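(* Let $\mathcal{B}\subseteq\mathcal{D}$ be a unital inclusion of unital $C^\ast$-algebras and let $(\mu,\nu)\in\Sigma_{\mathcal{B}:\mathcal{D}}\times\Sigma_{\mathcal{B}}$. Then $(\mu,\nu)$ is c-free infinitely divisible if and only if $\nu$ is $\boxplus$-infinitely divisible and the restriction of ${}^c\rho_{\mu,\nu}$ to $\mathcal{B}\langle\mathcal{X}\rangle_0$ satisfies: for all positive integers $n$ and all $f_1,\dots,f_n\in\mathcal{B}\langle\mathcal{X}\rangle_0$, $$\bigl[{}^c\rho_{\mu,\nu}(f_j^\ast f_i)\bigr]_{i,j=1}^n\ge0\quad\text{in } M_n(\mathcal{D}).$$
   Context: $\mathcal{B}\langle\mathcal{X}\rangle$ is the $\ast$-algebra freely generated by $\mathcal{B}$ and a selfadjoint symbol $\mathcal{X}$ (not assumed to commute with $\mathcal{B}$); $\mathcal{B}\langle\mathcal{X}\rangle_0$ is its $\ast$-subalgebra of polynomials without a free (constant) term; $\mathcal{B}\langle X_1,\dots,X_N\rangle$ is the $\ast$-algebra freely generated by $\mathcal{B}$ and non-commuting selfadjoint symbols $X_1,\dots,X_N$. $\Sigma_{\mathcal{B}}$ is the set of all positive conditional expectations $\mathcal{B}\langle\mathcal{X}\rangle\to\mathcal{B}$ (unital positive $\mathcal{B}$-bimodule maps). $\Sigma_{\mathcal{B}:\mathcal{D}}$ is the set of all unital positive $\mathcal{B}$-bimodule maps $\mu:\mathcal{B}\langle\mathcal{X}\rangle\to\mathcal{D}$ such that $[\mu(f_j^\ast f_i)]_{i,j=1}^n\ge0$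 in $M_n(\mathcal{D})$ for all $n$ and all $f_1,\dots,f_n\in\mathcal{B}\langle\mathcal{X}\rangle$. c-free cumulants: for $(\mu,\nu)\in\Sigma_{\mathcal{B}:\mathcal{D}}\times\Sigma_{\mathcal{B}}$ these are the multilinear maps ${}^c\kappa_{n,\mu,\nu}:\mathcal{B}^n\to\mathcal{D}$, $n\ge1$, defined recursively by $$\mu(\mathcal{X}b_1\cdots\mathcal{X}b_n)=\sum_{p=1}^n\ \sum_{0\le l_1<l_2<\dots<l_p=n-1}\mu(\mathcal{X}b_1\cdots\mathcal{X}b_{l_1})\cdot{}^c\kappa_{p,\mu,\nu}(Y_1,\dots,Y_{p-1},b_n),\qquad Y_s=b_{l_s+1}\,\nu(\mathcal{X}b_{l_s+2}\cdots\mathcal{X}b_{l_{s+1}}),$$ where $\mu$ and $\nu$ of the empty word are $1$. The map ${}^c\rho_{\mu,\nu}:\mathcal{B}\langle\mathcal{X}\rangle\to\mathcal{D}$ is the unital $\mathcal{B}$-bimodule map with ${}^c\rho_{\mu,\nu}(\mathcal{X}b_1\cdots\mathcal{X}b_n)={}^c\kappa_{n,\mu,\nu}(b_1,\dots,b_n)$ for all $n\ge1$. c-free additive convolution: given $(\mu_i,\nu_i)_{i=1}^N$ in $\Sigma_{\mathcal{B}:\mathcal{D}}\times\Sigma_{\mathcal{B}}$, let $\varphi:\mathcal{B}\langle X_1,\dots,X_N\rangle\to\mathcal{B}$ be a conditional expectation and $\theta:\mathcal{B}\langle X_1,\dots,X_N\rangle\to\mathcal{D}$ a unital $\mathcal{B}$-bimodule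 map whose restrictions to $\mathcal{B}\langle X_i\rangle\cong\mathcal{B}\langle\mathcal{X}\rangle$ are $\nu_i$ and $\mu_i$ respectively, determined by the requirement that $X_1,\dots,X_N$ be c-free with respect to $(\theta,\varphi)$: whenever $A_k\in\mathcal{B}\langle X_{\epsilon(k)}\rangle$ with $\epsilon(k)\ne\epsilon(k+1)$ and $\varphi(A_k)=0$ for all $k$, one has $\varphi(A_1\cdots A_m)=0$ and $\theta(A_1\cdots A_m)=\theta(A_1)\cdots\theta(A_m)$. With $\tau:\mathcal{B}\langle\mathcal{X}\rangle\to\mathcal{B}\langle X_1,\dots,X_N\rangle$ the homomorphism fixing $\mathcal{B}$ and sending $\mathcal{X}$ to $X_1+\dots+X_N$, the c-free additive convolution is the pair $(\theta\circ\tau,\varphi\circ\tau)$; its second component $\varphi\circ\tau$ is the free additive convolution $\boxplus_{i=1}^N\nu_i$. $\nu\in\Sigma_{\mathcal{B}}$ is $\boxplus$-infinitely divisible if for every positive integer $N$ there is $\nu_N\in\Sigma_{\mathcal{B}}$ such that $\nu$ is the free additive convolution of $N$ copies of $\nu_N$. $(\mu,\nu)$ is c-free infinitely divisible if for every positive integer $N$ there is $(\mu_N,\nu_N)\in\Sigma_{\mathcal{B}:\mathcal{D}}\times\Sigma_{\mathcal{B}}$ such that $(\mu,\nu)$ is the c-free additive convolution of $N$ copies of $(\mu_N,\nu_N)$. *)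

(* Defs.v *)
From HB Require Import structures.
From mathcomp Require Import all_boot all_order all_algebra generic_quotient zify.
From mathcomp Require Import boolp classical_sets reals.
From mathcomp.real_closed Require Import complex.

Set Implicit Arguments.
Unset Strict Implicit.
Unset Printing Implicit Defensive.

Import Order.TTheory GRing.Theory Num.Theory.
Local Open Scope ring_scope.
Local Open Scope quotient_scope.

HB.mixin Record hasStar (K : numClosedFieldType) A of GRing.Algebra K A := {
  star : A -> A;
  starK : involutive star;
  starD : {morph star : x y / x + y};
  starM : forall x y, star (x * y) = star y * star x;
  starZ : forall (a : K) x, star (a *: x) = a^* *: star x
}.

#[short(type="starAlgType")]
HB.structure Definition StarAlgebra (K : numClosedFieldType) :=
  {A of hasStar K A & GRing.Algebra K A}.

(* The norm is a separate field rather than an instance of `CompleteNormedModule`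
   because HB does not allow the join of that structure with rings to be
   declared above `numDomainType`. *)
HB.mixin Record isCStar (R : realType) A of StarAlgebra R[i] A := {
  cnorm : A -> R;
  cnorm0_eq0 : forall x, cnorm x = 0 -> x = 0;
  cnormD : forall x y, cnorm (x + y) <= cnorm x + cnorm y;
  cnormZ : forall (a : R[i]) x, cnorm (a *: x) = Normc.normc a * cnorm x;
  cnormM : forall x y, cnorm (x * y) <= cnorm x * cnorm y;
  cnorm_star : forall x, cnorm (star x * x) = cnorm x ^+ 2;
  cnorm_complete : forall u : nat -> A,
    (forall e : R, 0 < e -> exists N, forall m n,
       (N <= m)%N -> (N <= n)%N -> cnorm (u m - u n) < e) ->
    exists l, forall e : R, 0 < e -> exists N, forall n,
       (N <= n)%N -> cnorm (u n - l) < e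
}.

#[short(type="cstarAlgType")]
HB.structure Definition CStarAlgebra (R : realType) :=
  {A of isCStar R A & StarAlgebra R[i] A}.

Record unital_inclusion (R : realType) (B D : cstarAlgType R)
    (iota : {lrmorphism B -> D}) : Prop := {
  inclusion_star : forall b, iota (star b) = star (iota b);
  inclusion_norm : forall b, cnorm (iota b) = cnorm b
}.

Section Positivity.
Variables (K : numClosedFieldType) (A : starAlgType K).

Definition positive (a : A) : Prop := exists c : A, a = star c * c.

Definition mxstar n (M : 'M[A]_n) : 'M[A]_n := (map_mx star M)^T.

Definition mxpositive n (M : 'M[A]_n) : Prop :=
  exists C : 'M[A]_n, M = mxstar C *m C.

End Positivity.

(* `ncpoly I B` is the *-algebra freely generated by B and selfadjoint symbols
   indexed by I: formal expressions modulo the smallest congruence that makes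
   them a unital algebra in which the operations of B are those of B. *)
Section FreeAlgebra.
Variables (K : numClosedFieldType) (I : Type) (B : starAlgType K).

Inductive ncterm : Type :=
| Coef of B
| Var of I
| Add of ncterm & ncterm
| Opp of ncterm
| Mul of ncterm & ncterm.

Inductive nceq : ncterm -> ncterm -> Prop :=
| nceq_refl s : nceq s s
| nceq_sym s t : nceq s t -> nceq t s
| nceq_trans s t u : nceq s t -> nceq t u -> nceq s u
| nceq_add s s' t t' : nceq s s' -> nceq t t' -> nceq (Add s t) (Add s' t')
| nceq_opp s s' : nceq s s' -> nceq (Opp s) (Opp s')
| nceq_mul s s' t t' : nceq s s' -> nceq t t' -> nceq (Mul s t) (Mul s' t')
| nceq_addA s t u : nceq (Add s (Add t u)) (Add (Add s t) u)
| nceq_addC s t : nceq (Add s t) (Add t s)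
| nceq_add0 s : nceq (Add (Coef 0) s) s
| nceq_addN s : nceq (Add (Opp s) s) (Coef 0)
| nceq_mulA s t u : nceq (Mul s (Mul t u)) (Mul (Mul s t) u)
| nceq_mul1 s : nceq (Mul (Coef 1) s) s
| nceq_mulr1 s : nceq (Mul s (Coef 1)) s
| nceq_mulDl s t u : nceq (Mul (Add s t) u) (Add (Mul s u) (Mul t u))
| nceq_mulDr s t u : nceq (Mul s (Add t u)) (Add (Mul s t) (Mul s u))
| nceq_coefD a b : nceq (Coef (a + b)) (Add (Coef a) (Coef b))
| nceq_coefM a b : nceq (Coef (a * b)) (Mul (Coef a) (Coef b))
| nceq_scalar (k : K) s : nceq (Mul (Coef k%:A) s) (Mul s (Coef k%:A)).

HB.instance Definition _ := gen_eqMixin ncterm.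
HB.instance Definition _ := gen_choiceMixin ncterm.

Definition nceqb (s t : ncterm) : bool := `[< nceq s t >].

Lemma nceqb_refl : reflexive nceqb.
Proof. by move=> s; apply/asboolP; exact: nceq_refl. Qed.

Lemma nceqb_sym : symmetric nceqb.
Proof. by move=> s t; apply/asboolP/asboolP; exact: nceq_sym. Qed.

Lemma nceqb_trans : transitive nceqb.
Proof.
by move=> t s u /asboolP st /asboolP tu; apply/asboolP; exact: nceq_trans st tu.
Qed.

Canonical nceq_equiv := EquivRel nceqb nceqb_refl nceqb_sym nceqb_trans.

Definition ncpoly := {eq_quot nceq_equiv}.

HB.instance Definition _ := Choice.on ncpoly.

Definition ncpi (s : ncterm) : ncpoly := \pi_ncpoly s.

Lemma ncpiP s t : nceq s t -> ncpi s = ncpi t.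
Proof. by move=> st; apply/eqmodP/asboolP. Qed.

Lemma ncpi_eq s t : ncpi s = ncpi t -> nceq s t.
Proof. by move/eqmodP/asboolP. Qed.

Lemma ncpi_repr (f : ncpoly) : ncpi (repr f) = f.
Proof. exact: reprK. Qed.

Lemma nceq_repr s : nceq (repr (ncpi s)) s.
Proof. by apply: ncpi_eq; rewrite ncpi_repr. Qed.

Lemma ncpolyW (P : ncpoly -> Prop) :
  (forall s, P (ncpi s)) -> forall f, P f.
Proof. by move=> Pp f; rewrite -(ncpi_repr f). Qed.

Definition nccoef (b : B) : ncpoly := ncpi (Coef b).
Definition ncvar (i : I) : ncpoly := ncpi (Var i).
Definition ncadd (f g : ncpoly) := ncpi (Add (repr f) (repr g)).
Definition ncopp (f : ncpoly) := ncpi (Opp (repr f)).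
Definition ncmul (f g : ncpoly) := ncpi (Mul (repr f) (repr g)).
Definition ncscale (k : K) (f : ncpoly) := ncmul (nccoef k%:A) f.

Lemma ncpiD s t : ncpi (Add s t) = ncadd (ncpi s) (ncpi t).
Proof. by apply/ncpiP/nceq_sym/nceq_add; exact: nceq_repr. Qed.

Lemma ncpiN s : ncpi (Opp s) = ncopp (ncpi s).
Proof. by apply/ncpiP/nceq_sym/nceq_opp; exact: nceq_repr. Qed.

Lemma ncpiM s t : ncpi (Mul s t) = ncmul (ncpi s) (ncpi t).
Proof. by apply/ncpiP/nceq_sym/nceq_mul; exact: nceq_repr. Qed.

Lemma ncaddA : associative ncadd.
Proof.
elim/ncpolyW=> s; elim/ncpolyW=> t; elim/ncpolyW=> u.
by rewrite -!ncpiD; exact/ncpiP/nceq_addA.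
Qed.

Lemma ncaddC : commutative ncadd.
Proof.
elim/ncpolyW=> s; elim/ncpolyW=> t.
by rewrite -!ncpiD; exact/ncpiP/nceq_addC.
Qed.

Lemma ncadd0 : left_id (nccoef 0) ncadd.
Proof. by elim/ncpolyW=> s; rewrite -ncpiD; exact/ncpiP/nceq_add0. Qed.

Lemma ncaddN : left_inverse (nccoef 0) ncopp ncadd.
Proof. by elim/ncpolyW=> s; rewrite -ncpiN -ncpiD; exact/ncpiP/nceq_addN. Qed.

HB.instance Definition _ :=
  GRing.isZmodule.Build ncpoly ncaddA ncaddC ncadd0 ncaddN.

Lemma ncmulA : associative ncmul.
Proof.
elim/ncpolyW=> s; elim/ncpolyW=> t; elim/ncpolyW=> u.
by rewrite -!ncpiM; exact/ncpiP/nceq_mulA.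
Qed.

Lemma ncmul1 : left_id (nccoef 1) ncmul.
Proof. by elim/ncpolyW=> s; rewrite -ncpiM; exact/ncpiP/nceq_mul1. Qed.

Lemma ncmulr1 : right_id (nccoef 1) ncmul.
Proof. by elim/ncpolyW=> s; rewrite -ncpiM; exact/ncpiP/nceq_mulr1. Qed.

Lemma ncmulDl : left_distributive ncmul ncadd.
Proof.
elim/ncpolyW=> s; elim/ncpolyW=> t; elim/ncpolyW=> u.
by rewrite -!(ncpiM, ncpiD); exact/ncpiP/nceq_mulDl.
Qed.

Lemma ncmulDr : right_distributive ncmul ncadd.
Proof.
elim/ncpolyW=> s; elim/ncpolyW=> t; elim/ncpolyW=> u.
by rewrite -!(ncpiM, ncpiD); exact/ncpiP/nceq_mulDr.
Qed.

Section TermEval.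
Variables (A : algType K) (j : {lrmorphism B -> A}) (x : I -> A).

Fixpoint teval (s : ncterm) : A :=
  match s with
  | Coef b => j b
  | Var i => x i
  | Add s t => teval s + teval t
  | Opp s => - teval s
  | Mul s t => teval s * teval t
  end.

Lemma teval_nceq s t : nceq s t -> teval s = teval t.
Proof.
elim=> {s t} //=.
- by move=> s t u _ -> _ ->.
- by move=> s s' t t' _ -> _ ->.
- by move=> s s' _ ->.
- by move=> s s' t t' _ -> _ ->.
- by move=> s t u; rewrite addrA.
- by move=> s t; rewrite addrC.
- by move=> s; rewrite rmorph0 add0r.
- by move=> s; rewrite rmorph0 addNr.
- by move=> s t u; rewrite mulrA.
- by move=> s; rewrite rmorph1 mul1r.
- by move=> s; rewrite rmorph1 mulr1.
- by move=> s t u; rewrite mulrDl.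
- by move=> s t u; rewrite mulrDr.
- by move=> a b; rewrite rmorphD.
- by move=> a b; rewrite rmorphM.
- by move=> k s; rewrite linearZ /= rmorph1 -scalerAl mul1r -scalerAr mulr1.
Qed.

Definition nceval (f : ncpoly) : A := teval (repr f).

Lemma nceval_pi s : nceval (ncpi s) = teval s.
Proof. exact/teval_nceq/nceq_repr. Qed.

End TermEval.

Lemma ncone_neq0 : nccoef 1 != nccoef 0.
Proof.
apply/eqP => /(congr1 (nceval (idfun : {lrmorphism B -> B}) (fun=> 0))).
by rewrite !nceval_pi /= => /eqP; rewrite oner_eq0.
Qed.

HB.instance Definition _ := GRing.Zmodule_isNzRing.Build ncpoly
  ncmulA ncmul1 ncmulr1 ncmulDl ncmulDr ncone_neq0.

Lemma nccoefD : {morph nccoef : a b / a + b}.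
Proof. by move=> a b; rewrite /nccoef (ncpiP (nceq_coefD a b)) ncpiD. Qed.

Lemma nccoefM : {morph nccoef : a b / a * b}.
Proof. by move=> a b; rewrite /nccoef (ncpiP (nceq_coefM a b)) ncpiM. Qed.

Lemma ncscaleA (k l : K) f : ncscale k (ncscale l f) = ncscale (k * l) f.
Proof.
rewrite /ncscale ncmulA -[ncmul (nccoef k%:A) _]/(nccoef k%:A * nccoef l%:A).
by rewrite -nccoefM -scalerAl mul1r scalerA.
Qed.

Lemma ncscale1 : left_id 1 ncscale.
Proof. by move=> f; rewrite /ncscale scale1r ncmul1. Qed.

Lemma ncscaleDr : right_distributive ncscale +%R.
Proof. by move=> k f g; exact: ncmulDr. Qed.

Lemma ncscaleDl f : {morph ncscale^~ f : k l / k + l}.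
Proof. by move=> k l; rewrite /ncscale scalerDl nccoefD; exact: ncmulDl. Qed.

HB.instance Definition _ := GRing.Zmodule_isLmodule.Build K ncpoly
  ncscaleA ncscale1 ncscaleDr ncscaleDl.

Lemma ncscaleE (k : K) f : k *: f = nccoef k%:A * f.
Proof. by []. Qed.

Lemma ncscaleAl (k : K) (f g : ncpoly) : k *: (f * g) = (k *: f) * g.
Proof. exact: ncmulA. Qed.

HB.instance Definition _ :=
  GRing.Lmodule_isLalgebra.Build K ncpoly ncscaleAl.

Lemma ncscaleAr (k : K) (f g : ncpoly) : k *: (f * g) = f * (k *: g).
Proof.
have central (h : ncpoly) : nccoef k%:A * h = h * nccoef k%:A.
  elim/ncpolyW: h => s; rewrite /GRing.mul /= /nccoef -!ncpiM.
  exact/ncpiP/nceq_scalar.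
by rewrite !ncscaleE mulrA central -mulrA.
Qed.

HB.instance Definition _ := GRing.Lalgebra_isAlgebra.Build K ncpoly ncscaleAr.

Lemma nccoef_is_zmod_morphism : zmod_morphism nccoef.
Proof.
by move=> a b; apply: (addIr (nccoef b)); rewrite -nccoefD !subrK.
Qed.

HB.instance Definition _ :=
  GRing.isZmodMorphism.Build B ncpoly nccoef nccoef_is_zmod_morphism.

Lemma nccoef_is_monoid_morphism : monoid_morphism nccoef.
Proof. by split => //; exact: nccoefM. Qed.

HB.instance Definition _ :=
  GRing.isMonoidMorphism.Build B ncpoly nccoef nccoef_is_monoid_morphism.

Lemma nccoef_is_scalable : scalable nccoef.
Proof. by move=> k b; rewrite -[b in LHS]mul1r scalerAl nccoefM. Qed.

HB.instance Definition _ :=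
  GRing.isScalable.Build K B ncpoly *:%R nccoef nccoef_is_scalable.

Section Eval.
Variables (A : algType K) (j : {lrmorphism B -> A}) (x : I -> A).

Lemma ncevalC b : nceval j x (nccoef b) = j b.
Proof. exact: nceval_pi. Qed.

Lemma ncevalX i : nceval j x (ncvar i) = x i.
Proof. exact: nceval_pi. Qed.

Lemma nceval_is_zmod_morphism : zmod_morphism (nceval j x).
Proof.
elim/ncpolyW=> s; elim/ncpolyW=> t.
by rewrite /GRing.add /GRing.opp /= -ncpiN -ncpiD !nceval_pi.
Qed.

HB.instance Definition _ :=
  GRing.isZmodMorphism.Build ncpoly A (nceval j x) nceval_is_zmod_morphism.

Lemma nceval_is_monoid_morphism : monoid_morphism (nceval j x).
Proof.
split; first by rewrite [1]/(nccoef 1) ncevalC rmorph1.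
elim/ncpolyW=> s; elim/ncpolyW=> t.
by rewrite /GRing.mul /= -ncpiM !nceval_pi.
Qed.

HB.instance Definition _ :=
  GRing.isMonoidMorphism.Build ncpoly A (nceval j x) nceval_is_monoid_morphism.

Lemma nceval_is_scalable : scalable (nceval j x).
Proof.
move=> k f; rewrite ncscaleE rmorphM /= ncevalC.
by rewrite linearZ /= rmorph1 -scalerAl mul1r.
Qed.

HB.instance Definition _ :=
  GRing.isScalable.Build K ncpoly A *:%R (nceval j x) nceval_is_scalable.

End Eval.

Fixpoint tstar (s : ncterm) : ncterm :=
  match s with
  | Coef b => Coef (star b)
  | Var i => Var i
  | Add s t => Add (tstar s) (tstar t)
  | Opp s => Opp (tstar s)
  | Mul s t => Mul (tstar t) (tstar s)
  end.

Lemma star0 : star (0 : B) = 0.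
Proof. by apply: (addrI (star (0 : B))); rewrite -starD !addr0. Qed.

Lemma star1 : star (1 : B) = 1.
Proof. by rewrite -[LHS]mulr1 -{2}[1]starK -starM mulr1 starK. Qed.

Lemma tstar_nceq s t : nceq s t -> nceq (tstar s) (tstar t).
Proof.
elim=> {s t} /=; try by move=> *; constructor.
- by move=> s t u _ st _ tu; exact: nceq_trans st tu.
- by move=> s; rewrite star0; constructor.
- by move=> s; rewrite star0; constructor.
- by move=> s t u; apply: nceq_sym; constructor.
- by move=> s; rewrite star1; constructor.
- by move=> s; rewrite star1; constructor.
- by move=> a b; rewrite starD; constructor.
- by move=> a b; rewrite starM; constructor.
- by move=> k s; rewrite starZ star1; apply: nceq_sym; constructor.
Qed.

Lemma tstarK : involutive tstar.
Proof.
by elim=> /= [b|i|s -> t ->|s ->|s -> t ->] //; rewrite starK.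
Qed.

Definition ncstar (f : ncpoly) : ncpoly := ncpi (tstar (repr f)).

Lemma ncstar_pi s : ncstar (ncpi s) = ncpi (tstar s).
Proof. exact/ncpiP/tstar_nceq/nceq_repr. Qed.

Lemma ncstarK : involutive ncstar.
Proof. by elim/ncpolyW=> s; rewrite !ncstar_pi tstarK. Qed.

Lemma ncstarD : {morph ncstar : f g / f + g}.
Proof.
elim/ncpolyW=> s; elim/ncpolyW=> t.
by rewrite /GRing.add /= -ncpiD !ncstar_pi -ncpiD.
Qed.

Lemma ncstarM f g : ncstar (f * g) = ncstar g * ncstar f.
Proof.
elim/ncpolyW: f => s; elim/ncpolyW: g => t.
by rewrite /GRing.mul /= -ncpiM !ncstar_pi -ncpiM.
Qed.

Lemma ncstarZ (k : K) f : ncstar (k *: f) = k^* *: ncstar f.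
Proof.
rewrite ncscaleE ncstarM /nccoef ncstar_pi /= starZ star1.
by rewrite -[ncpi _]/(nccoef _) linearZ /= rmorph1 -scalerAr mulr1.
Qed.

HB.instance Definition _ :=
  hasStar.Build K ncpoly ncstarK ncstarD ncstarM ncstarZ.

Definition nc_constant_term (f : ncpoly) : B :=
  nceval (idfun : {lrmorphism B -> B}) (fun=> 0) f.

End FreeAlgebra.

Section Maps.
Variables (K : numClosedFieldType) (B D : starAlgType K).

Record unital_bimodule_map I (iota : B -> D) (phi : ncpoly I B -> D) : Prop := {
  bimodule_map_linear : linear phi;
  bimodule_map1 : phi 1 = 1;
  bimodule_mapM : forall b f c,
    phi (nccoef I b * f * nccoef I c) = iota b * phi f * iota c
}.

End Maps.

Notation conditional_expectation := (unital_bimodule_map idfun).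

Section Sigma.
Variables (K : numClosedFieldType) (B D : starAlgType K).

Definition SigmaB (nu : ncpoly unit B -> B) : Prop :=
  conditional_expectation nu /\ forall f, positive (nu (star f * f)).

(* The index j of f_j^* is the row index. With i as the row index, positivity of
   all the matrices would already fail for B = D = M_2(C), f_1 = E_11 and
   f_2 = E_12. *)
Definition gram (rho : ncpoly unit B -> D) n (f : 'I_n -> ncpoly unit B)
  : 'M[D]_n := \matrix_(j, i) rho (star (f j) * f i).

Definition SigmaBD (iota : B -> D) (mu : ncpoly unit B -> D) : Prop :=
  [/\ unital_bimodule_map iota mu,
      forall f, positive (mu (star f * f)) &
      forall n (f : 'I_n -> ncpoly unit B), mxpositive (gram mu f)].

End Sigma.

Section Cumulants.
Variables (K : numClosedFieldType) (B D : starAlgType K).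

Definition xword (bs : seq B) : ncpoly unit B :=
  \prod_(b <- bs) (ncvar B tt * nccoef unit b).

Definition slice (bs : seq B) i j : seq B := take (j - i) (drop i bs).

(* With the 0-based indexing of `seq`, `bs`_i` is b_{i+1} and `slice bs i j` is
   b_{i+1}, ..., b_j; the sequence l is l_1, ..., l_p, and `cblock nu bs l s` is
   Y_{s+1}. *)
Definition cchain n (l : seq nat) : bool :=
  sorted ltn l && (last 0%N l == n.-1).

Definition cblock (nu : ncpoly unit B -> B) (bs : seq B) (l : seq nat) s : B :=
  bs`_(nth 0%N l s) *
  nu (xword (slice bs (nth 0%N l s).+1 (nth 0%N l s.+1))).

Definition cargs (nu : ncpoly unit B -> B) (bs : seq B) (l : seq nat) : seq B :=
  rcons (mkseq (cblock nu bs l) (size l).-1) (last 0 bs).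

Variables (mu : ncpoly unit B -> D) (nu : ncpoly unit B -> B).

Fixpoint ckappa_rec fuel (bs : seq B) : D :=
  if fuel is fuel'.+1 then
    mu (xword bs) -
    \sum_(1 <= p < size bs)
      \sum_(l : p.-tuple 'I_(size bs) | cchain (size bs) (map val l))
        mu (xword (take (head 0%N (map val l)) bs)) *
        ckappa_rec fuel' (cargs nu bs (map val l))
  else 0.

(* `ckappa [:: b_1; ...; b_n]` is the c-free cumulant of order n at b_1, ..., b_n.
   Its defining recursion has this value as the term p = n of a sum over
   1 <= p <= n; that form is `ckappaE` below. *)
Definition ckappa (bs : seq B) : D := ckappa_rec (size bs) bs.

End Cumulants.

Section CumulantTheory.
Variables (K : numClosedFieldType) (B D : starAlgType K).
Variables (mu : ncpoly unit B -> D) (nu : ncpoly unit B -> B).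

Lemma size_cargs bs l : size (cargs nu bs l) = (size l).-1.+1.
Proof. by rewrite size_rcons size_mkseq. Qed.

Lemma ckappa_rec_fuel k k' bs : (0 < size bs <= k)%N -> (size bs <= k')%N ->
  ckappa_rec mu nu k bs = ckappa_rec mu nu k' bs.
Proof.
elim: k k' bs => [|k IH] [|k'] [|b bs] // /andP[_ bsk] bsk'.
rewrite [LHS]/= [RHS]/=; congr (_ - _); apply: eq_big_nat => p /andP[p0 pn].
apply: eq_bigr => l _; congr (_ * _).
have szc : size (cargs nu (b :: bs) (map val l)) = p.
  by rewrite size_cargs size_map size_tuple prednK.
have pn' : (p <= size bs)%N by rewrite -ltnS.
by apply: IH; rewrite szc ?p0 (leq_trans pn').
Qed.

Lemma ckappa_unfold bs : bs != [::] ->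
  ckappa mu nu bs = mu (xword bs) -
    \sum_(1 <= p < size bs)
      \sum_(l : p.-tuple 'I_(size bs) | cchain (size bs) (map val l))
        mu (xword (take (head 0%N (map val l)) bs)) *
        ckappa mu nu (cargs nu bs (map val l)).
Proof.
rewrite /ckappa; case: bs => // b bs _; rewrite [LHS]/=; congr (_ - _).
apply: eq_big_nat => p /andP[p0 pn]; apply: eq_bigr => l _; congr (_ * _).
have pn' : (p <= size bs)%N by rewrite -ltnS.
by apply: ckappa_rec_fuel; rewrite size_cargs size_map size_tuple prednK ?p0.
Qed.

Lemma xword_nil : xword [::] = 1 :> ncpoly unit B.
Proof. by rewrite /xword big_nil. Qed.

Lemma ord_chain n (l : n.-tuple 'I_n) :
  sorted ltn (map val l) -> map val l = iota 0 n.
Proof.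
move=> sl.
apply: (irr_sorted_eq ltn_trans ltnn sl (iota_ltn_sorted 0 n)).
have sub : {subset map val l <= iota 0 n}.
  by move=> _ /mapP[i _ ->]; rewrite mem_iota /= add0n.
have ul := sorted_uniq ltn_trans ltnn sl.
by have [] := uniq_min_size ul sub; rewrite ?size_iota ?size_map ?size_tuple.
Qed.

Lemma cargs_iota bs : nu 1 = 1 -> bs != [::] ->
  cargs nu bs (iota 0 (size bs)) = bs.
Proof.
move=> nu1; case/lastP: bs => // bs b _.
rewrite /cargs last_rcons size_iota; congr rcons.
apply: (@eq_from_nth _ 0); first by rewrite size_mkseq size_rcons.
rewrite size_mkseq size_rcons => i ib; rewrite nth_mkseq // /cblock /slice.
have iE k : (k <= size bs)%N -> nth 0%N (iota 0 (size bs).+1) k = k.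
  by move=> kb; rewrite nth_iota ?add0n.
rewrite iE ?(ltnW ib) // iE //.
by rewrite subnn take0 xword_nil nu1 mulr1 nth_rcons ib.
Qed.

Lemma ckappaE bs : mu 1 = 1 -> nu 1 = 1 -> bs != [::] ->
  mu (xword bs) =
    \sum_(1 <= p < (size bs).+1)
      \sum_(l : p.-tuple 'I_(size bs) | cchain (size bs) (map val l))
        mu (xword (take (head 0%N (map val l)) bs)) *
        ckappa mu nu (cargs nu bs (map val l)).
Proof.
move=> mu1 nu1 bs0.
have n0 : (0 < size bs)%N by case: bs bs0.
rewrite big_nat_recr //=.
have itup : size (map val (ord_tuple (size bs))) = size bs.
  by rewrite size_map size_tuple.
rewrite (big_pred1 (ord_tuple (size bs))) => [|l]; last first.
  rewrite /cchain; apply/andP/eqP => [[sl _]|->].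
    apply/val_inj/(inj_map val_inj); rewrite (ord_chain sl).
    by rewrite /= val_enum_ord.
  rewrite /= val_enum_ord iota_ltn_sorted; split => //.
  by rewrite -nth_last size_iota nth_iota ?add0n // ltn_predL.
rewrite /= val_enum_ord cargs_iota //.
have -> : head 0%N (iota 0 (size bs)) = 0%N by case: (size bs).
by rewrite take0 xword_nil mu1 mul1r ckappa_unfold // subrKC.
Qed.

End CumulantTheory.

Section Multilinear.
Variables (K : numClosedFieldType) (B : starAlgType K).

Definition slot (k : K) i (x y z : seq B) : Prop :=
  [/\ size y = size x, size z = size x, (i < size x)%N,
      forall m, m != i -> y`_m = x`_m /\ z`_m = x`_m &
      z`_i = k *: x`_i + y`_i].

Definition multilinear (V : lmodType K) (F : seq B -> V) : Prop :=
  forall k i x y z, slot k i x y z -> F z = k *: F x + F y.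

Lemma slot_catP k i x y z : slot k i x y z -> exists u b c v,
  [/\ x = u ++ b :: v, y = u ++ c :: v & z = u ++ (k *: b + c) :: v].
Proof.
move=> [sy sz ix yz zi].
have eqx (t : seq B) : size t = size x ->
    (forall m, m != i -> t`_m = x`_m) ->
    t = take i x ++ t`_i :: drop i.+1 x.
  move=> st tx; rewrite -[LHS](cat_take_drop i) (drop_nth 0) ?st //.
  congr (_ ++ _ :: _).
    apply: (@eq_from_nth _ 0); rewrite !size_take st // ix => m mi.
    by rewrite !nth_take // tx // ltn_eqF.
  apply: (@eq_from_nth _ 0); rewrite !size_drop st // => m _.
  by rewrite !nth_drop tx // gtn_eqF // addSn ltnS leq_addr.
exists (take i x), x`_i, y`_i, (drop i.+1 x); split.
- exact: eqx.
- by apply: eqx => // m /yz[].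
- by rewrite -zi; apply: eqx => // m /yz[].
Qed.

Lemma slot_cat k u b c v :
  slot k (size u) (u ++ b :: v) (u ++ c :: v) (u ++ (k *: b + c) :: v).
Proof.
split; rewrite ?size_cat //=; first by rewrite addnS ltnS leq_addr.
  move=> m mu; rewrite !nth_cat; case: ltnP => // um.
  by case E: (m - size u)%N => [|j] //; move: mu; rewrite eqn_leq um -subn_eq0 E.
by rewrite !nth_cat ltnn subnn.
Qed.

Lemma multilinearP (V : lmodType K) (F : seq B -> V) :
  multilinear F <->
  forall k u b c v, F (u ++ (k *: b + c) :: v) =
    k *: F (u ++ b :: v) + F (u ++ c :: v).
Proof.
split=> [Flin k u b c v|Flin k i x y z]; first exact: Flin (slot_cat _ _ _ _ _).
by move/slot_catP=> [u [b [c [v [-> -> ->]]]]].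
Qed.

Lemma nth_slice (bs : seq B) i j m :
  (slice bs i j)`_m = if (m < j - i)%N then bs`_(i + m) else 0.
Proof.
rewrite /slice; case: ltnP => mj; first by rewrite nth_take // nth_drop.
by rewrite nth_default // size_take; case: ltnP => // /leq_trans; apply.
Qed.

Lemma size_slice (bs : seq B) i j :
  size (slice bs i j) = minn (j - i) (size bs - i).
Proof. by rewrite /slice size_take_min size_drop. Qed.

Lemma slot_slice k i x y z a b : slot k i x y z -> (a <= i < b)%N ->
  slot k (i - a) (slice x a b) (slice y a b) (slice z a b).
Proof.
move=> [sy sz ix yz zi] aib; split; rewrite ?size_slice ?sy ?sz //; first by lia.
  move=> m mi; rewrite !nth_slice; case: ifP => // _; apply: yz; lia.
rewrite !nth_slice.
have -> : (a + (i - a) = i)%N by lia.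
by case: ltnP => //; lia.
Qed.

Lemma slice_out k i x y z a b : slot k i x y z -> ~~ (a <= i < b)%N ->
  slice y a b = slice x a b /\ slice z a b = slice x a b.
Proof.
move=> [sy sz ix yz zi] aib.
split; apply: (@eq_from_nth _ 0); rewrite !size_slice ?sy ?sz // => m _;
  rewrite !nth_slice; case: ifP => // mb;
  by have [] := yz (a + m)%N ltac:(lia).
Qed.

Lemma sliceE0 (bs : seq B) j : slice bs 0 j = take j bs.
Proof. by rewrite /slice drop0 subn0. Qed.

Lemma nccoefZ (k : K) (b : B) : nccoef unit (k *: b) = k *: nccoef unit b.
Proof. exact: linearZ. Qed.

Lemma xword_cat (u v : seq B) : xword (u ++ v) = xword u * xword v.
Proof. by rewrite /xword big_cat. Qed.

Lemma xword_cons b (v : seq B) :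
  xword (b :: v) = ncvar B tt * nccoef unit b * xword v.
Proof. by rewrite /xword big_cons. Qed.

Lemma xword_multilinear (V : lmodType K) (phi : ncpoly unit B -> V) :
  linear phi -> multilinear (phi \o @xword K B).
Proof.
move=> philin; apply/multilinearP => k u b c v /=.
rewrite -philin !xword_cat !xword_cons; congr phi.
rewrite nccoefD nccoefZ mulrDr mulrDl mulrDr.
by rewrite -scalerAr -scalerAl -scalerAr.
Qed.

End Multilinear.

Section CumulantMultilinear.
Variables (K : numClosedFieldType) (B D : starAlgType K).
Variables (iota : {lrmorphism B -> D}).
Variables (mu : ncpoly unit B -> D) (nu : ncpoly unit B -> B).
Hypothesis mu_bimod : unital_bimodule_map iota mu.
Hypothesis nu_lin : linear nu.

Lemma cblock_slot k i x y z l s :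
  slot k i x y z -> (nth 0%N l s <= i < nth 0%N l s.+1)%N ->
  cblock nu z l s = k *: cblock nu x l s + cblock nu y l s.
Proof.
rewrite /cblock; set u := nth _ _ s; set v := nth _ _ s.+1 => sl uiv.
have [sy sz ix yz zi] := sl.
have [iu|iu] := eqVneq i u.
  have [-> ->] := slice_out (a := u.+1) (b := v) sl ltac:(lia).
  by rewrite -iu zi mulrDl scalerAl.
have ui : u != i by lia.
have [-> ->] := yz _ ui.
have /= -> := xword_multilinear nu_lin (slot_slice (a := u.+1) (b := v) sl ltac:(lia)).
by rewrite mulrDr scalerAr.
Qed.

Lemma cblock_out k i x y z l s : slot k i x y z ->
  ~~ (nth 0%N l s <= i < nth 0%N l s.+1)%N ->
  (nth 0%N l s < nth 0%N l s.+1)%N ->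
  cblock nu y l s = cblock nu x l s /\ cblock nu z l s = cblock nu x l s.
Proof.
rewrite /cblock; set u := nth _ _ s; set v := nth _ _ s.+1 => sl uiv uv.
have [sy sz ix yz zi] := sl.
have [-> ->] := slice_out (a := u.+1) (b := v) sl ltac:(lia).
by have [-> ->] := yz u ltac:(lia).
Qed.

Lemma nth_cargs (bs : seq B) l s : (s < size l)%N ->
  (cargs nu bs l)`_s =
    if (s.+1 < size l)%N then cblock nu bs l s else bs`_(size bs).-1.
Proof.
move=> sl; rewrite /cargs nth_rcons size_mkseq.
case: (ltnP s.+1 (size l)) => sl'; first by rewrite ifT ?nth_mkseq //; lia.
by rewrite ifF ?ifT ?nth_last //; lia.
Qed.

Lemma chain_ltn l m m' :
  sorted ltn l -> (m < m')%N -> (m' < size l)%N -> (nth 0%N l m < nth 0%N l m')%N.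
Proof.
move=> sl mm ml; apply: (sorted_ltn_nth ltn_trans 0%N sl) => //.
by rewrite inE (ltn_trans mm).
Qed.

Lemma chain_leq l m m' :
  sorted ltn l -> (m <= m')%N -> (m' < size l)%N -> (nth 0%N l m <= nth 0%N l m')%N.
Proof.
rewrite leq_eqVlt => sl /orP[/eqP -> //|mm] ml.
exact/ltnW/chain_ltn.
Qed.

Lemma cargs_slot k i x y z l : slot k i x y z ->
  (0 < size l)%N -> cchain (size x) l -> (nth 0%N l 0 <= i)%N ->
  exists s, slot k s (cargs nu x l) (cargs nu y l) (cargs nu z l).
Proof.
move=> sl l0 /andP[lsort /eqP llast] l0i.
have [sy sz ix yz zi] := sl.
have last_nth : nth 0%N l (size l).-1 = (size x).-1 by rewrite nth_last.
pose P s := (s < size l)%N && (nth 0%N l s <= i)%N.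
have exP : exists s, P s by exists 0%N; rewrite /P l0.
have bP s : P s -> (s <= size l)%N by case/andP => /ltnW.
case: (ex_maxnP exP bP) => s /andP[ssz lsi] smax.
have si : (s.+1 < size l)%N -> (i < nth 0%N l s.+1)%N.
  move=> s1; rewrite ltnNge; apply/negP => lei.
  by have := smax s.+1; rewrite /P s1 lei ltnn => /(_ isT).
exists s; rewrite /slot !size_cargs prednK //; split => //.
  move=> m ms; case: (ltnP m (size l)) => ml; last first.
    by rewrite !nth_default // size_cargs prednK.
  rewrite !nth_cargs //; case: ifP => m1.
    have mm1 := chain_ltn lsort (ltnSn m) m1.
    apply: (cblock_out sl) => //.
    case: (ltngtP m s) ms => // cms _.
      have := chain_leq lsort cms ssz; lia.
    have := chain_leq lsort cms ml.
    have := si (leq_ltn_trans cms ml); lia.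
  rewrite sy sz; apply: yz.
  have mE : m = (size l).-1 by lia.
  have sm : (s < m)%N by lia.
  have := chain_leq lsort sm ml; have := si (leq_ltn_trans sm ml).
  by rewrite mE last_nth; lia.
rewrite !nth_cargs //; case: ifP => s1.
  by apply: (cblock_slot sl); rewrite lsi si.
have sE : s = (size l).-1 by lia.
move: lsi; rewrite sE last_nth sy sz => lsi.
by have -> : (size x).-1 = i by lia.
Qed.

Lemma cargs_out k i x y z l : slot k i x y z ->
  (0 < size l)%N -> cchain (size x) l -> (i < nth 0%N l 0)%N ->
  cargs nu y l = cargs nu x l /\ cargs nu z l = cargs nu x l.
Proof.
move=> sl l0 /andP[lsort /eqP llast] il0.
have [sy sz ix yz zi] := sl.
have last_nth : nth 0%N l (size l).-1 = (size x).-1 by rewrite nth_last.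
have H s : (s < size l)%N -> (cargs nu y l)`_s = (cargs nu x l)`_s /\
                             (cargs nu z l)`_s = (cargs nu x l)`_s.
  move=> ssz; have l0s := chain_leq lsort (leq0n s) ssz.
  rewrite !nth_cargs //; case: ifP => s1.
    have mm1 := chain_ltn lsort (ltnSn s) s1.
    by apply: (cblock_out sl) => //; lia.
  rewrite sy sz; apply: yz.
  by have sE : s = (size l).-1; [lia|rewrite -last_nth -sE; lia].
by split; apply: (@eq_from_nth _ 0); rewrite !size_cargs prednK // => s /H[].
Qed.

Lemma ckappa_unfold_size n bs : size bs = n -> bs != [::] ->
  ckappa mu nu bs = mu (xword bs) -
    \sum_(1 <= p < n) \sum_(l : p.-tuple 'I_n | cchain n (map val l))
        mu (xword (take (head 0%N (map val l)) bs)) *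
        ckappa mu nu (cargs nu bs (map val l)).
Proof. by move=> <-; exact: ckappa_unfold. Qed.

Lemma ckappa_multilinear : multilinear (ckappa mu nu).
Proof.
have mu_lin := bimodule_map_linear mu_bimod.
move=> k i x; move: {2}(size x) (leqnn (size x)) => n.
elim: n i x => [|n IH] i x xn y z sl; have [sy sz ix yz zi] := sl.
  by move: xn ix; rewrite leqn0 => /eqP ->.
have nnil (t : seq B) : size t = size x -> t != [::].
  by case: t => // sx; rewrite -sx in ix.
rewrite !(@ckappa_unfold_size (size x)) ?nnil //.
have /= -> := xword_multilinear mu_lin sl.
rewrite scalerBr scaler_sumr -!addrA; congr (_ + _).
rewrite [RHS]addrCA; congr (_ + _); rewrite -opprD; congr (- _).
rewrite -big_split /=; apply: eq_big_nat => p /andP[p0 pn].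
rewrite scaler_sumr -big_split /=; apply: eq_bigr => l lc.
set l' := map val l in lc *.
have szl : size l' = p by rewrite size_map size_tuple.
have l0 : (0 < size l')%N by rewrite szl.
rewrite -nth0.
case: (ltnP i (nth 0%N l' 0)) => il.
  have [-> ->] := cargs_out sl l0 lc il.
  have := slot_slice (a := 0) (b := nth 0%N l' 0) sl; rewrite il /= !sliceE0.
  move=> /(_ isT) /(xword_multilinear mu_lin) /= ->.
  by rewrite mulrDl scalerAl.
have := slice_out (a := 0) (b := nth 0%N l' 0) sl; rewrite ltnNge il /= !sliceE0.
move=> /(_ isT) [-> ->].
have [s slc] := cargs_slot sl l0 lc il.
rewrite (IH _ _ _ _ _ slc) ?mulrDr ?scalerAr //.
by rewrite size_cargs szl prednK //; lia.
Qed.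

Lemma bimod_right f b : mu (f * nccoef unit b) = mu f * iota b.
Proof.
have := bimodule_mapM mu_bimod 1 f b.
by rewrite !rmorph1 !mul1r.
Qed.

Lemma xword_rcons w (b : B) :
  xword (rcons w b) = xword w * (ncvar B tt * nccoef unit b).
Proof. by rewrite -cats1 xword_cat xword_cons xword_nil mulr1. Qed.

Lemma ckappa_right w c b :
  ckappa mu nu (rcons w (c * b)) = ckappa mu nu (rcons w c) * iota b.
Proof.
have mu_lin := bimodule_map_linear mu_bimod.
move: {2}(size w) (leqnn (size w)) => n.
elim: n w c => [|n IH] w c wn; rewrite !(@ckappa_unfold_size (size w).+1) ?size_rcons //;
  try by case: (w).
  move: wn; rewrite leqn0 => /nilP -> /=.
  rewrite !big_geq // !subr0 !xword_cons !xword_nil !mulr1.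
  by rewrite -bimod_right rmorphM mulrA.
rewrite mulrBl; congr (_ - _).
  by rewrite !xword_rcons -bimod_right rmorphM !mulrA.
rewrite mulr_suml; apply: eq_big_nat => p /andP[p0 pn].
rewrite mulr_suml; apply: eq_bigr => l /andP[lsort /eqP llast].
set l' := map val l in lsort llast *.
have szl : size l' = p by rewrite size_map size_tuple.
have last_nth : nth 0%N l' (size l').-1 = size w by rewrite nth_last.
have takew d : take (head 0%N l') (rcons w d) = take (head 0%N l') w.
  rewrite -cats1 takel_cat // -nth0 -last_nth.
  by apply: chain_leq; rewrite ?szl ?prednK.
have cargsw d : cargs nu (rcons w d) l' = rcons (mkseq (cblock nu w l') p.-1) d.
  rewrite /cargs last_rcons szl; congr rcons.
  apply: (@eq_from_nth _ 0); rewrite !size_mkseq // => s sp.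
  rewrite !nth_mkseq // /cblock.
  have s1 : (s.+1 < size l')%N by rewrite szl -ltn_predRL.
  have lss := chain_ltn lsort (ltnSn s) s1.
  have lw : (nth 0%N l' s.+1 <= size w)%N.
    by rewrite -last_nth; apply: chain_leq => //; rewrite szl; lia.
  rewrite nth_rcons (leq_trans lss lw).
  move: lss lw; set u := nth _ _ s; set v := nth _ _ s.+1 => lss lw.
  congr (_ * nu (xword _)); apply: (@eq_from_nth _ 0) => [|m _].
    rewrite !size_slice size_rcons (minn_idPl _) ?leq_sub2r //; last exact: leqW.
    by rewrite (minn_idPl _) ?leq_sub2r.
  rewrite !nth_slice; case: ifP => // ms; rewrite nth_rcons ifT //.
  by apply: leq_trans lw; lia.
rewrite !takew !cargsw -mulrA; congr (_ * _).
by apply: IH; rewrite size_mkseq; lia.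
Qed.

End CumulantMultilinear.

Section Rho.
Variables (K : numClosedFieldType) (B D : starAlgType K).

Definition is_crho (iota : B -> D) (mu : ncpoly unit B -> D)
    (nu : ncpoly unit B -> B) (rho : ncpoly unit B -> D) : Prop :=
  unital_bimodule_map iota rho /\
  forall bs : seq B, bs != [::] -> rho (xword bs) = ckappa mu nu bs.

(* The map satisfying `is_crho` exists (`crhoP`) and is unique
   (`is_crho_unique`). *)
Definition crho (iota : B -> D) (mu : ncpoly unit B -> D)
    (nu : ncpoly unit B -> B) : ncpoly unit B -> D :=
  xget (fun=> 0) [set rho | is_crho iota mu nu rho]%classic.

Section Action.
Variable iota : {lrmorphism B -> D}.

(* If F [:: b_0; ...; b_n] is the value of a linear map at the monomial
   b_0 X b_1 ... X b_n, then `tact s F` gives the values of its composition with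
   the left multiplication by s. *)
Fixpoint tact (s : ncterm unit B) (F : seq B -> D) (w : seq B) : D :=
  match s with
  | Coef b => if w is c :: w' then F (b * c :: w') else 0
  | Var _ => F (1 :: w)
  | Add s t => tact s F w + tact t F w
  | Opp s => - tact s F w
  | Mul s t => tact t (tact s F) w
  end.

Definition cat_linear (F : seq B -> D) : Prop := forall k u b c v,
  F (u ++ (k *: b + c) :: v) = k *: F (u ++ b :: v) + F (u ++ c :: v).

Lemma tact_linear s F : cat_linear F -> cat_linear (tact s F).
Proof.
elim: s F => [d|i|s IHs t IHt|s IHs|s IHs t IHt] F Flin k u b c v /=.
- case: u => [|e u] /=; last exact: (Flin k (d * e :: u)).
  by rewrite mulrDr -scalerAr (Flin k [::]).
- exact: (Flin k (1 :: u)).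
- by rewrite IHs // IHt // scalerDr addrACA.
- by rewrite IHs // scalerN opprD.
- by apply: IHt; exact: IHs.
Qed.

Lemma eq_tact s F G : (forall w, w != [::] -> F w = G w) ->
  forall w, w != [::] -> tact s F w = tact s G w.
Proof.
elim: s F G => [d|i|s IHs t IHt|s IHs|s IHs t IHt] F G FG w w0 /=.
- by case: w w0 => // c w _; exact: FG.
- exact: FG.
- by rewrite (IHs _ _ FG) // (IHt _ _ FG).
- by rewrite (IHs _ _ FG).
- by apply: IHt => // w' w'0; exact: IHs.
Qed.

Lemma cat_linear0 F v : cat_linear F -> F (0 :: v) = 0.
Proof.
move=> Flin; have := Flin 1 [::] 0 0 v; rewrite /= !scale1r addr0 => /esym.
by move/(canRL (addrK _)); rewrite subrr.
Qed.

Lemma cat_linearZ F k u b v : cat_linear F ->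
  F (u ++ k *: b :: v) = k *: F (u ++ b :: v).
Proof.
move=> Flin; have := Flin 0 u b (k *: b) v.
have := Flin 1 u 0 0 v; rewrite scaler0 addr0 scale1r => /esym.
move/(canRL (addrK _)); rewrite subrr => F0 _.
by have := Flin k u b 0 v; rewrite F0 !addr0.
Qed.

Lemma tact_add u F G H :
  (forall w, w != [::] -> H w = F w + G w) ->
  forall w, w != [::] -> tact u H w = tact u F w + tact u G w.
Proof.
elim: u F G H => [d|i|s IHs t IHt|s IHs|s IHs t IHt] F G H HFG w w0 /=.
- by case: w w0 => // c w _; exact: HFG.
- exact: HFG.
- by rewrite (IHs _ _ _ HFG) // (IHt _ _ _ HFG) // addrACA.
- by rewrite (IHs _ _ _ HFG) // opprD.
- by apply: IHt => // w' w'0; exact: IHs.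
Qed.

Lemma tact_comp (phi : D -> D) u F G :
  {morph phi : x y / x + y} -> {morph phi : x / - x} ->
  (forall w, w != [::] -> G w = phi (F w)) ->
  forall w, w != [::] -> tact u G w = phi (tact u F w).
Proof.
move=> phiD phiN.
elim: u F G => [d|i|s IHs t IHt|s IHs|s IHs t IHt] F G GF w w0 /=.
- by case: w w0 => // c w _; exact: GF.
- exact: GF.
- by rewrite (IHs _ _ GF) // (IHt _ _ GF) // phiD.
- by rewrite (IHs _ _ GF) // phiN.
- by apply: IHt => // w' w'0; exact: IHs.
Qed.

Lemma tact_nceq s t : nceq s t -> forall F, cat_linear F ->
  forall w, w != [::] -> tact s F w = tact t F w.
Proof.
elim=> {s t}.
- by [].
- by move=> s t _ IH F Flin w w0; rewrite IH.
- by move=> s t u _ IHs _ IHt F Flin w w0; rewrite IHs // IHt.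
- by move=> s s' t t' _ IHs _ IHt F Flin w w0 /=; rewrite IHs // IHt.
- by move=> s s' _ IHs F Flin w w0 /=; rewrite IHs.
- move=> s s' t t' _ IHs _ IHt F Flin w w0 /=.
  rewrite IHt //; last exact: tact_linear.
  by apply: eq_tact => // w' w'0; exact: IHs.
- by move=> s t u F _ w _ /=; rewrite addrA.
- by move=> s t F _ w _ /=; rewrite addrC.
- move=> s F Flin [//|c w] _ /=.
  by rewrite mul0r cat_linear0 // add0r.
- move=> s F Flin [//|c w] _ /=.
  by rewrite mul0r cat_linear0 // addNr.
- by [].
- move=> s F Flin w w0.
  apply: (@eq_tact s (tact (Coef unit 1) F) F) => // -[//|c w'] _ /=.
  by rewrite mul1r.
- by move=> s F Flin [//|c w] _ /=; rewrite mul1r.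
- by move=> s t u F Flin w w0; apply: (@tact_add u (tact s F) (tact t F)).
- by [].
- move=> a b F Flin [//|c w] _ /=.
  by have := Flin 1 [::] (a * c) (b * c) w; rewrite /= !scale1r mulrDl.
- by move=> a b F Flin [//|c w] _ /=; rewrite mulrA.
- move=> k s F Flin [//|c w] _ /=.
  rewrite -scalerAl mul1r (cat_linearZ k [::]) /=; last exact: tact_linear.
  apply: (tact_comp (phi := fun d => k *: d)) => //.
  + exact: scalerDr.
  + exact: scalerN.
  + move=> [//|d w'] _ /=.
    by rewrite -scalerAl mul1r (cat_linearZ k [::]).
Qed.

Lemma tact_right F :
  (forall w d c, F (rcons w (d * c)) = F (rcons w d) * iota c) ->
  forall s w d c, tact s F (rcons w (d * c)) = tact s F (rcons w d) * iota c.
Proof.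
move=> Fr s; elim: s F Fr => [b|i|s IHs t IHt|s IHs|s IHs t IHt] F Fr w d c /=.
- case: w => [|e w] /=; first by rewrite mulrA (Fr [::]).
  exact: (Fr (b * e :: w)).
- exact: (Fr (1 :: w)).
- by rewrite IHs // IHt // mulrDl.
- by rewrite IHs // mulNr.
- by apply: IHt => w' d' c'; exact: IHs.
Qed.

Fixpoint xterm (bs : seq B) : ncterm unit B :=
  if bs is b :: bs' then Mul (Mul (Var B tt) (Coef unit b)) (xterm bs')
  else Coef unit 1.

Lemma ncpi_xterm bs : ncpi (xterm bs) = xword bs.
Proof.
elim: bs => [|b bs IH]; first by rewrite xword_nil.
by rewrite xword_cons -IH /= ncpiM ncpiM.
Qed.

Lemma tact_xterm F bs : tact (xterm bs) F [:: 1] = F (1 :: bs).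
Proof.
elim: bs F => [|b bs IH] F; first by rewrite /= mul1r.
by rewrite [LHS]/= IH /= mulr1.
Qed.

Variables (mu : ncpoly unit B -> D) (nu : ncpoly unit B -> B).
Hypothesis mu_bimod : unital_bimodule_map iota mu.
Hypothesis nu_lin : linear nu.

Definition crho_fun (w : seq B) : D :=
  match w with
  | [::] => 0
  | [:: b] => iota b
  | b :: bs => iota b * ckappa mu nu bs
  end.

Lemma crho_fun_linear : cat_linear crho_fun.
Proof.
have /multilinearP kl := ckappa_multilinear mu_bimod nu_lin.
have iotaP k b c : iota (k *: b + c) = k *: iota b + iota c.
  by rewrite linearP.
move=> k [|e u] b c v /=.
  by case: v => [|d v]; rewrite iotaP // mulrDl scalerAl.
have crE w : w != [::] -> crho_fun (e :: w) = iota e * ckappa mu nu w.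
  by case: w.
have cat0 x : u ++ x :: v != [::] by case: (u).
rewrite -![match _ with [::] => _ | _ :: _ => _ end]/(crho_fun (e :: _)).
by rewrite !crE // kl mulrDr scalerAr.
Qed.

Lemma crho_fun_right w d c :
  crho_fun (rcons w (d * c)) = crho_fun (rcons w d) * iota c.
Proof.
case: w => [|e w] /=; first by rewrite rmorphM.
have crE v : v != [::] -> crho_fun (e :: v) = iota e * ckappa mu nu v.
  by case: v.
have r0 x : rcons w x != [::] by case: (w).
rewrite -![match _ with [::] => _ | _ :: _ => _ end]/(crho_fun (e :: _)).
by rewrite !crE // (ckappa_right nu mu_bimod) mulrA.
Qed.

Lemma crho_exists : exists rho, is_crho iota mu nu rho.
Proof.
pose rho (f : ncpoly unit B) := tact (repr f) crho_fun [:: 1].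
have rho_pi s : rho (ncpi s) = tact s crho_fun [:: 1].
  by apply: tact_nceq => //; [exact: nceq_repr | exact: crho_fun_linear].
have rhoD f g : rho (f + g) = rho f + rho g.
  elim/ncpolyW: f => s; elim/ncpolyW: g => t.
  have -> : ncpi s + ncpi t = ncpi (Add s t) by rewrite ncpiD.
  by rewrite !rho_pi.
have rhoM b f c : rho (nccoef unit b * f * nccoef unit c) =
    iota b * rho f * iota c.
  elim/ncpolyW: f => s.
  have -> : nccoef unit b * ncpi s * nccoef unit c =
            ncpi (Mul (Mul (Coef unit b) s) (Coef unit c)) by rewrite !ncpiM.
  rewrite !rho_pi /=.
  rewrite -[_ :: _]/(rcons [::] _) mulr1 -[X in rcons _ X]mul1r tact_right //=.
    congr (_ * iota c); apply: (tact_comp (phi := fun d => iota b * d)) => //.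
    + exact: mulrDr.
    + exact: mulrN.
    + by move=> [//|d [|e w]] _ /=; rewrite rmorphM // mulrA.
  move=> [|e w] d e' /=; first by rewrite !rmorphM mulrA.
  exact: (crho_fun_right (b * e :: w)).
exists rho; split; first split => //.
- move=> k f g; rewrite rhoD; congr (_ + _).
  have := rhoM k%:A f 1; rewrite !rmorph1 !mulr1 -ncscaleE => ->.
  by rewrite linearZ /= rmorph1 -scalerAl mul1r.
- by rewrite -[1]/(ncpi (Coef unit 1)) rho_pi /= mulr1 rmorph1.
- move=> bs bs0; rewrite -ncpi_xterm rho_pi tact_xterm.
  by case: bs bs0 => //= b bs _; rewrite rmorph1 mul1r.
Qed.

Lemma crhoP : is_crho iota mu nu (crho iota mu nu).
Proof. by have := xgetPex (fun=> 0) crho_exists. Qed.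

End Action.

Lemma ncpoly_span (phi psi : ncpoly unit B -> D) :
  {morph phi : f g / f + g} -> {morph psi : f g / f + g} ->
  (forall b bs, phi (nccoef unit b * xword bs) = psi (nccoef unit b * xword bs)) ->
  phi =1 psi.
Proof.
suff span s (phi' psi' : ncpoly unit B -> D) :
    {morph phi' : f g / f + g} -> {morph psi' : f g / f + g} ->
    (forall b bs, phi' (nccoef unit b * xword bs) =
                  psi' (nccoef unit b * xword bs)) ->
    forall b bs, phi' (ncpi s * (nccoef unit b * xword bs)) =
                 psi' (ncpi s * (nccoef unit b * xword bs)).
  move=> phiD psiD pp; elim/ncpolyW=> s.
  by have := span s _ _ phiD psiD pp 1 [::]; rewrite xword_nil rmorph1 !mulr1.
elim: s phi' psi' => [c|[]|s IHs t IHt|s IHs|s IHs t IHt] p q pD qD pq b bs.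
- by rewrite -[ncpi _]/(nccoef unit c) mulrA -nccoefM pq.
- rewrite -[ncpi _]/(ncvar B tt) mulrA -xword_cons.
  by have := pq 1 (b :: bs); rewrite rmorph1 mul1r.
- by rewrite ncpiD (_ : ncadd _ _ = ncpi s + ncpi t) // mulrDl pD qD; congr (_ + _); [exact: IHs | exact: IHt].
- rewrite ncpiN (_ : ncopp _ = - ncpi s) // mulNr.
  have mN (r : ncpoly unit B -> D) : {morph r : f g / f + g} ->
      forall f, r (- f) = - r f.
    move=> rD f; have r0 : r 0 = 0.
      by apply: (addrI (r 0)); rewrite -rD !addr0.
    by apply: (addrI (r f)); rewrite -rD !subrr.
  by rewrite (mN p) // (mN q) //; congr (- _); exact: IHs.
- rewrite ncpiM (_ : ncmul _ _ = ncpi s * ncpi t) // -mulrA.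
  apply: (IHt (fun f => p (ncpi s * f)) (fun f => q (ncpi s * f))).
  + by move=> f g /=; rewrite mulrDr pD.
  + by move=> f g /=; rewrite mulrDr qD.
  + by move=> c cs; apply: IHs.
Qed.

Lemma is_crho_unique (iota : {lrmorphism B -> D}) mu nu rho rho' :
  is_crho iota mu nu rho -> is_crho iota mu nu rho' -> rho = rho'.
Proof.
move=> [[l1 u1 m1] k1] [[l2 u2 m2] k2]; apply/funext; apply: ncpoly_span.
- by move=> f g; have := l1 1 f g; rewrite !scale1r.
- by move=> f g; have := l2 1 f g; rewrite !scale1r.
move=> b bs; have := m1 b (xword bs) 1; have := m2 b (xword bs) 1.
rewrite !rmorph1 !mulr1 => -> ->; congr (_ * _).
by case: bs => [|c bs]; rewrite ?xword_nil ?u1 ?u2 // k1 // k2.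
Qed.

End Rho.

Section Convolution.
Variables (K : numClosedFieldType) (B D : starAlgType K) (N : nat).

Definition ncembed (i : 'I_N) (f : ncpoly unit B) : ncpoly 'I_N B :=
  nceval (@nccoef K 'I_N B) (fun=> ncvar B i) f.

Definition ncsumvars (f : ncpoly unit B) : ncpoly 'I_N B :=
  nceval (@nccoef K 'I_N B) (fun=> \sum_(i < N) ncvar B i) f.

(* The alternating products are A_0 ... A_m with A_k = ncembed (eps k) (a k);
   only the values of eps and a on 0, ..., m matter. *)
Definition centered_alternating (phi : ncpoly 'I_N B -> B)
    (m : nat) (eps : nat -> 'I_N) (a : nat -> ncpoly unit B) : Prop :=
  (forall k, (k < m)%N -> eps k != eps k.+1) /\
  (forall k, (k <= m)%N -> phi (ncembed (eps k) (a k)) = 0).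

Definition free_variables (phi : ncpoly 'I_N B -> B) : Prop :=
  forall m eps a, centered_alternating phi m eps a ->
    phi (\prod_(k < m.+1) ncembed (eps k) (a k)) = 0.

Definition cfree_variables (theta : ncpoly 'I_N B -> D)
    (phi : ncpoly 'I_N B -> B) : Prop :=
  forall m eps a, centered_alternating phi m eps a ->
    phi (\prod_(k < m.+1) ncembed (eps k) (a k)) = 0 /\
    theta (\prod_(k < m.+1) ncembed (eps k) (a k)) =
      \prod_(k < m.+1) theta (ncembed (eps k) (a k)).

Definition is_free_convolution (nus : 'I_N -> ncpoly unit B -> B)
    (nu : ncpoly unit B -> B) : Prop :=
  exists phi : ncpoly 'I_N B -> B,
    [/\ conditional_expectation phi,
        forall i f, phi (ncembed i f) = nus i f,
        free_variables phi &
        forall f, nu f = phi (ncsumvars f)].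

Definition is_cfree_convolution (iota : B -> D)
    (mus : 'I_N -> ncpoly unit B -> D) (nus : 'I_N -> ncpoly unit B -> B)
    (mu : ncpoly unit B -> D) (nu : ncpoly unit B -> B) : Prop :=
  exists (phi : ncpoly 'I_N B -> B) (theta : ncpoly 'I_N B -> D),
    [/\ conditional_expectation phi /\ unital_bimodule_map iota theta,
        forall i f, phi (ncembed i f) = nus i f,
        forall i f, theta (ncembed i f) = mus i f,
        cfree_variables theta phi &
        forall f, mu f = theta (ncsumvars f) /\ nu f = phi (ncsumvars f)].

End Convolution.

Section InfiniteDivisibility.
Variables (K : numClosedFieldType) (B D : starAlgType K).

Definition free_infinitely_divisible (nu : ncpoly unit B -> B) : Prop :=
  forall N, (0 < N)%N -> exists2 nuN : ncpoly unit B -> B,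
    SigmaB nuN & is_free_convolution (fun _ : 'I_N => nuN) nu.

Definition cfree_infinitely_divisible (iota : B -> D)
    (mu : ncpoly unit B -> D) (nu : ncpoly unit B -> B) : Prop :=
  forall N, (0 < N)%N ->
    exists (muN : ncpoly unit B -> D) (nuN : ncpoly unit B -> B),
      [/\ SigmaBD iota muN, SigmaB nuN &
          is_cfree_convolution iota
            (fun _ : 'I_N => muN) (fun _ : 'I_N => nuN) mu nu].

End InfiniteDivisibility.

(* Main.v *)
(** If mu and nu are given, the c-free cumulants are the unique rho for which mu is the
    moment functional of rho: reading a word from left to right, one sums over all ways
    to cut it into consecutive blocks, each block contributing rho of the letters chosen in
    it, with nu applied to the gaps between them. This functional makes sense over any
    number of letters, phi being applied to the gaps, and then it is c-free with respect
    to phi as soon as phi is free. Comparing with the uniqueness of the c-free functional,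
    cumulants add under c-free convolution, so an N-th root of (mu, nu) has cumulants
    rho / N.

    If roots exist for all N, then N mu_N(f) is a polynomial in 1/N whose constant
    coefficient is rho(f) for f without constant term, and the positivity of mu_N passes
    to the limit. Conversely, if rho is positive on polynomials without constant term, then
    the functional with cumulants rho / N and gaps evaluated by nu_N is positive:
    mu_N(f^* g) is mu_N(f)^* mu_N(g) plus the sum over the blocks straddling the cut, which
    is a Gram matrix built from rho and the complete positivity of nu_N.

    The matrix inequalities use that M_n(A) is a C*-algebra for the operator norm of the
    Hilbert module A^n, and that M is positive iff x^* M x >= 0 for all x. That sums, limits
    and products c^* c are squares of selfadjoint elements is proved without spectra, from
    the power series iteration for the square root. *)
Require Import Defs.
From HB Require Import structures.
From mathcomp Require Import all_boot all_order all_algebra zify ring lra.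
From mathcomp Require Import boolp classical_sets functions reals.
From mathcomp.real_closed Require Import complex.

Set Implicit Arguments.
Unset Strict Implicit.
Unset Printing Implicit Defensive.

Import Order.TTheory GRing.Theory Num.Theory.
Local Open Scope ring_scope.

(** * Identities in noncommutative rings *)

(** The free algebra is a quotient of terms without a normal form, so the moment functional is
    defined on terms: each generator acts linearly on a state that records the unfinished blocks,
    and the relations of the algebra become identities between such actions. Restriction to one
    variable, substitution of a sum and freeness are then invariants preserved during the reading.
    In the necessity proof the gaps are evaluated by [nu_N], whose dependence on N must be known
    beforehand. Free convolution is c-free convolution with [theta = phi], so the expansion applies
    to the pair [(nu, nu)] and controls [nu_N] by induction on word length. Polynomials in 1/N take
    the place of limits because the arguments of the cumulants live in the free algebra, which
    carries no norm, and because they survive every linear map, continuous or not. In the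
    sufficiency proof, reading from the left treats a product and its adjoint differently; hermitian
    symmetry of the moments is therefore proved together with the description of the blocks across a
    cut. *)

Inductive ncexpr : Type :=
| NCvar of nat
| NC0
| NC1
| NCadd of ncexpr & ncexpr
| NCopp of ncexpr
| NCmul of ncexpr & ncexpr.

Section NCRing.
Variable A : pzRingType.

Fixpoint nc_eval (env : seq A) (e : ncexpr) : A :=
  match e with
  | NCvar i => nth 0 env i
  | NC0 => 0
  | NC1 => 1
  | NCadd e f => nc_eval env e + nc_eval env f
  | NCopp e => - nc_eval env e
  | NCmul e f => nc_eval env e * nc_eval env f
  end.

Definition nc_mono := (int * seq nat)%type.

Definition nc_mono_eval (env : seq A) (m : nc_mono) : A :=
  (\prod_(i <- m.2) nth 0 env i) *~ m.1.

Definition nc_sum_eval env (l : seq nc_mono) : A := \sum_(m <- l) nc_mono_eval env m.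

(** Equal words are merged but zero coefficients are kept, so an identity is recognised by all
    coefficients of the difference being zero. *)
Fixpoint nc_insert (m : nc_mono) (l : seq nc_mono) : seq nc_mono :=
  if l is h :: t then
    if h.2 == m.2 then ((h.1 + m.1)%R, m.2) :: t else h :: nc_insert m t
  else [:: m].

Fixpoint nc_norm (e : ncexpr) : seq nc_mono :=
  match e with
  | NCvar i => [:: (1%:Z, [:: i])]
  | NC0 => [::]
  | NC1 => [:: (1%:Z, [::])]
  | NCadd e f => foldr nc_insert (nc_norm f) (nc_norm e)
  | NCopp e => [seq (- m.1, m.2) | m <- nc_norm e]
  | NCmul e f => foldr nc_insert [::]
      [seq (m.1 * k.1, m.2 ++ k.2) | m <- nc_norm e, k <- nc_norm f]
  end.

Lemma nc_insert_eval env m l :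
  nc_sum_eval env (nc_insert m l) = nc_mono_eval env m + nc_sum_eval env l.
Proof.
rewrite /nc_sum_eval; elim: l => [|h t IH] /=; first by rewrite big_cons.
case: eqP => [hm|_]; rewrite !big_cons; last by rewrite IH addrCA.
by rewrite addrA /nc_mono_eval /= -hm mulrzDr [X in X + _]addrC.
Qed.

Lemma nc_foldr_eval env l t :
  nc_sum_eval env (foldr nc_insert t l) = nc_sum_eval env l + nc_sum_eval env t.
Proof.
elim: l => [|m l IH] /=; first by rewrite /nc_sum_eval big_nil add0r.
by rewrite nc_insert_eval IH addrA /nc_sum_eval big_cons.
Qed.

Lemma nc_normE env e : nc_eval env e = nc_sum_eval env (nc_norm e).
Proof.
elim: e => [i|||e IHe f IHf|e IHe|e IHe f IHf] /=.
- by rewrite /nc_sum_eval big_seq1 /nc_mono_eval big_seq1.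
- by rewrite /nc_sum_eval big_nil.
- by rewrite /nc_sum_eval big_seq1 /nc_mono_eval big_nil.
- by rewrite nc_foldr_eval IHe IHf.
- rewrite IHe /nc_sum_eval big_map -sumrN; apply: eq_bigr => m _.
  by rewrite /nc_mono_eval /= mulrNz.
- rewrite nc_foldr_eval IHe IHf /nc_sum_eval big_nil addr0 big_allpairs_dep mulr_suml.
  apply: eq_bigr => m _; rewrite mulr_sumr; apply: eq_bigr => k _.
  by rewrite /nc_mono_eval /= big_cat /= mulrzAl mulrzAr -mulrzA mulrC.
Qed.

Lemma nc_ring_correct env e f :
  all (fun m : nc_mono => m.1 == 0) (nc_norm (NCadd e (NCopp f))) ->
  nc_eval env e = nc_eval env f.
Proof.
move=> h; apply/eqP; rewrite -subr_eq0.
rewrite -[X in X == 0]/(nc_eval env (NCadd e (NCopp f))) nc_normE.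
apply/eqP; rewrite /nc_sum_eval big_seq big1 // => m /(allP h) /eqP m0.
by rewrite /nc_mono_eval m0 mulr0z.
Qed.

End NCRing.

(** Atoms are compared up to conversion, so that different elaborations of one subterm share an
    index. *)
Ltac nc_same a b :=
  first [constr_eq a b | let e := constr:(erefl a : a = b) in idtac].

Ltac nc_index a l :=
  lazymatch l with
  | ?b :: ?t => match goal with
       | _ => let _ := match goal with _ => nc_same a b end in constr:(O)
       | _ => let n := nc_index a t in constr:(S n) end
  end.

Ltac nc_add a l :=
  match goal with
  | _ => let n := nc_index a l in l
  | _ => lazymatch l with
         | nil => let T := type of l in lazymatch T with
                  list ?X => constr:(@cons X a l) end
         | @cons ?X ?b ?t => let t' := nc_add a t in constr:(@cons X b t')
         end
  end.

Ltac nc_atoms e l :=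
  lazymatch e with
  | @GRing.add _ ?a ?b => let l := nc_atoms a l in nc_atoms b l
  | @GRing.mul _ ?a ?b => let l := nc_atoms a l in nc_atoms b l
  | @GRing.opp _ ?a => nc_atoms a l
  | @GRing.zero _ => l
  | @GRing.one _ => l
  | _ => nc_add e l
  end.

Ltac nc_quote e l :=
  lazymatch e with
  | @GRing.add _ ?a ?b => let x := nc_quote a l in let y := nc_quote b l in
     constr:(NCadd x y)
  | @GRing.mul _ ?a ?b => let x := nc_quote a l in let y := nc_quote b l in
     constr:(NCmul x y)
  | @GRing.opp _ ?a => let x := nc_quote a l in constr:(NCopp x)
  | @GRing.zero _ => constr:(NC0)
  | @GRing.one _ => constr:(NC1)
  | _ => let n := nc_index e l in constr:(NCvar n)
  end.

Ltac nc_ring :=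
  lazymatch goal with
  | |- @eq ?T ?a ?b =>
    let l := constr:(@nil T) in
    let l := nc_atoms a l in
    let l := nc_atoms b l in
    let x := nc_quote a l in
    let y := nc_quote b l in
    refine (@nc_ring_correct _ l x y _); vm_compute; reflexivity
  end.

(** * C*-algebras *)

Section StarTheory.
Variables (K : numClosedFieldType) (A : starAlgType K).
Implicit Types x y : A.

Lemma starN x : star (- x) = - star x.
Proof. by apply: (addrI (star x)); rewrite -starD !subrr star0. Qed.

Lemma starB x y : star (x - y) = star x - star y.
Proof. by rewrite starD starN. Qed.

Lemma star_sum (I : Type) (r : seq I) (P : pred I) (F : I -> A) :
  star (\sum_(i <- r | P i) F i) = \sum_(i <- r | P i) star (F i).
Proof. by apply: (big_morph (@star K A) (@starD K A)); rewrite star0. Qed.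

End StarTheory.

Section CStarTheory.
Local Open Scope complex_scope.
Variables (R : realType) (A : cstarAlgType R).
Implicit Types (x y z a b c : A) (r t e : R).

Lemma normc_real r : Normc.normc r%:C = `|r|.
Proof. by rewrite /= expr0n /= addr0 sqrtr_sqr. Qed.

Lemma normc_i : Normc.normc ('i%C : R[i]) = 1.
Proof. by rewrite /= expr0n expr1n add0r sqrtr1. Qed.

Lemma cnormZr r x : cnorm (r%:C *: x) = `|r| * cnorm x.
Proof. by rewrite cnormZ normc_real. Qed.

Lemma cnorm0 : cnorm (0 : A) = 0.
Proof. by have := cnormZr 0 0; rewrite scaler0 normr0 mul0r. Qed.

Lemma cnormN x : cnorm (- x) = cnorm x.
Proof. by have := cnormZr (-1) x; rewrite rmorphN1 scaleN1r normrN1 mul1r. Qed.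

Lemma cnorm_ge0 x : 0 <= cnorm x.
Proof.
have := cnormD x (- x); rewrite subrr cnorm0 cnormN => h; lra.
Qed.

Lemma cnormB x y : cnorm (x - y) <= cnorm x + cnorm y.
Proof. by rewrite -(cnormN y) cnormD. Qed.

Lemma cnormBC x y : cnorm (x - y) = cnorm (y - x).
Proof. by rewrite -cnormN opprB. Qed.

Lemma cnorm_dist y x z : cnorm (x - z) <= cnorm (x - y) + cnorm (y - z).
Proof. by rewrite (le_trans _ (cnormD _ _)) // subrKA. Qed.

Lemma cnorm_starE x : cnorm (star x) = cnorm x.
Proof.
have le y : cnorm y <= cnorm (star y).
  have := cnormM (star y) y; rewrite cnorm_star expr2.
  have := cnorm_ge0 y; rewrite le_eqVlt => /orP[/eqP <- _|y0].
    exact: cnorm_ge0.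
  by rewrite ler_pM2r.
by apply/eqP; rewrite eq_le le andbT -{2}[x]starK le.
Qed.

Lemma cnorm1 : cnorm (1 : A) = 1.
Proof.
have := cnorm_star (1 : A); rewrite star1 mul1r => h.
have n0 : cnorm (1 : A) != 0.
  by apply/eqP => /cnorm0_eq0 /eqP; rewrite oner_eq0.
by apply: (mulfI n0); rewrite mulr1 -expr2 -h.
Qed.

Definition selfadjoint x := star x = x.

Lemma selfadjointZ r x : selfadjoint x -> selfadjoint (r%:C *: x).
Proof.
by rewrite /selfadjoint starZ => ->; congr (_ *: _); rewrite -[LHS]/(conjc _) conjc_real.
Qed.

Lemma cnorm_sqr x : selfadjoint x -> cnorm (x * x) = cnorm x ^+ 2.
Proof. by rewrite -cnorm_star => ->. Qed.

Lemma sqr_eq0 x : selfadjoint x -> x * x = 0 -> x = 0.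
Proof.
move=> sx xx; apply: cnorm0_eq0; apply/eqP.
by rewrite -sqrf_eq0 -cnorm_sqr // xx cnorm0.
Qed.

Definition converges (u : nat -> A) l := forall e, 0 < e ->
  exists N, forall n, (N <= n)%N -> cnorm (u n - l) < e.

Lemma converges_unique u l l' : converges u l -> converges u l' -> l = l'.
Proof.
move=> ul ul'; apply/eqP; rewrite -subr_eq0; apply/eqP/cnorm0_eq0.
apply/eqP; rewrite eq_le cnorm_ge0 andbT; apply/ler_addgt0Pr => e e0.
have e2 : 0 < e / 2 by rewrite divr_gt0.
have [N HN] := ul _ e2; have [M HM] := ul' _ e2.
have := HN _ (leq_maxl N M); have := HM _ (leq_maxr N M).
set w := u _ => h1 h2; rewrite add0r.
have := cnorm_dist w l l'; rewrite (cnormBC l w) => h3.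
have : e / 2 + e / 2 = e by field.
by lra.
Qed.

Lemma converges_cst l : converges (fun=> l) l.
Proof. by move=> e e0; exists 0%N => n _; rewrite subrr cnorm0. Qed.

Lemma eq_converges u v l : (forall n, u n = v n) -> converges u l -> converges v l.
Proof. by move=> uv ul e /ul[N HN]; exists N => n /HN; rewrite uv. Qed.

Lemma converges_shift u l : converges u l -> converges (fun n => u n.+1) l.
Proof. by move=> ul e /ul[N HN]; exists N => n Nn; apply: HN; rewrite leqW. Qed.

Lemma convergesD u v l m : converges u l -> converges v m ->
  converges (fun n => u n + v n) (l + m).
Proof.
move=> ul vm e e0; have e2 : 0 < e / 2 by rewrite divr_gt0.
have [N HN] := ul _ e2; have [M HM] := vm _ e2.
exists (maxn N M) => n; rewrite geq_max => /andP[/HN h1 /HM h2].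
rewrite opprD addrACA; have h3 := cnormD (u n - l) (v n - m).
have : e / 2 + e / 2 = e by field.
lra.
Qed.

Lemma convergesM u v l m : converges u l -> converges v m ->
  converges (fun n => u n * v n) (l * m).
Proof.
move=> ul vm e e0.
(* A common bound for the norms of [l] and, eventually, of [v n]; the 1 is the tolerance at which
   [P] is chosen. *)
pose c := cnorm l + cnorm m + 1.
have c0 : 0 < c by rewrite /c; have := cnorm_ge0 l; have := cnorm_ge0 m; lra.
have ec : 0 < e / (2 * c) by rewrite divr_gt0 // mulr_gt0.
have ece : e / (2 * c) * c = e / 2 by field; lra.
have [N HN] := ul _ ec; have [M HM] := vm _ ec; have [P HP] := vm _ ltr01.
exists (maxn N (maxn M P)) => n; rewrite !geq_max => /and3P[/HN h1 /HM h2 /HP h3].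
have -> : u n * v n - l * m = (u n - l) * v n + l * (v n - m).
  by rewrite mulrBl mulrBr addrA subrK.
have h4 := cnormD ((u n - l) * v n) (l * (v n - m)).
have h5 := cnormM (u n - l) (v n); have h6 := cnormM l (v n - m).
have h7 : cnorm (v n) <= c.
  have := cnormD (v n - m) m; rewrite subrK; have := cnorm_ge0 l; rewrite /c; lra.
have h8 : cnorm l <= c by have := cnorm_ge0 m; rewrite /c; lra.
have h9 : cnorm (u n - l) * cnorm (v n) <= cnorm (u n - l) * c.
  by apply: ler_wpM2l => //; exact: cnorm_ge0.
have h10 : cnorm l * cnorm (v n - m) <= c * cnorm (v n - m).
  by apply: ler_wpM2r => //; exact: cnorm_ge0.
have h11 : cnorm (u n - l) * c < e / 2 by rewrite -ece ltr_pM2r.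
have h12 : c * cnorm (v n - m) < e / 2 by rewrite mulrC -ece ltr_pM2r.
by lra.
Qed.

Lemma convergesZ r u l : converges u l -> converges (fun n => r%:C *: u n) (r%:C *: l).
Proof.
move=> ul; have := convergesM (converges_cst (r%:C *: 1)) ul.
by rewrite -scalerAl mul1r; apply: eq_converges => n; rewrite -scalerAl mul1r.
Qed.

Lemma converges_star u l : converges u l -> converges (fun n => star (u n)) (star l).
Proof. by move=> ul e /ul[N HN]; exists N => n /HN; rewrite -starB cnorm_starE. Qed.

Lemma converges_norm_le u l r : converges u l -> (forall n, cnorm (u n) <= r) ->
  cnorm l <= r.
Proof.
move=> ul ur; apply/ler_addgt0Pr => e e0; have [N HN] := ul _ e0.
have := HN _ (leqnn N); have := ur N; have := cnorm_dist (u N) l 0.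
by rewrite !subr0 (cnormBC l); lra.
Qed.

(* The iteration y <- (x + y^2)/2 for 1 - sqrt(1 - x), and its majorant at x = 1. *)
Fixpoint sqrt_iter x n : A :=
  if n is m.+1 then (2^-1)%:C *: (x + sqrt_iter x m * sqrt_iter x m) else 0.

Fixpoint sqrt_bound n : R :=
  if n is m.+1 then 2^-1 * (1 + sqrt_bound m ^+ 2) else 0.

Lemma sqrt_bound_itv n : 0 <= sqrt_bound n <= 1.
Proof. by elim: n => [|n /andP[h0 h1]] /=; [lra | apply/andP; split; nra]. Qed.

(** Any index whose value lies within e of the supremum works, since later values stay below the
    supremum. *)
Lemma sqrt_bound_cauchy e : 0 < e ->
  exists N, forall n, (N <= n)%N -> sqrt_bound n - sqrt_bound N < e.
Proof.
move=> e0; pose S := [set r | exists n, r = sqrt_bound n]%classic.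
have hs : has_sup S.
  split; first by exists 0, 0%N.
  by exists 1 => _ [n ->]; have /andP[] := sqrt_bound_itv n.
have [_ [N ->] hN] := sup_adherent e0 hs.
exists N => n _; have : sqrt_bound n <= sup S by apply: sup_upper_bound => //; exists n.
by lra.
Qed.

Lemma sqrt_iter_comm x z n : z * x = x * z ->
  z * sqrt_iter x n = sqrt_iter x n * z.
Proof.
move=> zx; elim: n => [|n IH] /=; first by rewrite mulr0 mul0r.
rewrite -scalerAr -scalerAl mulrDr mulrDl zx; congr (_ *: (_ + _)).
by rewrite mulrA IH -mulrA IH mulrA.
Qed.

Lemma sqrt_iter_selfadjoint x n : selfadjoint x -> selfadjoint (sqrt_iter x n).
Proof.
move=> sx; elim: n => [|n IH] /=; first exact: star0.
by apply: selfadjointZ; rewrite /selfadjoint starD sx starM IH.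
Qed.

Lemma half_norm x : cnorm ((2^-1)%:C *: x) = 2^-1 * cnorm x.
Proof. by rewrite cnormZr gtr0_norm // invr_gt0. Qed.

Lemma sqrt_iter_norm x n : cnorm x <= 1 -> cnorm (sqrt_iter x n) <= sqrt_bound n.
Proof.
move=> x1; elim: n => [|n IH] /=; first by rewrite cnorm0.
rewrite half_norm ler_pM2l ?invr_gt0 // (le_trans (cnormD _ _)) // lerD //.
rewrite (le_trans (cnormM _ _)) // -expr2 lerXn2r //.
  exact: cnorm_ge0.
by have /andP[] := sqrt_bound_itv n.
Qed.

(** The iterates commute, so the difference of two squares factors as (y - z)(y + z). The majorant
    obeys the same factorisation with equality, which makes the increments comparable. *)
Lemma sqrt_iter_diff x n : cnorm x <= 1 ->
  cnorm (sqrt_iter x n.+1 - sqrt_iter x n) <= sqrt_bound n.+1 - sqrt_bound n.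
Proof.
move=> x1; elim: n => [|n IH].
  rewrite /= mulr0 addr0 !subr0 half_norm expr0n /= addr0.
  by rewrite ler_pM2l ?invr_gt0.
set y := sqrt_iter x n.+1 in IH *; set z := sqrt_iter x n in IH *.
have yE : y = (2^-1)%:C *: (x + z * z) by [].
rewrite -[sqrt_iter x n.+2]/((2^-1)%:C *: (x + y * y)) {2}yE -scalerBr half_norm.
have zy : z * y = y * z.
  apply: sqrt_iter_comm; symmetry; exact: sqrt_iter_comm.
have -> : x + y * y - (x + z * z) = (y - z) * (y + z).
  by rewrite opprD addrACA subrr add0r mulrBl !mulrDr zy opprD addrA addrK.
have h1 := cnormM (y - z) (y + z).
have h2 : cnorm (y + z) <= sqrt_bound n.+1 + sqrt_bound n.
  by rewrite (le_trans (cnormD _ _)) // lerD // sqrt_iter_norm.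
have h3 := cnorm_ge0 (y - z); have h4 := cnorm_ge0 (y + z).
have h5 := ler_pM h3 h4 IH h2.
rewrite -[sqrt_bound n.+2]/(2^-1 * (1 + sqrt_bound n.+1 ^+ 2)).
have -> : sqrt_bound n.+1 = 2^-1 * (1 + sqrt_bound n ^+ 2) by [].
have h6 : sqrt_bound n.+1 = 2^-1 * (1 + sqrt_bound n ^+ 2) by [].
move: h1 h5; rewrite h6; set p := sqrt_bound n => h1 h5; lra.
Qed.

Lemma sqrt_iter_dist x N n : cnorm x <= 1 -> (N <= n)%N ->
  cnorm (sqrt_iter x n - sqrt_iter x N) <= sqrt_bound n - sqrt_bound N.
Proof.
move=> x1 /subnK <-; elim: (n - N)%N => [|k IH]; first by rewrite !subrr cnorm0.
rewrite addSn; have h := sqrt_iter_diff (k + N) x1.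
have := cnormD (sqrt_iter x (k + N).+1 - sqrt_iter x (k + N))
               (sqrt_iter x (k + N) - sqrt_iter x N).
rewrite subrKA; move: h IH; set p := sqrt_bound _.+1; lra.
Qed.

(** The limit solves y = (x + y^2)/2, that is (1 - y)^2 = 1 - x. The commutation clause, inherited
    from the iterates, plays the part of functional calculus below. *)
Lemma sqrt_one_minus x : selfadjoint x -> cnorm x <= 1 ->
  exists y, [/\ selfadjoint y, cnorm y <= 1, (1 - y) * (1 - y) = 1 - x &
                forall z, z * x = x * z -> z * y = y * z].
Proof.
move=> sx x1.
have [y hy] : exists y, converges (sqrt_iter x) y.
  apply: cnorm_complete => e e0; have e2 : 0 < e / 2 by rewrite divr_gt0.
  have [N HN] := sqrt_bound_cauchy e2; exists N => m n Nm Nn.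
  have h1 := sqrt_iter_dist x1 Nm; have h2 := sqrt_iter_dist x1 Nn.
  have h3 := HN _ Nm; have h4 := HN _ Nn.
  have := cnorm_dist (sqrt_iter x N) (sqrt_iter x m) (sqrt_iter x n).
  rewrite (cnormBC (sqrt_iter x N)); have : e / 2 + e / 2 = e by field.
  by lra.
have yE : y = (2^-1)%:C *: (x + y * y).
  apply: (converges_unique (converges_shift hy)).
  apply: convergesZ; apply: convergesD; first exact: converges_cst.
  exact: convergesM.
exists y; split.
- apply: (converges_unique (converges_star hy)); apply: eq_converges hy => n.
  by rewrite sqrt_iter_selfadjoint.
- apply: (converges_norm_le hy) => n; rewrite (le_trans (sqrt_iter_norm n x1)) //.
  by have /andP[] := sqrt_bound_itv n.
- have : y + y = x + y * y.
    rewrite {1 2}yE -scalerDl -rmorphD /=.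
    by rewrite (_ : 2^-1 + 2^-1 = 1 :> R) ?rmorph1 ?scale1r //; field.
  move=> h; have -> : (1 - y) * (1 - y) = 1 - (y + y) + y * y by nc_ring.
  by rewrite h; nc_ring.
- move=> z zx; apply: (@converges_unique (fun n => z * sqrt_iter x n)).
    by apply: convergesM => //; exact: converges_cst.
  apply: (@eq_converges (fun n => sqrt_iter x n * z)).
    by move=> n; rewrite sqrt_iter_comm.
  by apply: convergesM => //; exact: converges_cst.
Qed.

Lemma mulrZZ r t x y : (r%:C *: x) * (t%:C *: y) = (r * t)%:C *: (x * y).
Proof. by rewrite -scalerAl -scalerAr scalerA -rmorphM. Qed.

Lemma sqrt_mul_sqrt t : 0 <= t -> Num.sqrt t * Num.sqrt t = t.
Proof. by move=> t0; rewrite -expr2 sqr_sqrtr. Qed.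

(** Squares of selfadjoint elements are the working notion of positivity; their agreement with
    [positive] becomes available with [psd_star_mul]. *)
Definition psd x := exists2 b, selfadjoint b & x = b * b.

Lemma psd_selfadjoint x : psd x -> selfadjoint x.
Proof. by case=> b sb ->; rewrite /selfadjoint starM sb. Qed.

Lemma psd0 : psd 0.
Proof. by exists 0; rewrite ?mulr0 //; exact: star0. Qed.

Lemma psdZ t x : 0 <= t -> psd x -> psd (t%:C *: x).
Proof.
move=> t0 [b sb ->]; exists ((Num.sqrt t)%:C *: b); first exact: selfadjointZ.
by rewrite mulrZZ sqrt_mul_sqrt.
Qed.

Lemma psd_one_minus x : selfadjoint x -> cnorm x <= 1 ->
  exists b, [/\ selfadjoint b, psd b, 1 - x = b * b &
    forall z, z * x = x * z -> z * b = b * z].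
Proof.
(* This makes the root [1 - y] itself a square: [y] is again a selfadjoint contraction, so the
   construction applies to it once more. *)
have half y : selfadjoint y -> cnorm y <= 1 -> psd (1 - y).
  move=> sy y1; have [w [sw _ wE _]] := sqrt_one_minus sy y1.
  by exists (1 - w); rewrite ?wE // /selfadjoint starB star1 sw.
move=> sx x1; have [y [sy y1 yE yc]] := sqrt_one_minus sx x1.
exists (1 - y); split => //.
- by rewrite /selfadjoint starB star1 sy.
- exact: half.
- by move=> z /yc zy; rewrite mulrBr mulrBl mulr1 mul1r zy.
Qed.

(* b + i c is unitary, whence its real part b and imaginary part c are contractions. *)
Lemma unitary_parts b c : selfadjoint b -> selfadjoint c -> b * c = c * b ->
  b * b + c * c = 1 -> cnorm b <= 1 /\ cnorm c <= 1.
Proof.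
move=> sb sc bc bc1; set I := ('i%C : R[i]).
have II : I * I = -1 by rewrite -expr2 sqr_i.
pose u := b + I *: c.
have suE : star u = b - I *: c.
  rewrite starD starZ sb sc -[_^*%R]/(conjc I) /I /=.
  by rewrite -scaleNr; congr (_ + _ *: _); apply/eqP; rewrite eq_complex /= oppr0 !eqxx.
have uu : star u * u = 1.
  have -> : star u * u = b * b + (b * (I *: c) - (I *: c) * b) - (I *: c) * (I *: c).
    by rewrite suE /u; nc_ring.
  rewrite -!scalerAl -!scalerAr bc subrr addr0 scalerA II scaleN1r opprK.
  exact: bc1.
have u1 : cnorm u = 1.
  apply/eqP; rewrite -[_ == _](@eqrXn2 _ 2) ?cnorm_ge0 //.
  by rewrite -cnorm_star uu cnorm1 expr1n.
have su1 : cnorm (star u) = 1 by rewrite cnorm_starE.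
have hb : (2%:R)%:C *: b = u + star u.
  by rewrite suE /u addrACA subrr addr0 rmorph_nat scaler_nat mulr2n.
have hc : ((2%:R)%:C * I) *: c = u - star u.
  by rewrite -scalerA rmorph_nat scaler_nat mulr2n suE /u; nc_ring.
split.
- have := cnormD u (star u); rewrite -hb cnormZr normr_nat u1 su1; lra.
- have := cnormB u (star u).
  by rewrite -hc -scalerA cnormZr cnormZ normc_i mul1r normr_nat u1 su1; lra.
Qed.

(** With [c] a root of 1 - b^2 commuting with [b], the element b + ic is unitary, so [c] is a
    contraction, and so is c^2 = 1 - b^2. *)
Lemma sqr_contraction b : selfadjoint b -> cnorm b <= 1 -> cnorm (1 - b * b) <= 1.
Proof.
move=> sb b1.
have sbb : selfadjoint (b * b) by rewrite /selfadjoint starM sb.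
have bb1 : cnorm (b * b) <= 1 by rewrite cnorm_sqr // expr_le1 // cnorm_ge0.
have [c [sc _ cE cc]] := psd_one_minus sbb bb1.
have [|_ c1] := unitary_parts sb sc (cc b (mulrA _ _ _)).
  by rewrite -cE addrC subrK.
by rewrite cE cnorm_sqr // expr_le1 // cnorm_ge0.
Qed.

(** Squares of norm at most t lie in the ball of radius t around t, and by [ball_root] the
    selfadjoint elements of this ball are squares. The condition is convex and closed, which is what
    makes sums and limits of squares squares. *)
Lemma psd_ball x t : psd x -> cnorm x <= t -> cnorm (t%:C *: 1 - x) <= t.
Proof.
move=> [b sb ->] xt; have t0 : 0 <= t by rewrite (le_trans _ xt) // cnorm_ge0.
move: t0; rewrite le_eqVlt => /orP[/eqP t0|t0].
  have -> : b * b = 0 by apply: cnorm0_eq0; apply/eqP; rewrite eq_le cnorm_ge0 t0 xt.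
  by rewrite subr0 cnormZr cnorm1 mulr1 -t0 normr0.
pose s := Num.sqrt t; have s0 : 0 < s by rewrite sqrtr_gt0.
have ss : s * s = t by rewrite sqrt_mul_sqrt // ltW.
have bE : b * b = t%:C *: ((s^-1%:C *: b) * (s^-1%:C *: b)).
  rewrite mulrZZ scalerA -rmorphM /= -ss.
  by rewrite (_ : s * s * (s^-1 * s^-1) = 1) ?rmorph1 ?scale1r //; field; lra.
rewrite bE -scalerBr cnormZr gtr0_norm // -{2}[t]mulr1 ler_pM2l //.
apply: sqr_contraction; first exact: selfadjointZ.
rewrite cnormZr gtr0_norm ?invr_gt0 // mulrC ler_pdivrMr // mul1r.
have : cnorm b ^+ 2 <= s ^+ 2 by rewrite -cnorm_sqr // [s ^+ 2]expr2 ss.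
by rewrite ler_pXn2r // nnegrE ?cnorm_ge0 ?ltW.
Qed.

Lemma ball_root x t : selfadjoint x -> cnorm (t%:C *: 1 - x) <= t ->
  exists b, [/\ selfadjoint b, psd b, x = b * b &
    forall z, z * x = x * z -> z * b = b * z].
Proof.
move=> sx xt; have t0 : 0 <= t by rewrite (le_trans _ xt) // cnorm_ge0.
move: t0; rewrite le_eqVlt => /orP[/eqP t0|t0].
  have -> : x = 0.
    apply: cnorm0_eq0; apply/eqP; rewrite eq_le cnorm_ge0 andbT.
    by move: xt; rewrite -t0 scale0r sub0r cnormN.
  exists 0; split; [exact: star0|exact: psd0|by rewrite mulr0|].
  by move=> z; rewrite mulr0 mul0r.
pose y : A := 1 - t^-1%:C *: x.
have sy : selfadjoint y by rewrite /selfadjoint starB star1 selfadjointZ.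
have tK w : t%:C *: (t^-1%:C *: w) = w.
  by rewrite scalerA -rmorphM /= divff ?rmorph1 ?scale1r // lt0r_neq0.
have y1 : cnorm y <= 1.
  rewrite -(ler_pM2l t0) mulr1 -{1}(gtr0_norm t0) -cnormZr.
  by rewrite scalerBr tK.
have [b [sb pb bE bc]] := psd_one_minus sy y1.
exists ((Num.sqrt t)%:C *: b); split.
- exact: selfadjointZ.
- by apply: psdZ => //; exact: sqrtr_ge0.
- rewrite mulrZZ sqrt_mul_sqrt ?ltW // -bE.
  by rewrite /y opprB addrC subrK tK.
- move=> z zx; rewrite -scalerAl -scalerAr bc // /y mulrBl mulrBr mul1r mulr1.
  by rewrite -scalerAl -scalerAr zx.
Qed.

Lemma psd_root x : psd x ->
  exists b, [/\ selfadjoint b, psd b, x = b * b &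
    forall z, z * x = x * z -> z * b = b * z].
Proof.
move=> px; apply: (@ball_root x (cnorm x)); first exact: psd_selfadjoint.
exact: psd_ball.
Qed.

Lemma psdD x y : psd x -> psd y -> psd (x + y).
Proof.
move=> px py; have sxy : selfadjoint (x + y).
  by rewrite /selfadjoint starD !psd_selfadjoint.
have [|b [sb _ bE _]] := @ball_root (x + y) (cnorm x + cnorm y) sxy; last by exists b.
rewrite rmorphD /= scalerDl opprD addrACA (le_trans (cnormD _ _)) //.
by rewrite lerD // psd_ball.
Qed.

Lemma psd_sum (I : Type) (s : seq I) (P : pred I) (F : I -> A) :
  (forall i, P i -> psd (F i)) -> psd (\sum_(i <- s | P i) F i).
Proof. by move=> h; apply: big_ind => //; [exact: psd0 | exact: psdD]. Qed.

Lemma psd_limit u l : (forall n, psd (u n)) -> converges u l -> psd l.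
Proof.
move=> pu ul; have [N HN] := ul _ ltr01.
(* On this tail the number [t] below bounds all norms, so that one ball serves for every term. *)
pose v n := u (N + n)%N.
have vl : converges v l.
  move=> e /ul[M HM]; exists M => n Mn; apply: HM.
  by rewrite (leq_trans Mn) // leq_addl.
pose t := cnorm l + 1.
have vt n : cnorm (v n) <= t.
  have := HN _ (leq_addr n N); have := cnormD (v n - l) l.
  by rewrite subrK /v /t; lra.
have sl : selfadjoint l.
  apply: (converges_unique (converges_star ul)); apply: eq_converges ul => n.
  by rewrite psd_selfadjoint.
have [|b [sb _ bE _]] := @ball_root l t sl; last by exists b.
apply: (@converges_norm_le (fun n => t%:C *: 1 - v n)) => [|n]; last first.
  by apply: psd_ball; rewrite ?vt //; exact: pu.
have := convergesD (converges_cst (t%:C *: 1)) (convergesZ (-1) vl).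
rewrite rmorphN1 scaleN1r; apply: eq_converges => n.
by rewrite scaleN1r.
Qed.

(** Commuting roots b of y and c of 1 - y make b + ic unitary, whence y = b^2 has norm at most 1.
    Scaling gives every positive bound, and adding a small e to t covers t = 0. *)
Lemma psd_norm_le x t : 0 <= t -> psd x -> psd (t%:C *: 1 - x) -> cnorm x <= t.
Proof.
have one y : psd y -> psd (1 - y) -> cnorm y <= 1.
  move=> /psd_root[b [sb _ bE bc]] /psd_root[c [sc _ cE cc]].
  have byE : b * y = y * b by rewrite bE mulrA.
  have bcE : b * c = c * b.
    by apply: cc; rewrite mulrBr mulrBl mulr1 mul1r byE.
  have [|b1 _] := unitary_parts sb sc bcE; first by rewrite -bE -cE addrC subrK.
  by rewrite bE cnorm_sqr // expr_le1 // cnorm_ge0.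
have pos : forall r, 0 < r -> psd x -> psd (r%:C *: 1 - x) -> cnorm x <= r.
  move=> r r0 px prx.
  have rK w : r^-1%:C *: (r%:C *: w) = w.
    by rewrite scalerA -rmorphM /= mulVf ?rmorph1 ?scale1r // lt0r_neq0.
  have ri : 0 <= r^-1 by rewrite invr_ge0 ltW.
  have := one _ (psdZ ri px); have := psdZ ri prx.
  rewrite scalerBr rK => h /(_ h); rewrite cnormZr ger0_norm //.
  by rewrite mulrC ler_pdivrMr // mul1r.
move=> t0 px ptx; apply/ler_addgt0Pr => e e0; apply: pos => //; first by lra.
rewrite rmorphD /= scalerDl addrAC; apply: psdD => //.
apply: psdZ; first exact: ltW.
by exists 1; rewrite ?mulr1 //; exact: star1.
Qed.

Lemma psd_antisym x : psd x -> psd (- x) -> x = 0.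
Proof.
move=> px nx; apply: cnorm0_eq0; apply/eqP; rewrite eq_le cnorm_ge0 andbT.
by apply: psd_norm_le; rewrite ?scale0r ?sub0r.
Qed.

(* n is |a| - a, twice the negative part of a, and s is the square root of |a|. *)
Lemma negative_part a : selfadjoint a -> exists n s,
  [/\ selfadjoint n, selfadjoint (s * n), n * a * n = - (s * n * (s * n)) &
      s * n = 0 -> psd a].
Proof.
move=> sa; have paa : psd (a * a) by exists a.
have [m [sm pm mE mc]] := psd_root paa.
have [s [ss _ sE sc]] := psd_root pm.
have am : a * m = m * a by apply: mc; rewrite mulrA.
have as_ : a * s = s * a by apply: sc.
have ms : m * s = s * m by rewrite sE mulrA.
pose n := m - a.
have sn : selfadjoint n by rewrite /selfadjoint starB sm sa.
have ns : n * s = s * n by rewrite mulrBl mulrBr ms as_.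
have an : a * n = - (m * n).
  by rewrite !mulrBr mE am opprB.
have na : n * a = a * n by rewrite mulrBr mulrBl am.
exists n, s; split => //.
- by rewrite /selfadjoint starM sn ss.
- rewrite na an mulNr sE; congr (- _).
  by rewrite -!mulrA; congr (s * _); rewrite !mulrA ns.
- move=> sn0; have mn0 : m * n = 0 by rewrite sE -mulrA sn0 mulr0.
  have nn : n * n = 0 by rewrite {1}/n mulrBl an mn0 oppr0 subrr.
  by have /eqP := sqr_eq0 sn nn; rewrite subr_eq0 => /eqP <-.
Qed.

(** In terms of the selfadjoint elements x = b + [star b] and y = i([star b] - b), the sum is (x^2 +
    y^2)/2. *)
Lemma psd_star_mul_add b : psd (star b * b + b * star b).
Proof.
set I := ('i%C : R[i]).
have II : I * I = -1 by rewrite -expr2 sqr_i.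
have Ic : I^*%R = - I.
  rewrite -[_^*%R]/(conjc I) /I /=.
  by apply/eqP; rewrite eq_complex /= oppr0 !eqxx.
pose x := b + star b; pose y := I *: (star b - b).
have sx : selfadjoint x by rewrite /selfadjoint starD starK addrC.
have sy : selfadjoint y.
  by rewrite /selfadjoint starZ Ic starB starK scaleNr -scalerN opprB.
have half w : (2^-1)%:C *: (w + w) = w :> A.
  rewrite -mulr2n -scaler_nat scalerA -(@rmorph_nat _ _ (real_complex R)) -rmorphM /=.
  by rewrite mulVf ?rmorph1 ?scale1r // pnatr_eq0.
have -> : star b * b + b * star b = (2^-1)%:C *: (x * x + y * y).
  rewrite -[LHS]half; congr (_ *: _).
  rewrite /x /y -scalerAl -scalerAr scalerA II scaleN1r; nc_ring.
apply: psdZ; first by rewrite invr_ge0.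
by apply: psdD; [exists x | exists y].
Qed.

(** For b = c n, with n twice the negative part of [star c * c], one has [star b * b = - p] with p a
    square. With r the root of p and q = [b * star b], [psd_star_mul_add] at b r says that -(p^2 +
    q^2) is a square, which forces p = 0. This replaces the comparison of the spectra of
    [star b * b] and [b * star b]. *)
Lemma psd_star_mul c : psd (star c * c).
Proof.
have [|n [s [sn ssn nan]]] := @negative_part (star c * c).
  by rewrite /selfadjoint starM starK.
apply; pose b := c * n; pose p := s * n * (s * n).
have bb : star b * b = - p by rewrite -nan /b starM sn !mulrA.
have [r [sr _ pE _]] : exists r : A, [/\ selfadjoint r, psd r, p = r * r &
    forall z, z * p = p * z -> z * r = r * z].
  by apply: psd_root; exists (s * n).
pose q := b * star b.
have sp : selfadjoint p by rewrite /selfadjoint pE starM sr.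
have sq : selfadjoint q by rewrite /selfadjoint starM starK.
have := psd_star_mul_add (b * r); rewrite starM sr.
have -> : r * star b * (b * r) + b * r * (r * star b) = - (p * p + q * q).
  have -> : r * star b * (b * r) = - (p * p).
    have -> : r * star b * (b * r) = r * (star b * b) * r by nc_ring.
    by rewrite bb pE; nc_ring.
  have -> : b * r * (r * star b) = - (q * q).
    have -> : b * r * (r * star b) = b * (r * r) * star b by nc_ring.
    by rewrite -pE -[p]opprK -bb /q; nc_ring.
  by nc_ring.
move=> npq; have pp : psd (p * p) by exists p.
have qq : psd (q * q) by exists q.
have /eqP := psd_antisym (psdD pp qq) npq.
rewrite addr_eq0 => /eqP ppE.
have p0 : p * p = 0 by apply: psd_antisym => //; rewrite ppE opprK.
exact/(sqr_eq0 ssn)/(sqr_eq0 sp).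
Qed.

Lemma positiveP x : positive x <-> psd x.
Proof.
by split=> [[c ->]|[b sb ->]]; [exact: psd_star_mul | exists b; rewrite sb].
Qed.

End CStarTheory.

(** * Matrices over a C*-algebra *)

Section MatrixStar.
Variables (K : numClosedFieldType) (A : starAlgType K).

Lemma mxstarE n (M : 'M[A]_n) i j : mxstar M i j = star (M j i).
Proof. by rewrite !mxE. Qed.

Lemma mxstarK n : involutive (@mxstar K A n).
Proof.
move=> M; apply/matrixP => i j.
by rewrite !mxstarE starK. Qed.

Lemma mxstarD n : {morph @mxstar K A n : M N / M + N}.
Proof. by move=> M N; apply/matrixP => i j; rewrite !mxE starD. Qed.

Lemma mxstarM n (M N : 'M[A]_n) : mxstar (M *m N) = mxstar N *m mxstar M.
Proof.
apply/matrixP => i j; rewrite mxstarE !mxE star_sum; apply: eq_bigr => k _.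
by rewrite starM !mxstarE.
Qed.

Definition ip n (x y : 'cV[A]_n) : A := \sum_i star (x i 0) * y i 0.

(** Scaling by the field; the operation [*:] on these matrices scales by elements of [A]. *)
Definition kscale m n (k : K) (M : 'M[A]_(m, n)) : 'M[A]_(m, n) :=
  map_mx (fun a => k *: a) M.

Lemma star_ip n (x y : 'cV[A]_n) : star (ip x y) = ip y x.
Proof. by rewrite star_sum; apply: eq_bigr => i _; rewrite starM starK. Qed.

Lemma ipDl n (x y z : 'cV[A]_n) : ip (x + y) z = ip x z + ip y z.
Proof. by rewrite -big_split; apply: eq_bigr => i _; rewrite mxE starD mulrDl. Qed.

Lemma ipDr n (x y z : 'cV[A]_n) : ip z (x + y) = ip z x + ip z y.
Proof. by rewrite -big_split; apply: eq_bigr => i _; rewrite mxE mulrDr. Qed.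

Lemma ipZl n k (x y : 'cV[A]_n) : ip (kscale k x) y = k^* *: ip x y.
Proof.
by rewrite scaler_sumr; apply: eq_bigr => i _; rewrite mxE starZ scalerAl.
Qed.

Lemma ipZr n k (x y : 'cV[A]_n) : ip x (kscale k y) = k *: ip x y.
Proof. by rewrite scaler_sumr; apply: eq_bigr => i _; rewrite mxE scalerAr. Qed.

Lemma ip_adj n (M : 'M[A]_n) x y : ip (M *m x) y = ip x (mxstar M *m y).
Proof.
rewrite /ip; under eq_bigr => i _ do rewrite mxE star_sum mulr_suml.
rewrite exchange_big /=; apply: eq_bigr => j _; rewrite mxE mulr_sumr.
by apply: eq_bigr => i _; rewrite starM mxstarE mulrA.
Qed.

Lemma mul_kscale_l m n p k (M : 'M[A]_(m, n)) (N : 'M[A]_(n, p)) :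
  kscale k M *m N = kscale k (M *m N).
Proof.
apply/matrixP => i j; rewrite !mxE scaler_sumr; apply: eq_bigr => l _.
by rewrite mxE scalerAl.
Qed.

Lemma mul_kscale_r m n p k (M : 'M[A]_(m, n)) (N : 'M[A]_(n, p)) :
  M *m kscale k N = kscale k (M *m N).
Proof.
apply/matrixP => i j; rewrite !mxE scaler_sumr; apply: eq_bigr => l _.
by rewrite mxE scalerAr.
Qed.

End MatrixStar.

(** * Operator bounds in the order of the algebra *)

Section MatrixBound.
Local Open Scope complex_scope.
Variables (R : realType) (A : cstarAlgType R).
Implicit Types (a b : A) (c d r s t e : R).

Lemma psd_conj a b : psd a -> psd (star b * a * b).
Proof.
move=> [w sw ->]; have -> : star b * (w * w) * b = star (w * b) * (w * b).
  by rewrite starM sw !mulrA.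
exact: psd_star_mul.
Qed.

Lemma psd_norm_sub a t : psd a -> cnorm a <= t -> psd (t%:C *: 1 - a).
Proof.
move=> pa at_; have [||b [sb _ bE _]] := @ball_root R A (t%:C *: 1 - a) t.
- by rewrite /selfadjoint starB (psd_selfadjoint pa) selfadjointZ //; exact: star1.
- by rewrite opprB addrC subrK.
- by exists b.
Qed.

Lemma psd_sqr_norm_sub a t : cnorm a <= t -> psd ((t ^+ 2)%:C *: 1 - star a * a).
Proof.
move=> at_; apply: psd_norm_sub; first exact: psd_star_mul.
by rewrite cnorm_star lerXn2r // nnegrE ?cnorm_ge0 // (le_trans _ at_) // cnorm_ge0.
Qed.

Lemma small_scalar e r : 0 < e -> 0 <= r -> exists2 s, 0 < s & s * r < e.
Proof.
move=> e0 r0; exists (e / (r + 1)); first by rewrite divr_gt0 //; lra.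
rewrite -mulrA -[ltRHS]mulr1 ltr_pM2l // mulrC ltr_pdivrMr; lra.
Qed.

Lemma converges_harmonic a b :
  converges (fun n => a + ((n.+1%:R)^-1 : R)%:C *: b) a.
Proof.
move=> e e0; have [s s0 sb] := small_scalar e0 (cnorm_ge0 b).
exists (Num.truncn s^-1) => n Nn; rewrite addrC addKr cnormZr.
rewrite ger0_norm ?invr_ge0 ?ler0n // (le_lt_trans _ sb) //.
apply: ler_wpM2r; first exact: cnorm_ge0.
rewrite invf_ple ?posrE ?ltr0n //; apply/ltW.
have := truncnS_gt s^-1; move/lt_le_trans; apply.
by rewrite ler_nat ltnS.
Qed.

Lemma psd_closed_eps a b : (forall e, 0 < e -> psd (a + e%:C *: b)) -> psd a.
Proof.
move=> h; apply: psd_limit (converges_harmonic a b) => n; apply: h.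
by rewrite invr_gt0 ltr0n.
Qed.

Lemma psd_ip n (x : 'cV[A]_n) : psd (ip x x).
Proof. by apply: psd_sum => i _; exact: psd_star_mul. Qed.

Lemma ip_eq0 n (x : 'cV[A]_n) : psd (- ip x x) -> x = 0.
Proof.
move=> nx.
apply/matrixP => i j; rewrite ord1 mxE; apply: cnorm0_eq0; apply/eqP.
rewrite -sqrf_eq0 -cnorm_star (_ : _ * _ = 0) ?cnorm0 //.
apply: psd_antisym; first exact: psd_star_mul.
move: nx; rewrite /ip (bigD1 i) //= opprD => h.
rewrite -[X in psd X]addr0 -[X in _ + X](subrr (\sum_(k | k != i) star (x k 0) * x k 0)).
rewrite addrCA addrC addrC; apply: psdD => //.
by apply: psd_sum => k _; exact: psd_star_mul.
Qed.

Lemma conj_real r : (r%:C : R[i])^*%R = r%:C.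
Proof. exact: conjc_real. Qed.

(** The square of s x - y/s. This weighted inequality stands in for Cauchy-Schwarz in the order of
    [A]; each use below picks its own weight s. *)
Lemma ip_difference n s (x y : 'cV[A]_n) : 0 < s ->
  psd ((s * s)%:C *: ip x x + (s^-1 * s^-1)%:C *: ip y y - (ip x y + ip y x)).
Proof.
move=> s0; have := psd_ip (kscale s%:C x + kscale (- s^-1)%:C y).
rewrite !ipDl !ipDr !ipZl !ipZr !conj_real !scalerA -!rmorphM /=.
rewrite !mulrN !mulNr !opprK mulfV ?mulVf ?lt0r_neq0 // rmorphN1 !scaleN1r.
by congr psd; nc_ring.
Qed.

Variable n : nat.
Implicit Types (M N : 'M[A]_n) (x y : 'cV[A]_n).

(** The bound compares [A]-valued inner products in the order of [A], so that no norm on the module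
    A^n has to be constructed. *)
Definition bounded M c := 0 <= c /\
  forall x, psd ((c ^+ 2)%:C *: ip x x - ip (M *m x) (M *m x)).

Lemma bounded_mono M c d : c <= d -> bounded M c -> bounded M d.
Proof.
move=> cd [c0 Mc]; split; first exact: le_trans cd.
move=> x; rewrite -[_ *: _](subrK ((c ^+ 2)%:C *: ip x x)) -addrA.
apply: psdD => //; rewrite -scalerBl -rmorphB /=; apply: psdZ; last exact: psd_ip.
by rewrite subr_ge0 lerXn2r // nnegrE // (le_trans c0).
Qed.

(** Lets the estimates below assume positive bounds, by which they divide. *)
Lemma bounded_closed M c : 0 <= c -> (forall e, 0 < e -> bounded M (c + e)) ->
  bounded M c.
Proof.
move=> c0 h; split=> // x; apply: (@psd_closed_eps _ (ip x x)) => e e0.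
have c1 : 0 <= 2 * c + 1 by lra.
have [s s0 se] := small_scalar e0 c1.
(* The cap at 1 gives s'^2 <= s', whence (c + s')^2 - c^2 <= s'(2c + 1) < e. *)
pose s' := Num.min s 1.
have s'0 : 0 < s' by rewrite lt_min s0 ltr01.
have s's : s' <= s by rewrite ge_min lexx.
have s'1 : s' <= 1 by rewrite ge_min lexx orbT.
have [_ /(_ x) hx] := h _ s'0.
have -> : (c ^+ 2)%:C *: ip x x - ip (M *m x) (M *m x) + e%:C *: ip x x =
    ((c + s') ^+ 2)%:C *: ip x x - ip (M *m x) (M *m x) +
    (c ^+ 2 + e - (c + s') ^+ 2)%:C *: ip x x.
  rewrite rmorphB /= rmorphD /= scalerBl scalerDl; nc_ring.
apply: psdD => //; apply: psdZ; last exact: psd_ip.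
have h1 : s' * (2 * c + 1) <= s * (2 * c + 1) by rewrite ler_wpM2r.
have h2 : s' * s' <= s' * 1 by rewrite ler_pM2l.
by move: se h1 h2; rewrite !expr2; lra.
Qed.

Lemma bounded0 : bounded 0 0.
Proof.
split=> // x; rewrite mul0mx expr0n scale0r sub0r.
have -> : ip (0 : 'cV[A]_n) 0 = 0 by apply: big1 => i _; rewrite mxE mulr0.
by rewrite oppr0; exact: psd0.
Qed.

Lemma boundedD M N c d : bounded M c -> bounded N d -> bounded (M + N) (c + d).
Proof.
suff pos c' d' : 0 < c' -> 0 < d' -> bounded M c' -> bounded N d' ->
    bounded (M + N) (c' + d').
  move=> Mc Nd; have [c0 _] := Mc; have [d0 _] := Nd.
  apply: bounded_closed => [|e e0]; first by lra.
  have e2 : 0 < e / 2 by rewrite divr_gt0.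
  have -> : c + d + e = (c + e / 2) + (d + e / 2) by field.
  apply: pos; try (by lra); [apply: bounded_mono Mc | apply: bounded_mono Nd]; lra.
move=> c0 d0 [_ Mc] [_ Nd]; split=> [|x]; first by lra.
(* The weight for which the two bounds and the cross terms add up to exactly (c' + d')^2. *)
pose s := Num.sqrt (d' / c').
have s0 : 0 < s by rewrite sqrtr_gt0 divr_gt0.
have ss : s * s = d' / c' by rewrite sqrt_mul_sqrt // ltW // divr_gt0.
have si : s^-1 * s^-1 = c' / d' by rewrite -invfM ss invf_div.
set u := M *m x; set v := N *m x.
have h1 := psdZ (_ : 0 <= 1 + d' / c') (Mc x).
have h2 := psdZ (_ : 0 <= 1 + c' / d') (Nd x).
have h3 := @ip_difference n s u v s0.
have dc : 0 <= d' / c' by rewrite divr_ge0 // ltW.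
have cd : 0 <= c' / d' by rewrite divr_ge0 // ltW.
have := psdD (psdD (h1 _) (h2 _)) h3; rewrite -/u -/v => h.
have : psd (((c' + d') ^+ 2)%:C *: ip x x - ip (u + v) (u + v)); last first.
  by rewrite mulmxDl.
have := h ltac:(lra) ltac:(lra); congr psd.
rewrite !ipDl !ipDr ss si !scalerBr !scalerA -!rmorphM /= !rmorphD /= !scalerDl.
rewrite rmorph1 !scale1r.
have -> : (c' + d') ^+ 2 = (1 + d' / c') * c' ^+ 2 + (1 + c' / d') * d' ^+ 2.
  by field; rewrite !lt0r_neq0.
rewrite rmorphD /= scalerDl; nc_ring.
Qed.

Lemma bounded_sum (I : Type) (s : seq I) (F : I -> 'M[A]_n) (c : I -> R) :
  (forall i, bounded (F i) (c i)) ->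
  bounded (\sum_(i <- s) F i) (\sum_(i <- s) c i).
Proof.
move=> h; elim: s => [|i s IH]; first by rewrite !big_nil; exact: bounded0.
by rewrite !big_cons; exact: boundedD.
Qed.

Lemma bounded_delta a i j : bounded (a *: delta_mx i j) (cnorm a).
Proof.
split=> [|x]; first exact: cnorm_ge0.
have -> : ip ((a *: delta_mx i j) *m x) ((a *: delta_mx i j) *m x) =
    star (x j 0) * (star a * a) * x j 0.
  have E k : ((a *: delta_mx i j) *m x) k 0 = if k == i then a * x j 0 else 0.
    rewrite mxE (bigD1 j) //= !mxE eqxx andbT big1 ?addr0 => [|l lj].
      by case: eqP => _; rewrite ?mulr1 // mulr0 mul0r.
    by rewrite !mxE (negPf lj) andbF mulr0 mul0r.
  rewrite /ip (bigD1 i) //= E eqxx big1 ?addr0 => [|k ki].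
    by rewrite starM !mulrA.
  by rewrite E (negPf ki) mulr0.
rewrite /ip (bigD1 j) //= scalerDr addrAC; apply: psdD; last first.
  apply: psdZ; first exact: sqr_ge0.
  by apply: psd_sum => k _; exact: psd_star_mul.
have := psd_conj (x j 0) (psd_sqr_norm_sub (lexx (cnorm a))).
by rewrite mulrBr mulrBl -scalerAr -scalerAl mulr1.
Qed.

(** Every matrix has some bound. Together with [bounded_entry] this squeezes the norm between the
    norm of each entry and the sum of these norms, so that completeness can be checked entrywise. *)
Lemma bounded_entries M : bounded M (\sum_i \sum_j cnorm (M i j)).
Proof.
rewrite {1}[M]matrix_sum_delta; apply: bounded_sum => i.
by apply: bounded_sum => j; exact: bounded_delta.
Qed.

Lemma bounded_entry M c i j : bounded M c -> cnorm (M i j) <= c.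
Proof.
move=> [c0 Mc]; have := Mc (delta_mx j 0).
have -> : ip (delta_mx j 0 : 'cV[A]_n) (delta_mx j 0) = 1.
  rewrite /ip (bigD1 j) //= !mxE !eqxx star1 mulr1 big1 ?addr0 // => k kj.
  by rewrite !mxE (negPf kj) mulr0.
have E k : (M *m delta_mx j 0 : 'cV[A]_n) k 0 = M k j.
  rewrite mxE (bigD1 j) //= mxE !eqxx mulr1 big1 ?addr0 // => l lj.
  by rewrite mxE (negPf lj) mulr0.
move=> h; have {}h : psd ((c ^+ 2)%:C *: 1 - star (M i j) * M i j).
  move: h; rewrite /ip (bigD1 i) //= E opprD addrA => h.
  rewrite -[X in psd X](subrK (\sum_(k | k != i)
     star ((M *m delta_mx j 0 : 'cV[A]_n) k 0) * (M *m delta_mx j 0 : 'cV[A]_n) k 0)).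
  apply: psdD => //; by apply: psd_sum => k _; exact: psd_star_mul.
have := psd_norm_le (sqr_ge0 c) (psd_star_mul _) h.
by rewrite cnorm_star ler_pXn2r // nnegrE // cnorm_ge0.
Qed.

Lemma boundedM M N c d : bounded M c -> bounded N d -> bounded (M *m N) (c * d).
Proof.
move=> [c0 Mc] [d0 Nd]; split=> [|x]; first exact: mulr_ge0.
have h := psdD (Mc (N *m x)) (psdZ (sqr_ge0 c) (Nd x)).
move: h; rewrite mulmxA scalerBr scalerA -rmorphM /= -exprMn.
by congr psd; nc_ring.
Qed.

Lemma boundedZ (k : R[i]) M c : bounded M c -> bounded (kscale k M) (Normc.normc k * c).
Proof.
move=> [c0 Mc]; have k0 : 0 <= Normc.normc k by case: (k) => u v; exact: sqrtr_ge0.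
split=> [|x]; first exact: mulr_ge0.
have -> : ip (kscale k M *m x) (kscale k M *m x) =
    (Normc.normc k ^+ 2)%:C *: ip (M *m x) (M *m x).
  rewrite mul_kscale_l ipZl ipZr scalerA; congr (_ *: _).
  case: (k) => u v /=; rewrite sqr_sqrtr ?addr_ge0 ?sqr_ge0 //.
  rewrite -[_^*%R]/(conjc _) /=; apply/eqP; rewrite eq_complex /=.
  by apply/andP; split; apply/eqP; ring.
by rewrite exprMn rmorphM /= -scalerA -scalerBr; apply: psdZ => //; exact: sqr_ge0.
Qed.

(** For y = [mxstar M *m x] one has <y,y> = <x,My>, so 2<y,y> <= c^2 <x,x> + c^-2 <My,My> <= c^2
    <x,x> + <y,y>. *)
Lemma bounded_star M c : bounded M c -> bounded (mxstar M) c.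
Proof.
suff pos d : 0 < d -> bounded M d -> bounded (mxstar M) d.
  move=> Mc; have [c0 _] := Mc; apply: bounded_closed => // e e0.
  by apply: pos; [lra | apply: bounded_mono Mc; lra].
move: d => {}c c0 [_ Mc]; split=> [|x]; first exact: ltW.
set y := mxstar M *m x.
have h1 := @ip_difference n c x (M *m y) c0.
have yx : ip (M *m y) x = ip y y by rewrite ip_adj.
have xy : ip x (M *m y) = ip y y by rewrite -star_ip yx star_ip.
have ci : 0 <= (c ^+ 2)^-1 by rewrite invr_ge0 sqr_ge0.
have h2 := psdZ ci (Mc y).
have := psdD h1 h2; rewrite yx xy scalerBr scalerA -rmorphM /=.
rewrite mulVf ?expf_neq0 ?lt0r_neq0 // rmorph1 scale1r -invfM -!expr2.
by congr psd; nc_ring.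
Qed.

(** The substantial half of the C*-identity. With v = [mxstar M *m M *m x], the sum <x,v> + <v,x> is
    2<Mx,Mx>, and it is at most e^2 <x,x> + e^-2 <v,v> <= 2 e^2 <x,x>. *)
Lemma bounded_sqrt M e : 0 <= e -> bounded (mxstar M *m M) (e ^+ 2) -> bounded M e.
Proof.
suff pos d : 0 < d -> bounded (mxstar M *m M) (d ^+ 2) -> bounded M d.
  move=> e0 he; apply: bounded_closed => // d d0; apply: pos; first by lra.
  by apply: bounded_mono he; rewrite lerXn2r ?nnegrE; lra.
move: d => {}e e0 [_ he]; split=> [|x]; first exact: ltW.
set v := mxstar M *m M *m x.
have h1 := @ip_difference n e x v e0.
have xv : ip x v = ip (M *m x) (M *m x) by rewrite ip_adj mulmxA.
have vx : ip v x = ip (M *m x) (M *m x) by rewrite -star_ip xv star_ip.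
have ei : 0 <= (e ^+ 2)^-1 by rewrite invr_ge0 sqr_ge0.
have h2 := psdZ ei (he x).
have half : 0 <= 2^-1 :> R by rewrite invr_ge0.
have := psdZ half (psdD h1 h2).
rewrite xv vx scalerBr scalerA -rmorphM /= -/v.
have -> : (e ^+ 2)^-1 * (e ^+ 2) ^+ 2 = e ^+ 2 by field; rewrite lt0r_neq0.
rewrite -invfM -!expr2.
set p := _ *: ip x x; set q := ip (M *m x) (M *m x); set r := _ *: ip v v.
have -> : p + r - (q + q) + (p - r) = (p - q) + (p - q) by nc_ring.
rewrite -mulr2n -scaler_nat scalerA -(@rmorph_nat _ _ (real_complex R)) -rmorphM /=.
by rewrite mulVf ?pnatr_eq0 // rmorph1 scale1r.
Qed.

End MatrixBound.

(** * The C*-algebra of square matrices *)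

Section MatrixCStar.
Local Open Scope complex_scope.
Variables (R : realType) (A : cstarAlgType R) (n : nat).

(* A copy of the matrix ring with the scalars R[i] instead of A. *)
Definition cmx : Type := 'M[A]_n.+1.

HB.instance Definition _ := GRing.NzRing.on cmx.

Let cscale (k : R[i]) (M : cmx) : cmx := kscale k M.

Lemma cscaleA k l M : cscale k (cscale l M) = cscale (k * l) M.
Proof. by apply/matrixP => i j; rewrite !mxE scalerA. Qed.

Lemma cscale1 : left_id 1 cscale.
Proof. by move=> M; apply/matrixP => i j; rewrite !mxE scale1r. Qed.

Lemma cscaleDr : right_distributive cscale +%R.
Proof. by move=> k M N; apply/matrixP => i j; rewrite !mxE scalerDr. Qed.

Lemma cscaleDl M : {morph cscale^~ M : k l / k + l}.
Proof. by move=> k l; apply/matrixP => i j; rewrite !mxE scalerDl. Qed.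

HB.instance Definition _ := GRing.Zmodule_isLmodule.Build R[i] cmx
  cscaleA cscale1 cscaleDr cscaleDl.

Lemma cmx_scaleE (k : R[i]) (M : cmx) : k *: M = kscale k M.
Proof. by []. Qed.

Lemma cscaleAl (k : R[i]) (M N : cmx) : k *: (M * N) = (k *: M) * N.
Proof. exact/esym/mul_kscale_l. Qed.

HB.instance Definition _ := GRing.Lmodule_isLalgebra.Build R[i] cmx cscaleAl.

Lemma cscaleAr (k : R[i]) (M N : cmx) : k *: (M * N) = M * (k *: N).
Proof. exact/esym/mul_kscale_r. Qed.

HB.instance Definition _ := GRing.Lalgebra_isAlgebra.Build R[i] cmx cscaleAr.

Let cstar (M : cmx) : cmx := mxstar M.

Lemma cmx_starZ (k : R[i]) (M : cmx) : cstar (k *: M) = k^*%R *: cstar M.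
Proof. by apply/matrixP => i j; rewrite !cmx_scaleE !mxE starZ. Qed.

HB.instance Definition _ := hasStar.Build R[i] cmx
  (@mxstarK _ A n.+1) (@mxstarD _ A n.+1) (@mxstarM _ A n.+1) cmx_starZ.

Definition cmx_norm (M : cmx) : R := inf [set c | bounded M c]%classic.

Lemma cmx_norm_lb M c : bounded M c -> cmx_norm M <= c.
Proof.
move=> Mc; apply: ge_inf => //; exists 0 => d [d0 _]; exact: d0.
Qed.

(** The infimum is attained because the bounds of a matrix form a closed set; each norm inequality
    then reduces to exhibiting a bound. *)
Lemma bounded_cmx_norm M : bounded M (cmx_norm M).
Proof.
have ne : ([set c | bounded M c] !=set0)%classic.
  by eexists; exact: bounded_entries.
have hi : has_inf [set c | bounded M c]%classic.
  by split=> //; exists 0 => d [d0 _]; exact: d0.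
apply: bounded_closed => [|e e0].
  by apply: lb_le_inf => // d [d0 _]; exact: d0.
have [c Mc ce] := inf_adherent e0 hi.
by apply: bounded_mono Mc; exact: ltW.
Qed.

Lemma cmx_norm_entry (M : cmx) i j : cnorm (M i j) <= cmx_norm M.
Proof. exact/bounded_entry/bounded_cmx_norm. Qed.

Lemma cmx_norm_le_entries (M : cmx) : cmx_norm M <= \sum_i \sum_j cnorm (M i j).
Proof. exact/cmx_norm_lb/bounded_entries. Qed.

Lemma cmx_norm_ge0 M : 0 <= cmx_norm M.
Proof. by have [] := bounded_cmx_norm M. Qed.

Lemma cmx_norm0_eq0 M : cmx_norm M = 0 -> M = 0.
Proof.
move=> M0; apply/matrixP => i j; rewrite mxE; apply: cnorm0_eq0.
by apply/eqP; rewrite eq_le cnorm_ge0 andbT -M0 cmx_norm_entry.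
Qed.

Lemma cmx_normD M N : cmx_norm (M + N) <= cmx_norm M + cmx_norm N.
Proof. by apply/cmx_norm_lb/boundedD; exact: bounded_cmx_norm. Qed.

Lemma cmx_normM (M N : cmx) : cmx_norm (M * N) <= cmx_norm M * cmx_norm N.
Proof. by apply/cmx_norm_lb/boundedM; exact: bounded_cmx_norm. Qed.

Lemma cmx_normZ (k : R[i]) M : cmx_norm (k *: M) = Normc.normc k * cmx_norm M.
Proof.
have le (l : R[i]) N : cmx_norm (l *: N) <= Normc.normc l * cmx_norm N.
  by apply/cmx_norm_lb/boundedZ; exact: bounded_cmx_norm.
apply/eqP; rewrite eq_le le /=.
have [->|k0] := eqVneq k 0; first by rewrite Normc.normc0 mul0r cmx_norm_ge0.
have nk : Normc.normc k != 0.
  by apply: contra k0 => /eqP /Normc.eq0_normc ->.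
have nk0 : 0 < Normc.normc k.
  by rewrite lt0r nk; case: (k) => u v; exact: sqrtr_ge0.
have := le k^-1 (k *: M).
by rewrite scalerA mulVf // scale1r Normc.normcV ler_pdivlMl.
Qed.

Lemma cmx_norm_star (M : cmx) : cmx_norm (star M * M) = cmx_norm M ^+ 2.
Proof.
apply/eqP; rewrite eq_le; apply/andP; split.
  rewrite (le_trans (cmx_normM _ _)) // expr2 ler_wpM2r ?cmx_norm_ge0 //.
  exact/cmx_norm_lb/bounded_star/bounded_cmx_norm.
set r := cmx_norm (star M * M); have r0 : 0 <= r by exact: cmx_norm_ge0.
have : cmx_norm M <= Num.sqrt r.
  apply/cmx_norm_lb/bounded_sqrt; first exact: sqrtr_ge0.
  by rewrite sqr_sqrtr //; exact: bounded_cmx_norm.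
move=> h; have : cmx_norm M ^+ 2 <= Num.sqrt r ^+ 2.
  by rewrite lerXn2r // nnegrE ?cmx_norm_ge0 ?sqrtr_ge0.
by rewrite sqr_sqrtr.
Qed.

Lemma cmx_converges (u : nat -> cmx) (l : cmx) :
  (forall i j, converges (fun k => u k i j) (l i j)) ->
  forall e : R, 0 < e -> exists N, forall k, (N <= k)%N -> cmx_norm (u k - l) < e.
Proof.
move=> ul e e0; pose c : R := (n.+1 * n.+1)%:R.
have c0 : 0 < c by rewrite ltr0n.
have ec : 0 < e / (2 * c) by rewrite divr_gt0 // mulr_gt0.
have /choice[N HN] : forall ij : 'I_n.+1 * 'I_n.+1, exists N, forall k, (N <= k)%N ->
    cnorm (u k ij.1 ij.2 - l ij.1 ij.2) < e / (2 * c).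
  by move=> [i j]; exact: ul.
exists (\max_ij N ij) => k Nk; apply: le_lt_trans (cmx_norm_le_entries _) _.
apply: (@le_lt_trans _ _ (\sum_(i < n.+1) \sum_(j < n.+1) (e / (2 * c)))).
  apply: ler_sum => i _; apply: ler_sum => j _; rewrite !mxE; apply/ltW/(HN (i, j)).
  by apply: leq_trans Nk; exact: leq_bigmax.
rewrite !sumr_const card_ord -mulrnA -[ltLHS]mulr_natr -/c.
have e20 : e / 2 < e by rewrite ltr_pdivrMr // mulr_natr mulr2n ltrDl.
by rewrite invfM mulrA -mulrA mulVf ?mulr1 // lt0r_neq0.
Qed.

Lemma cmx_complete (u : nat -> cmx) :
  (forall e : R, 0 < e -> exists N, forall k m,
     (N <= k)%N -> (N <= m)%N -> cmx_norm (u k - u m) < e) ->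
  exists l, forall e : R, 0 < e -> exists N, forall k,
     (N <= k)%N -> cmx_norm (u k - l) < e.
Proof.
move=> cu.
have /choice[l hl] : forall ij : 'I_n.+1 * 'I_n.+1, exists l : A,
    converges (fun k => u k ij.1 ij.2) l.
  move=> [i j]; apply: cnorm_complete => e /cu[N HN]; exists N => k m Nk Nm.
  apply: le_lt_trans (HN k m Nk Nm).
  by have := cmx_norm_entry (u k - u m) i j; rewrite !mxE.
exists (\matrix_(i, j) l (i, j)); apply: cmx_converges => i j.
by rewrite mxE; exact: (hl (i, j)).
Qed.

HB.instance Definition _ := isCStar.Build R cmx cmx_norm0_eq0 cmx_normD cmx_normZ
  cmx_normM cmx_norm_star cmx_complete.

Lemma mxpositive_psd (M : cmx) : mxpositive M <-> psd M.
Proof. exact: (@positiveP R cmx M). Qed.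

End MatrixCStar.

(** * Positivity of matrices tested on vectors *)

Section MatrixPositivity.
Local Open Scope complex_scope.
Variables (R : realType) (A : cstarAlgType R).

Lemma mxpositive0 (M : 'M[A]_0) : mxpositive M.
Proof. by exists 0; apply/matrixP => -[]. Qed.

Lemma mxpositiveD n (M N : 'M[A]_n) :
  mxpositive M -> mxpositive N -> mxpositive (M + N).
Proof.
case: n M N => [|n] M N; first by move=> *; exact: mxpositive0.
by move=> /mxpositive_psd pM /mxpositive_psd pN; apply/mxpositive_psd/psdD.
Qed.

Lemma ip_deltaE n (M : 'M[A]_n) i j :
  ip (delta_mx i 0) (M *m delta_mx j 0 : 'cV[A]_n) = M i j.
Proof.
rewrite /ip (bigD1 i) //= [X in _ + X]big1 => [|k ki]; last first.
  by rewrite mxE (negPf ki) /= star0 mul0r.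
rewrite !mxE !eqxx star1 mul1r addr0 (bigD1 j) //= mxE !eqxx mulr1 big1 ?addr0 //.
by move=> k kj; rewrite mxE (negPf kj) mulr0.
Qed.

(** Polarisation: the hypothesis at u + v and at u + iv yields the symmetric and the antisymmetric
    combination of the two forms on basis vectors. *)
Lemma ip_selfadjoint n (M : 'M[A]_n) :
  (forall x, selfadjoint (ip x (M *m x))) -> mxstar M = M.
Proof.
move=> h; apply/matrixP => i j; rewrite mxstarE -!ip_deltaE star_ip.
have polar u v : ip (M *m u) v + ip (M *m v) u = ip u (M *m v) + ip v (M *m u).
  have := h (u + v); rewrite /selfadjoint star_ip mulmxDr !ipDl !ipDr.
  have := h u; have := h v; rewrite /selfadjoint !star_ip => -> -> e.
  apply: (addrI (ip u (M *m u) + ip v (M *m v))).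
  transitivity (ip u (M *m u) + ip (M *m u) v + (ip (M *m v) u + ip v (M *m v))).
    by nc_ring.
  by rewrite e; nc_ring.
move: (delta_mx i 0) (delta_mx j 0) => u v.
have h1 := polar u v; have h2 := polar u (kscale 'i v).
have Ic : ('i%C : R[i])^*%R = - 'i.
  by rewrite -[LHS]/(conjc _) /=; apply/eqP; rewrite eq_complex /= oppr0 !eqxx.
have I0 : 'i%C != 0 :> R[i] by rewrite eq_complex /= oner_eq0 andbF.
move: h2; rewrite !mul_kscale_r !ipZl !ipZr Ic !scaleNr -!scalerBr.
move/(scalerI I0) => h2; apply: (@scalerI _ _ (2%:R : R[i])); first by rewrite pnatr_eq0.
rewrite !scaler_nat !mulr2n.
transitivity (ip (M *m u) v + ip (M *m v) u + (ip (M *m u) v - ip (M *m v) u)).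
  by nc_ring.
by rewrite h1 h2; nc_ring.
Qed.

(** For the converse, let P be twice the negative part of M and S the root of its modulus, so that P
    M P = -(S P)^2. Then <SPx,SPx> = -<Px,MPx> <= 0, hence S P = 0 and M is a square. Size zero is
    treated apart because [cmx] has positive size. *)
Lemma mxpositive_ip n (M : 'M[A]_n) :
  mxpositive M <-> forall x, positive (ip x (M *m x)).
Proof.
split=> [[C ->] x|h].
  by rewrite -mulmxA -ip_adj; apply/positiveP; exact: psd_ip.
case: n M h => [|n] M h; first exact: mxpositive0.
have {}h x : psd (ip x (M *m x)) by apply/positiveP.
have sM : @selfadjoint R (cmx A n) M.
  by apply: ip_selfadjoint => x; apply: psd_selfadjoint; exact: h.
have [P [S [sP sSP PMP]]] := negative_part sM.
have sSP' : mxstar (S *m P) = S *m P by exact: sSP.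
have sP' : mxstar P = P by exact: sP.
move=> SP0; apply/mxpositive_psd/SP0.
have SPx (x : 'cV[A]_n.+1) : (S *m P) *m x = 0.
  apply: ip_eq0; rewrite ip_adj sSP' mulmxA.
  have -> : S *m P *m (S *m P) = - (P *m M *m P).
    by rewrite -[P *m M *m P]/(P * M * P : cmx A n) PMP opprK.
  rewrite mulNmx -!mulmxA -{1}sP'.
  have -> y : ip x (- y) = - ip x y.
    by apply: (addrI (ip x y)); rewrite -ipDr !subrr /ip big1 // => k _; rewrite mxE mulr0.
  by rewrite opprK -ip_adj; exact: h.
apply/matrixP => i j; rewrite mxE.
have := congr1 (fun v : 'cV[A]_n.+1 => v i 0) (SPx (delta_mx j 0)).
by rewrite -colE !mxE.
Qed.

Lemma mxpositive_gram_row n (I : finType) (h : I -> 'I_n -> A) :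
  mxpositive (\matrix_(j, i) \sum_e star (h e j) * h e i).
Proof.
apply/mxpositive_ip => x; apply/positiveP.
suff -> : ip x ((\matrix_(j, i) \sum_e star (h e j) * h e i) *m x) =
    \sum_e star (\sum_i h e i * x i 0) * (\sum_i h e i * x i 0).
  by apply: psd_sum => e _; exact: psd_star_mul.
rewrite /ip; under eq_bigr => j _.
  rewrite mxE mulr_sumr; under eq_bigr => i _ do rewrite mxE mulr_suml mulr_sumr.
  rewrite exchange_big /=; over.
rewrite exchange_big /=; apply: eq_bigr => e _.
rewrite star_sum mulr_suml; apply: eq_bigr => j _.
by rewrite mulr_sumr; apply: eq_bigr => i _; rewrite starM !mulrA.
Qed.

Lemma mxpositive_sumP n (M : 'M[A]_n) : mxpositive M ->
  exists h : 'I_n -> 'I_n -> A, forall j i, M j i = \sum_e star (h e j) * h e i.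
Proof.
move=> [C ->]; exists C => j i; rewrite mxE.
by apply: eq_bigr => e _; rewrite mxstarE.
Qed.

End MatrixPositivity.

(** * Moments with prescribed cumulants *)

Section LinearProp.
Variables (K : pzRingType) (U V : lmodType K) (f : U -> V).
Hypothesis f_lin : linear f.

Lemma lin_add x y : f (x + y) = f x + f y.
Proof. by have := f_lin 1 x y; rewrite !scale1r. Qed.

Lemma lin_0 : f 0 = 0.
Proof. by apply: (addrI (f 0)); rewrite -lin_add !addr0. Qed.

Lemma lin_scale k x : f (k *: x) = k *: f x.
Proof. by have := f_lin k x 0; rewrite lin_0 !addr0. Qed.

Lemma lin_opp x : f (- x) = - f x.
Proof. by rewrite -scaleN1r lin_scale scaleN1r. Qed.

Lemma lin_sub x y : f (x - y) = f x - f y.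
Proof. by rewrite lin_add lin_opp. Qed.

Lemma lin_sum (J : Type) (r : seq J) (P : pred J) (F : J -> U) :
  f (\sum_(i <- r | P i) F i) = \sum_(i <- r | P i) f (F i).
Proof. by apply: (big_morph f lin_add lin_0). Qed.

End LinearProp.

Section NcpolyInduction.
Variables (K : numClosedFieldType) (I : Type) (B : starAlgType K).

Lemma ncpoly_ind (Q : ncpoly I B -> Prop) :
  (forall b, Q (nccoef I b)) -> (forall i, Q (ncvar B i)) ->
  (forall f g, Q f -> Q g -> Q (f + g)) -> (forall f, Q f -> Q (- f)) ->
  (forall f g, Q f -> Q g -> Q (f * g)) -> forall f, Q f.
Proof.
move=> Qc Qv Qa Qo Qm; elim/ncpolyW; elim=> [b|i|s IHs t IHt|s IHs|s IHs t IHt].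
- exact: Qc.
- exact: Qv.
- by rewrite ncpiD; exact: Qa.
- by rewrite ncpiN; exact: Qo.
- by rewrite ncpiM; exact: Qm.
Qed.

Lemma nc_star_coef (b : B) : star (nccoef I b) = nccoef I (star b).
Proof. exact: ncstar_pi. Qed.

Lemma nc_star_var (i : I) : star (ncvar B i) = ncvar B i.
Proof. exact: ncstar_pi. Qed.

End NcpolyInduction.

(* The state after reading a prefix of a word is a pair: the value of the functional on
   the prefix, and, for the sum over the ways to have an unfinished block of colour i,
   the functional of what will fill the current gap of that block and of what will follow
   in its cumulant. *)
Section CumulantMoments.
Variables (K : numClosedFieldType) (I : eqType) (B D : starAlgType K).
Variables (iota : {lrmorphism B -> D}).
Variables (phi : ncpoly I B -> B) (rho : ncpoly unit B -> D).

Let X : ncpoly unit B := ncvar B tt.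

Definition state := (D * (I -> ncpoly I B -> ncpoly unit B -> D))%type.

(** A variable either completes a block, namely one of its own or the open one, or leaves a block
    open. In the second case it falls into the current gap, or, if the colours agree, it becomes a
    letter of the block: it starts the block or continues it, and the gap behind it will have the
    value [phi u]. Products are read from left to right. *)
Fixpoint step (s : ncterm I B) (v : state) : state :=
  match s with
  | Coef b => (v.1 * iota b, fun i u g => v.2 i (nccoef I b * u) g)
  | Var j =>
      (v.1 * rho X + v.2 j 1 X,
       fun i u g => v.2 i (ncvar B j * u) g +
         if i == j then v.1 * rho (X * nccoef unit (phi u) * g) +
                        v.2 j 1 (X * nccoef unit (phi u) * g)
         else 0)
  | Add s t => step s v + step t v
  | Opp s => - step s v
  | Mul s t => step t (step s v)
  end.

(** The invariants that make the relations of the free algebra hold for [step]: those on sums and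
    scalars of coefficients use linearity in the gap. The other clauses keep the invariant stable
    and yield right [B]-linearity of the moments. *)
Record regular (v : state) : Prop := {
  regular_gap : forall i g, linear (fun u => v.2 i u g);
  regular_arg : forall i u, linear (v.2 i u);
  regular_right : forall i u g b, v.2 i u (g * nccoef unit b) = v.2 i u g * iota b
}.

Hypothesis phi_lin : linear phi.
Hypothesis rho_lin : linear rho.
Hypothesis rho_right : forall g b, rho (g * nccoef unit b) = rho g * iota b.

Lemma state_ext (v w : state) :
  v.1 = w.1 -> (forall i u g, v.2 i u g = w.2 i u g) -> v = w.
Proof.
case: v w => [d p] [e q] /= -> pq; congr pair.
by apply/funext => i; apply/funext => u; apply/funext => g.
Qed.

Lemma regular_lin k v w : regular v -> regular w -> regular (k *: v + w).
Proof.
move=> [vg va vr] [wg wa wr]; split=> i.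
- move=> g l x y; rewrite -[LHS]/(k *: v.2 i (l *: x + y) g + w.2 i (l *: x + y) g).
  rewrite (vg i g) (wg i g) -[RHS]/(l *: (k *: v.2 i x g + w.2 i x g) +
    (k *: v.2 i y g + w.2 i y g)).
  by rewrite !scalerDr !scalerA [l * k]mulrC addrACA.
- move=> u l x y; rewrite -[LHS]/(k *: v.2 i u (l *: x + y) + w.2 i u (l *: x + y)).
  rewrite (va i u) (wa i u) -[RHS]/(l *: (k *: v.2 i u x + w.2 i u x) +
    (k *: v.2 i u y + w.2 i u y)).
  by rewrite !scalerDr !scalerA [l * k]mulrC addrACA.
- move=> u g b.
  rewrite -[LHS]/(k *: v.2 i u (g * nccoef unit b) + w.2 i u (g * nccoef unit b)).
  by rewrite vr wr -[RHS]/((k *: v.2 i u g + w.2 i u g) * iota b) mulrDl scalerAl.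
Qed.

Lemma regular0 : regular 0.
Proof.
split=> [i g k x y|i u k x y|i u g b].
- by rewrite -[LHS]/(0 : D) -[RHS]/(k *: (0 : D) + 0) scaler0 addr0.
- by rewrite -[LHS]/(0 : D) -[RHS]/(k *: (0 : D) + 0) scaler0 addr0.
- by rewrite -[LHS]/(0 : D) -[RHS]/((0 : D) * iota b) mul0r.
Qed.

Lemma regularD v w : regular v -> regular w -> regular (v + w).
Proof. by move=> rv rw; rewrite -[v]scale1r; exact: regular_lin. Qed.

Lemma regularN v : regular v -> regular (- v).
Proof.
by move=> rv; rewrite -scaleN1r -[_ *: _]addr0; apply: regular_lin; last exact: regular0.
Qed.

Lemma arg_lin g : linear (fun u => X * nccoef unit (phi u) * g).
Proof. by move=> k x y; rewrite phi_lin nccoefD nccoefZ mulrDr mulrDl -scalerAr -scalerAl. Qed.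

Lemma step_regular s v : regular v -> regular (step s v).
Proof.
elim: s v => [b|j|s IHs t IHt|s IHs|s IHs t IHt] v rv /=.
- case: rv => vg va vr; split=> i.
  + by move=> g k x y /=; rewrite mulrDr -scalerAr (vg i g).
  + by move=> u k x y /=; rewrite (va i).
  + by move=> u g c /=; rewrite vr.
- case: rv => vg va vr; split=> i.
  + move=> g k x y /=; rewrite mulrDr -scalerAr (vg i g).
    case: eqP => _; last by rewrite !addr0.
    rewrite (arg_lin g) (va j) rho_lin mulrDr -scalerAr !scalerDr.
    nc_ring.
  + move=> u k x y /=; rewrite (va i).
    case: eqP => _; last by rewrite !addr0.
    rewrite mulrDr -scalerAr (va j) rho_lin mulrDr -scalerAr !scalerDr.
    nc_ring.
  + move=> u g c /=; rewrite vr mulrDl; congr (_ + _).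
    by case: eqP => _; rewrite ?mul0r // mulrA rho_right vr mulrDl mulrA.
- by apply: regularD; [exact: IHs | exact: IHt].
- by apply: regularN; exact: IHs.
- by apply: IHt; exact: IHs.
Qed.

Lemma step_lin s k v w : step s (k *: v + w) = k *: step s v + step s w.
Proof.
elim: s k v w => [b|j|s IHs t IHt|s IHs|s IHs t IHt] k v w /=.
- apply: state_ext => //=.
  by rewrite mulrDl scalerAl.
- apply: state_ext => [|i u g] /=.
    rewrite mulrDl -scalerAl -[(_ + _) j 1 X]/(k *: v.2 j 1 X + w.2 j 1 X).
    by rewrite scalerDr addrACA.
  rewrite -[RHS]/(k *: (v.2 i (ncvar B j * u) g + if i == j then _ else 0) +
    (w.2 i (ncvar B j * u) g + if i == j then _ else 0)).
  rewrite -[(_ + _) i _ g]/(k *: v.2 i _ g + w.2 i _ g).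
  rewrite -[(_ + _) j 1 _]/(k *: v.2 j 1 _ + w.2 j 1 _).
  case: eqP => _; last by rewrite !addr0.
  rewrite mulrDl -scalerAl !scalerDr; nc_ring.
- by rewrite IHs IHt scalerDr addrACA.
- by rewrite IHs opprD scalerN.
- by rewrite IHs IHt.
Qed.

Lemma step_add s v w : step s (v + w) = step s v + step s w.
Proof. by have := step_lin s 1 v w; rewrite !scale1r. Qed.

Lemma step_scale s k v : step s (k *: v) = k *: step s v.
Proof.
have s0 : step s 0 = 0.
  by apply: (addrI (step s 0)); rewrite -step_add !addr0.
by have := step_lin s k v 0; rewrite s0 !addr0.
Qed.

Lemma step_coef_scalar (k : K) v : regular v -> step (Coef I k%:A) v = k *: v.
Proof.
move=> [vg _ _]; apply: state_ext => [|i u g] /=.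
  by rewrite linearZ /= rmorph1 -scalerAr mulr1.
by rewrite -ncscaleE (lin_scale (vg i g)).
Qed.

Lemma step_coef0 v : regular v -> step (Coef I 0) v = 0.
Proof. by move=> rv; rewrite -[0 in LHS](scale0r (1 : B)) step_coef_scalar // scale0r. Qed.

(** Makes the reading descend to the quotient. A scalar coefficient acts on a regular state as that
    scalar, hence commutes with every step, since steps are linear. *)
Lemma step_nceq s t : nceq s t -> forall v, regular v -> step s v = step t v.
Proof.
elim=> {s t} //=.
- by move=> s t _ IH v rv; rewrite IH.
- by move=> s t u _ IHs _ IHt v rv; rewrite IHs // IHt.
- by move=> s s' t t' _ IHs _ IHt v rv; rewrite IHs // IHt.
- by move=> s s' _ IH v rv; rewrite IH.
- by move=> s s' t t' _ IHs _ IHt v rv; rewrite IHs // IHt //; exact: step_regular.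
- by move=> s t u v _; rewrite addrA.
- by move=> s t v _; rewrite addrC.
- by move=> s v rv; rewrite -[X in X + _]/(step (Coef I 0) v) step_coef0 // add0r.
- by move=> s v rv; rewrite -[RHS]/(step (Coef I 0) v) step_coef0 // addNr.
- move=> s v rv; congr step; apply: state_ext => [|i u g] /=.
    by rewrite rmorph1 mulr1.
  by rewrite rmorph1 mul1r.
- move=> s v rv; apply: state_ext => [|i u g] /=; first by rewrite rmorph1 mulr1.
  by rewrite rmorph1 mul1r.
- by move=> s t u v rv; rewrite step_add.
- move=> a b v [vg _ _]; apply: state_ext => [|i u g] /=.
    by rewrite rmorphD mulrDr.
  by rewrite nccoefD mulrDl (lin_add (vg i g)).
- move=> a b v rv; apply: state_ext => [|i u g] /=; first by rewrite rmorphM mulrA.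
  by rewrite nccoefM mulrA.
- move=> k s v rv.
  rewrite -[(_ * _, _)]/(step (Coef I k%:A) v) step_coef_scalar //.
  rewrite -[RHS]/(step (Coef I k%:A) (step s v)) step_coef_scalar ?step_scale //.
  exact: step_regular.
Qed.

Definition run (v : state) (f : ncpoly I B) : state := step (repr f) v.

Lemma run_pi v s : regular v -> run v (ncpi s) = step s v.
Proof. by move=> rv; apply: step_nceq => //; exact: nceq_repr. Qed.

Lemma run_regular v f : regular v -> regular (run v f).
Proof. exact: step_regular. Qed.

Lemma runD v f g : regular v -> run v (f + g) = run v f + run v g.
Proof.
move=> rv; elim/ncpolyW: f => s; elim/ncpolyW: g => t.
by rewrite -[ncpi s + ncpi t]/(ncadd (ncpi s) (ncpi t)) -ncpiD !run_pi.
Qed.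

Lemma runN v f : regular v -> run v (- f) = - run v f.
Proof.
move=> rv; elim/ncpolyW: f => s.
by rewrite -[- ncpi s]/(ncopp (ncpi s)) -ncpiN !run_pi.
Qed.

Lemma runM v f g : regular v -> run v (f * g) = run (run v f) g.
Proof.
move=> rv; have rf := run_regular f rv; move: rf.
elim/ncpolyW: f => s rf; elim/ncpolyW: g => t.
rewrite -[ncpi s * ncpi t]/(ncmul (ncpi s) (ncpi t)) -ncpiM !run_pi //.
exact: step_regular.
Qed.

Lemma run_coef v b : regular v ->
  run v (nccoef I b) = (v.1 * iota b, fun i u g => v.2 i (nccoef I b * u) g).
Proof. by move=> rv; rewrite run_pi. Qed.

Lemma run_var v j : regular v -> run v (ncvar B j) =
  (v.1 * rho X + v.2 j 1 X,
   fun i u g => v.2 i (ncvar B j * u) g +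
     if i == j then v.1 * rho (X * nccoef unit (phi u) * g) +
                    v.2 j 1 (X * nccoef unit (phi u) * g)
     else 0).
Proof. by move=> rv; rewrite run_pi. Qed.

Lemma run_scale v k f : regular v -> run v (k *: f) = k *: run v f.
Proof.
move=> rv; rewrite ncscaleE runM // run_coef // -[(_, _)]/(step (Coef I k%:A) v).
by rewrite step_coef_scalar // /run step_scale.
Qed.

Definition lmul_state (d : D) (v : state) : state :=
  (d * v.1, fun i u g => d * v.2 i u g).

Lemma step_lmul s d v : step s (lmul_state d v) = lmul_state d (step s v).
Proof.
elim: s v => [b|j|s IHs t IHt|s IHs|s IHs t IHt] v /=.
- by apply: state_ext => //=; rewrite mulrA.
- apply: state_ext => [|i u g] /=; first by rewrite mulrDr mulrA.
  by rewrite mulrDr; case: eqP => _; rewrite ?mulr0 // mulrDr mulrA.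
- rewrite IHs IHt; apply: state_ext => [|i u g].
    by rewrite -[LHS]/(d * _ + d * _) -mulrDr.
  by rewrite -[LHS]/(d * _ + d * _) -mulrDr.
- rewrite IHs; apply: state_ext => [|i u g].
    by rewrite -[LHS]/(- (d * _)) -mulrN.
  by rewrite -[LHS]/(- (d * _)) -mulrN.
- by rewrite IHs IHt.
Qed.

Definition init : state := (1, 0).

Lemma regular_init : regular init.
Proof. by case: regular0. Qed.

Definition cmoment (f : ncpoly I B) : D := (run init f).1.

Lemma cmoment_left b f : cmoment (nccoef I b * f) = iota b * cmoment f.
Proof.
rewrite /cmoment runM ?run_coef; try exact: regular_init.
rewrite (_ : (_, _) = lmul_state (iota b) init) /run ?step_lmul //.
by apply: state_ext => [|i u g] /=; rewrite ?mulr1 ?mul1r // mulr0.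
Qed.

Lemma cmoment_right b f : cmoment (f * nccoef I b) = cmoment f * iota b.
Proof.
rewrite /cmoment runM ?run_coef //; try exact: regular_init.
by apply: run_regular; exact: regular_init.
Qed.

Lemma cmoment_bimodule : unital_bimodule_map iota cmoment.
Proof.
split.
- move=> k f g; have ri := regular_init.
  by rewrite /cmoment runD // run_scale.
- by rewrite -[1]/(nccoef I 1) /cmoment run_coef /= ?rmorph1 ?mulr1 //; exact: regular_init.
- by move=> b f c; rewrite cmoment_right cmoment_left.
Qed.

End CumulantMoments.

Section Embeddings.
Variables (K : numClosedFieldType) (B : starAlgType K) (N : nat).
Implicit Types (i : 'I_N) (b : B) (f g : ncpoly unit B).

Lemma ncembedC i b : ncembed i (nccoef unit b) = nccoef 'I_N b.
Proof. exact: ncevalC. Qed.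

Lemma ncembedX i : ncembed i (ncvar B tt) = ncvar B i.
Proof. exact: ncevalX. Qed.

Lemma ncembedD i f g : ncembed i (f + g) = ncembed i f + ncembed i g.
Proof. exact: rmorphD. Qed.

Lemma ncembedN i f : ncembed i (- f) = - ncembed i f.
Proof. exact: rmorphN. Qed.

Lemma ncembedM i f g : ncembed i (f * g) = ncembed i f * ncembed i g.
Proof. exact: rmorphM. Qed.

Lemma ncembed1 i : ncembed i (1 : ncpoly unit B) = 1.
Proof. exact: rmorph1. Qed.

Lemma ncembed_lin i : linear (@ncembed K B N i).
Proof. by move=> k f g; rewrite /ncembed linearP. Qed.

Lemma ncsumvarsC b : ncsumvars N (nccoef unit b) = nccoef 'I_N b.
Proof. exact: ncevalC. Qed.

Lemma ncsumvarsX : ncsumvars N (ncvar B tt) = \sum_(i < N) ncvar B i.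
Proof. exact: ncevalX. Qed.

Lemma ncsumvarsD f g : ncsumvars N (f + g) = ncsumvars N f + ncsumvars N g.
Proof. exact: rmorphD. Qed.

Lemma ncsumvarsN f : ncsumvars N (- f) = - ncsumvars N f.
Proof. exact: rmorphN. Qed.

Lemma ncsumvarsM f g : ncsumvars N (f * g) = ncsumvars N f * ncsumvars N g.
Proof. exact: rmorphM. Qed.

Lemma ncsumvars1 : ncsumvars N (1 : ncpoly unit B) = 1.
Proof. exact: rmorph1. Qed.

Lemma ncsumvars_lin : linear (@ncsumvars K B N).
Proof. by move=> k f g; rewrite /ncsumvars linearP. Qed.

End Embeddings.

Section ConditionalExpectation.
Variables (K : numClosedFieldType) (I : Type) (B D : starAlgType K).
Variables (iota : {lrmorphism B -> D}) (theta : ncpoly I B -> D).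
Hypothesis theta_bimod : unital_bimodule_map iota theta.

Lemma bimod_left b f : theta (nccoef I b * f) = iota b * theta f.
Proof. by have := bimodule_mapM theta_bimod b f 1; rewrite !rmorph1 !mulr1. Qed.

Lemma bimod_right' f b : theta (f * nccoef I b) = theta f * iota b.
Proof. by have := bimodule_mapM theta_bimod 1 f b; rewrite !rmorph1 !mul1r. Qed.

Lemma bimod_coef b : theta (nccoef I b) = iota b.
Proof. by rewrite -[nccoef I b]mulr1 bimod_left (bimodule_map1 theta_bimod) mulr1. Qed.

End ConditionalExpectation.

(** * Restriction to one variable and to the sum of the variables *)

Section Transfer.
Variables (K : numClosedFieldType) (B D : starAlgType K) (N : nat).
Variables (iota : {lrmorphism B -> D}).
Variables (phi : ncpoly 'I_N B -> B) (rho rho' : ncpoly unit B -> D).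
Hypothesis phi_lin : linear phi.
Hypothesis rho_lin : linear rho.
Hypothesis rho_right : forall g b, rho (g * nccoef unit b) = rho g * iota b.

Let X : ncpoly unit B := ncvar B tt.

Lemma cmoment_embed i f :
  cmoment iota phi rho (ncembed i f) = cmoment iota (phi \o ncembed i) rho f.
Proof.
set nu := phi \o ncembed i.
have nu_lin : linear nu by move=> k x y; rewrite /nu /= ncembed_lin phi_lin.
(* Only open blocks of colour i, and gaps in the algebra of that colour, are compared. *)
pose rel (v : state 'I_N B D) (w : state unit B D) :=
  v.1 = w.1 /\ forall u g, v.2 i (ncembed i u) g = w.2 tt u g.
suff key v w : regular iota v -> regular iota w -> rel v w ->
    rel (run iota phi rho v (ncembed i f)) (run iota nu rho w f).
  have rel0 : rel (init 'I_N B D) (init unit B D) by [].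
  by have [] := key _ _ (regular_init _ _) (regular_init _ _) rel0.
elim/ncpoly_ind: f v w => [b|[]|f g IHf IHg|f IHf|f g IHf IHg] v w rv rw vw.
- case: vw => v1 v2; rewrite ncembedC !run_coef //; split=> [|u g] /=; first by rewrite v1.
  by rewrite -v2 ncembedM ncembedC.
- case: vw => v1 v2; rewrite ncembedX !run_var //.
  split=> [|u g] /=; first by rewrite v1 -v2 ncembed1.
  by rewrite !eqxx v1 -!v2 ncembedM ncembedX ncembed1.
- rewrite ncembedD !runD //; have [f1 f2] := IHf v w rv rw vw.
  have [g1 g2] := IHg v w rv rw vw; split=> [|u h] /=; first by rewrite f1 g1.
  by rewrite -[LHS]/(_ + _) f2 g2.
- rewrite ncembedN !runN //; have [f1 f2] := IHf v w rv rw vw.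
  split=> [|u h] /=; first by rewrite f1.
  by rewrite -[LHS]/(- _) f2.
- rewrite ncembedM !runM //; apply: IHg; try exact: run_regular.
  exact: IHf.
Qed.

(** Summing the open blocks over all colours gives the state of the single variable. The letters of
    a block share one colour, chosen among N when the block is opened; hence the factor N. The two
    functionals are compared only on left multiples of X, since unital ones such as [crho] cannot be
    proportional at 1 in general. *)
Lemma cmoment_sum f : (forall g, rho' (X * g) = N%:R *: rho (X * g)) ->
  linear rho' -> (forall g b, rho' (g * nccoef unit b) = rho' g * iota b) ->
  cmoment iota phi rho (ncsumvars N f) =
  cmoment iota (phi \o @ncsumvars K B N) rho' f.
Proof.
move=> rho'E rho'_lin rho'_right.
have rho'X : rho' X = N%:R *: rho X by have := rho'E 1; rewrite mulr1.
set nu := phi \o _.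
have nu_lin : linear nu by move=> k x y; rewrite /nu /= ncsumvars_lin phi_lin.
pose rel (v : state 'I_N B D) (w : state unit B D) :=
  v.1 = w.1 /\ forall u g, \sum_i v.2 i (ncsumvars N u) g = w.2 tt u g.
suff key v w : regular iota v -> regular iota w -> rel v w ->
    rel (run iota phi rho v (ncsumvars N f)) (run iota nu rho' w f).
  have rel0 : rel (init 'I_N B D) (init unit B D) by split=> // u g; rewrite big1.
  by have [] := key _ _ (regular_init _ _) (regular_init _ _) rel0.
elim/ncpoly_ind: f v w => [b|[]|f g IHf IHg|f IHf|f g IHf IHg] v w rv rw vw.
- case: vw => v1 v2; rewrite ncsumvarsC !run_coef //; split=> [|u g] /=.
    by rewrite v1.
  by rewrite -v2; apply: eq_bigr => i _; rewrite ncsumvarsM ncsumvarsC.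
- case: vw => v1 v2; rewrite ncsumvarsX.
  have v2' g : \sum_i v.2 i 1 g = w.2 tt 1 g by rewrite -v2 ncsumvars1.
  have -> : run iota phi rho v (\sum_(i < N) ncvar B i) =
      \sum_(i < N) run iota phi rho v (ncvar B i).
    apply: (big_morph (run iota phi rho v)) => [x y|]; first exact: runD.
    by rewrite -[0](scale0r 1) run_scale // scale0r.
  have fstE (F : 'I_N -> state 'I_N B D) : (\sum_j F j).1 = \sum_j (F j).1.
    exact: (big_morph (fun s : state 'I_N B D => s.1)).
  have sndE (F : 'I_N -> state 'I_N B D) i u g :
      (\sum_j F j).2 i u g = \sum_j (F j).2 i u g.
    exact: (big_morph (fun s : state 'I_N B D => s.2 i u g)).
  rewrite run_var //; split=> [|u g].
    rewrite fstE; under eq_bigr => j _ do rewrite run_var //=.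
    by rewrite big_split /= v2' rho'X sumr_const card_ord v1 -scaler_nat scalerAr.
  transitivity (\sum_i \sum_j (run iota phi rho v (ncvar B j)).2 i (ncsumvars N u) g).
    by apply: eq_bigr => i _; rewrite sndE.
  under eq_bigr => i _ do under eq_bigr => j _ do rewrite run_var //=.
  rewrite /= -[X * _ * g]mulrA rho'E mulrA /nu /= -v2.
  under eq_bigr => i _ do rewrite big_split /=.
  rewrite big_split /=; congr (_ + _).
    apply: eq_bigr => i _; rewrite ncsumvarsM ncsumvarsX mulr_suml.
    by rewrite (lin_sum (regular_gap rv i g)).
  under eq_bigr => i _ do rewrite -big_mkcond /= (eq_bigl _ _ (eq_sym i)) big_pred1_eq.
  by rewrite big_split /= sumr_const card_ord v1 -scaler_nat scalerAr v2'.
- rewrite ncsumvarsD !runD //; have [f1 f2] := IHf v w rv rw vw.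
  have [g1 g2] := IHg v w rv rw vw; split=> [|u h] /=; first by rewrite f1 g1.
  by rewrite -[RHS]/(_ + _) -f2 -g2 -big_split.
- rewrite ncsumvarsN !runN //; have [f1 f2] := IHf v w rv rw vw.
  split=> [|u h] /=; first by rewrite f1.
  by rewrite -[RHS]/(- _) -f2 -sumrN.
- rewrite ncsumvarsM !runM //; apply: IHg; try exact: run_regular.
  exact: IHf.
Qed.

End Transfer.

(** * Conditional freeness of the moment functional *)

Section Freeness.
Variables (K : numClosedFieldType) (B D : starAlgType K) (N : nat).
Variables (iota : {lrmorphism B -> D}).

Definition colprod (s : seq ('I_N * ncpoly unit B)) : ncpoly 'I_N B :=
  \prod_(p <- s) ncembed p.1 p.2.

Variables (phi : ncpoly 'I_N B -> B).

Definition centered (s : seq ('I_N * ncpoly unit B)) : Prop :=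
  sorted (fun p q => p.1 != q.1) s /\
  forall p, p \in s -> phi (ncembed p.1 p.2) = 0.

Lemma centered_alternatingP s p0 : s != [::] -> centered s ->
  centered_alternating phi (size s).-1 (fun k => (nth p0 s k).1)
    (fun k => (nth p0 s k).2).
Proof.
move=> s0 [so ce]; have sz : (size s).-1.+1 = size s by rewrite prednK // lt0n size_eq0.
split=> k; last first.
  by rewrite -ltnS sz => ks; apply: ce; exact: mem_nth.
rewrite -ltnS sz => ks; move/(sortedP p0): so; exact.
Qed.

Lemma prod_colprod (R : pzRingType) (F : ncpoly 'I_N B -> R) s p0 : s != [::] ->
  \prod_(k < (size s).-1.+1) F (ncembed (nth p0 s k).1 (nth p0 s k).2) =
  \prod_(p <- s) F (ncembed p.1 p.2).
Proof.
move=> s0; have sz : (size s).-1.+1 = size s by rewrite prednK // lt0n size_eq0.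
by rewrite (big_nth p0) big_mkord sz.
Qed.

Lemma free_colprod s : free_variables phi -> s != [::] -> centered s ->
  phi (colprod s) = 0.
Proof.
case: s => // p0 s fr s0 cs.
have := fr _ _ _ (centered_alternatingP p0 s0 cs).
by rewrite (@prod_colprod _ (fun x => x) _ p0).
Qed.

Hypothesis phi_ce : conditional_expectation phi.
Hypothesis phi_free : free_variables phi.

Let phi_lin : linear phi := bimodule_map_linear phi_ce.

Lemma ce_coef (b : B) : phi (nccoef 'I_N b) = b.
Proof. exact: (@bimod_coef _ _ _ _ (idfun : {lrmorphism B -> B})). Qed.

Definition center_part i (a : ncpoly unit B) : ncpoly unit B :=
  a - nccoef unit (phi (ncembed i a)).

Lemma center_part0 i a : phi (ncembed i (center_part i a)) = 0.
Proof.
by rewrite /center_part ncembedD ncembedN ncembedC lin_sub // ce_coef subrr.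
Qed.

Lemma center_partE i a :
  ncembed i a = ncembed i (center_part i a) + nccoef 'I_N (phi (ncembed i a)).
Proof. by rewrite /center_part ncembedD ncembedN ncembedC subrK. Qed.

Lemma colprod_cons p s : colprod (p :: s) = ncembed p.1 p.2 * colprod s.
Proof. exact: big_cons. Qed.

Lemma colprod_rcons s p : colprod (rcons s p) = colprod s * ncembed p.1 p.2.
Proof. by rewrite /colprod -cats1 big_cat big_seq1. Qed.

Lemma centered_cons p s : phi (ncembed p.1 p.2) = 0 -> (ohead s != None -> p.1 != (head p s).1) ->
  centered s -> centered (p :: s).
Proof.
case: s => [|q s] /= p0 pq [so ce]; split=> //=.
- by move=> r; rewrite inE => /eqP ->.
- by rewrite pq.
- by move=> r; rewrite inE => /orP[/eqP -> //|]; exact: ce.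
Qed.

Lemma centered_rcons p s : phi (ncembed p.1 p.2) = 0 ->
  (s != [::] -> (last p s).1 != p.1) -> centered s -> centered (rcons s p).
Proof.
case: s => [|q s] /= p0 pq [so ce]; split=> //=.
- by move=> r; rewrite inE => /eqP ->.
- by rewrite rcons_path; apply/andP; split; [exact: so | exact: pq].
- move=> r; rewrite inE mem_rcons inE => /or3P[/eqP ->|/eqP -> //|rs].
    by apply: ce; rewrite inE eqxx.
  by apply: ce; rewrite inE rs orbT.
Qed.

(** Splitting both outer factors into a centred part and an element of [B] leaves four nonempty
    centred alternating products, multiplied by elements of [B] on the outside. *)
Lemma free_sandwich i a s g p : centered (p :: s) -> p.1 != i -> (last p s).1 != i ->
  phi (ncembed i a * colprod (p :: s) * ncembed i g) = 0.
Proof.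
move=> cs pi si.
have lin := lin_add phi_lin.
rewrite (center_partE i a) (center_partE i g); set a' := center_part i a.
set g' := center_part i g; set c := phi (ncembed i a); set e := phi (ncembed i g).
have cr : centered (rcons (p :: s) (i, g')).
  by apply: centered_rcons => //; exact: center_part0.
have cl t q : centered (q :: t) -> q.1 != i -> centered ((i, a') :: q :: t).
  move=> ct qi; apply: centered_cons => //; first exact: center_part0.
  by rewrite /= eq_sym.
set P := colprod (p :: s).
have EP : P * ncembed i g' = colprod (rcons (p :: s) (i, g')).
  by rewrite colprod_rcons.
have z1 : phi P = 0 by exact: free_colprod.
have z2 : phi (P * ncembed i g') = 0 by rewrite EP; exact: free_colprod.
have z3 : phi (ncembed i a' * P) = 0.
  rewrite (_ : _ * P = colprod ((i, a') :: p :: s)); last by rewrite colprod_cons.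
  by apply: free_colprod => //; exact: cl.
have z4 : phi (ncembed i a' * (P * ncembed i g')) = 0.
  rewrite EP (_ : _ * _ = colprod ((i, a') :: rcons (p :: s) (i, g'))).
    by apply: free_colprod => //; exact: cl.
  exact: (esym (colprod_cons (i, a') _)).
have bl := bimod_left (iota := (idfun : {lrmorphism B -> B})) phi_ce.
have br := bimod_right' (iota := (idfun : {lrmorphism B -> B})) phi_ce.
have -> : (ncembed i a' + nccoef 'I_N c) * P * (ncembed i g' + nccoef 'I_N e) =
  ncembed i a' * (P * ncembed i g') + nccoef 'I_N c * (P * ncembed i g') +
  ncembed i a' * P * nccoef 'I_N e + nccoef 'I_N c * (P * nccoef 'I_N e).
  nc_ring.
rewrite !lin bl bl br br /= z1 z2 z3 z4.
by rewrite !(mulr0, mul0r) !addr0.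
Qed.

Variable rho : ncpoly unit B -> D.
Hypothesis rho_lin : linear rho.
Hypothesis rho_right : forall g b, rho (g * nccoef unit b) = rho g * iota b.

Notation run := (run iota phi rho).
Notation init := (init 'I_N B D).

(** If [h] contributed a letter to the block, the gap behind its last such letter would be an
    element of colour i times [Z], where [phi] vanishes. Only the terms with all of [h] inside the
    old gap survive. *)
Lemma run_gap_same i h Z v : regular iota v ->
  (forall a, phi (ncembed i a * Z) = 0) ->
  forall a g, (run v (ncembed i h)).2 i (ncembed i a * Z) g =
              v.2 i (ncembed i (h * a) * Z) g.
Proof.
move=> rv Z0; elim/ncpoly_ind: h v rv => [b|[]|f g IHf IHg|f IHf|f g IHf IHg] v rv a w.
- by rewrite ncembedC run_coef //= ncembedM ncembedC mulrA.
- rewrite ncembedX run_var //= eqxx Z0 rmorph0 mulr0 mul0r.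
  rewrite (lin_0 rho_lin) (lin_0 (regular_arg rv i 1)) mulr0 !addr0.
  by rewrite ncembedM ncembedX mulrA.
- rewrite ncembedD runD // -[LHS]/(_ + _) IHf // IHg // mulrDl ncembedD mulrDl.
  by rewrite (lin_add (regular_gap rv i w)).
- rewrite ncembedN runN // -[LHS]/(- _) IHf // mulNr ncembedN mulNr.
  by rewrite (lin_opp (regular_gap rv i w)).
- rewrite ncembedM runM // IHg; last exact: run_regular.
  by rewrite IHf // mulrA.
Qed.

Lemma run_gap_other i j h v : regular iota v -> i != j ->
  forall u g, (run v (ncembed j h)).2 i u g = v.2 i (ncembed j h * u) g.
Proof.
move=> rv ij; elim/ncpoly_ind: h v rv => [b|[]|f g IHf IHg|f IHf|f g IHf IHg] v rv u w.
- by rewrite ncembedC run_coef.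
- by rewrite ncembedX run_var //= (negPf ij) addr0.
- rewrite ncembedD runD // -[LHS]/(_ + _) IHf // IHg // mulrDl.
  by rewrite (lin_add (regular_gap rv i w)).
- rewrite ncembedN runN // -[LHS]/(- _) IHf // mulNr.
  by rewrite (lin_opp (regular_gap rv i w)).
- rewrite ncembedM runM // IHg; last exact: run_regular.
  by rewrite IHf // mulrA.
Qed.

Lemma centered_catr s t : centered (s ++ t) -> centered t.
Proof.
move=> [so ce]; split.
  by case: s so {ce} => //= p s; rewrite cat_path => /andP[_ /path_sorted].
by move=> p pt; apply: ce; rewrite mem_cat pt orbT.
Qed.

(** Factors move one by one from the word read into the open gap, until nothing is read and no block
    is open. A factor of another colour can only lie in the gap; for one of colour i,
    [free_sandwich] supplies the vanishing that [run_gap_same] requires. *)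
Lemma run_colprod_gap i s t : centered (s ++ t) ->
  (forall p, s ++ t != [::] -> (last p (s ++ t)).1 != i) ->
  forall a g, (run init (colprod s)).2 i (colprod t * ncembed i a) g = 0.
Proof.
have ri := regular_init 'I_N iota.
elim/last_ind: s t => [|s p IH] t ct lt a g.
  by rewrite /colprod big_nil -[1]/(nccoef 'I_N 1) run_coef; last exact: regular_init.
have rs : regular iota (run init (colprod s)).
  by apply: run_regular => //; exact: regular_init.
rewrite colprod_rcons runM; try exact: regular_init; try by [].
have IH' := IH (p :: t); rewrite -cat_rcons in IH'.
have [pi|pi] := eqVneq i p.1; last first.
  rewrite run_gap_other // mulrA -colprod_cons; exact: IH'.
subst i; case: t ct lt IH' => [|q t] ct lt IH'.
  have := lt p; rewrite cats0 last_rcons eqxx.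
  by case: (s) => [|? ?] /(_ isT).
rewrite -[colprod _ * _]mul1r -(ncembed1 B p.1) run_gap_same // => [|b].
  by rewrite mulr1 mulrA -colprod_cons; exact: IH'.
rewrite mulrA; apply: free_sandwich.
- exact: centered_catr ct.
- move: ct => [so _]; move: so; rewrite cat_rcons.
  rewrite eq_sym; case: (s) => [|r s'] /=; first by case/andP.
  by rewrite cat_path /= => /and4P[].
- by have := lt q; rewrite last_cat /=; apply; case: (s).
Qed.

(** Reading in colour i sees only the value of a state and its open blocks of colour i with gaps of
    that colour, so a left factor [d] relating two states there persists. *)
Lemma run_same_left i d v w : regular iota v -> regular iota w ->
  v.1 = d * w.1 -> (forall a g, v.2 i (ncembed i a) g = d * w.2 i (ncembed i a) g) ->
  forall h, (run v (ncembed i h)).1 = d * (run w (ncembed i h)).1.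
Proof.
move=> rv rw v1 v2 h.
pose rel (v w : state 'I_N B D) := v.1 = d * w.1 /\
  forall a g, v.2 i (ncembed i a) g = d * w.2 i (ncembed i a) g.
suff key : rel (run v (ncembed i h)) (run w (ncembed i h)) by case: key.
have {v1 v2} vw : rel v w by [].
elim/ncpoly_ind: h v w rv rw vw => [b|[]|f g IHf IHg|f IHf|f g IHf IHg] v w rv rw vw.
- case: vw => v1 v2; rewrite ncembedC !run_coef //; split=> [|a g] /=.
    by rewrite v1 mulrA.
  by rewrite -(ncembedC i) -ncembedM v2.
- case: vw => v1 v2; rewrite ncembedX !run_var //.
  have v2' := v2 1; rewrite ncembed1 in v2'.
  split=> [|a g] /=; first by rewrite v1 v2' mulrDr mulrA.
  by rewrite eqxx -(ncembedX B i) -ncembedM v2 v2' v1 !mulrDr mulrA.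
- have [f1 f2] := IHf v w rv rw vw; have [g1 g2] := IHg v w rv rw vw.
  rewrite ncembedD !runD //; split=> [|a c].
    by rewrite -[LHS]/(_ + _) f1 g1 -mulrDr.
  by rewrite -[LHS]/(_ + _) f2 g2 -mulrDr.
- have [f1 f2] := IHf v w rv rw vw.
  rewrite ncembedN !runN //; split=> [|a c].
    by rewrite -[LHS]/(- _) f1 -mulrN.
  by rewrite -[LHS]/(- _) f2 -mulrN.
- rewrite ncembedM !runM //; apply: IHg; try exact: run_regular.
  exact: IHf.
Qed.

(** By [run_colprod_gap] no open block connects the last factor to the preceding ones, so its
    reading starts afresh with their value as left factor. *)
Lemma cmoment_colprod s : centered s ->
  cmoment iota phi rho (colprod s) =
  \prod_(p <- s) cmoment iota phi rho (ncembed p.1 p.2).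
Proof.
have ri := regular_init 'I_N iota.
elim/last_ind: s => [|s p IH] cs.
  by rewrite /colprod !big_nil (bimodule_map1 (cmoment_bimodule phi_lin rho_lin rho_right)).
have cs' : centered s.
  case: cs => so ce; split; last by move=> q qs; apply: ce; rewrite mem_rcons inE qs orbT.
  by case: s so {IH ce} => //= q s; rewrite rcons_path => /andP[].
rewrite -cats1 big_cat big_seq1 /= -IH // cats1 colprod_rcons.
rewrite /cmoment runM //; apply: run_same_left => //.
- exact: run_regular.
- by rewrite mulr1.
- move=> a g; rewrite mulr0.
  have := @run_colprod_gap p.1 s [::]; rewrite cats0 => /(_ cs') h.
  rewrite -[ncembed _ a]mul1r -[1](_ : colprod [::] = 1) ?h //; last first.
    by rewrite /colprod big_nil.
  move=> q s0; case: cs => so _; move: so; case: (s) s0 => //= r s' _.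
  by rewrite rcons_path => /andP[].
Qed.

Lemma cmoment_cfree : cfree_variables (cmoment iota phi rho) phi.
Proof.
move=> m eps a [alt ce].
pose s := mkseq (fun k => (eps k, a k)) m.+1.
have cs : centered s.
  split; last first.
    by move=> p /mapP[k]; rewrite mem_iota ltnS => /andP[_ km] ->; exact: ce.
  apply/(sortedP (eps 0%N, a 0%N)) => k; rewrite size_mkseq ltnS => km.
  by rewrite !nth_mkseq //=; [exact: alt | rewrite ltnS ltnW].
have E (R : pzRingType) (F : ncpoly 'I_N B -> R) :
    \prod_(k < m.+1) F (ncembed (eps k) (a k)) = \prod_(p <- s) F (ncembed p.1 p.2).
  by rewrite /s /mkseq big_map -[seq.iota 0 m.+1]/(index_iota 0 m.+1) big_mkord.
split; rewrite (E _ (fun x => x)); first exact: (free_colprod phi_free).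
by rewrite E; exact: cmoment_colprod.
Qed.

End Freeness.

(** * Uniqueness of the c-free functional *)

Section Uniqueness.
Variables (K : numClosedFieldType) (B D : starAlgType K) (N : nat).
Variables (phi : ncpoly 'I_N B -> B).
Hypothesis phi_ce : conditional_expectation phi.

(** Coefficients from [B] on the right are absorbed into the last factor, whose centring they
    preserve; [rcons] keeps the products nonempty and exposes that factor. *)
Inductive centered_span : ncpoly 'I_N B -> Prop :=
| span_coef b : centered_span (nccoef 'I_N b)
| span_prod s p : centered phi (rcons s p) -> centered_span (colprod (rcons s p))
| span_add f g : centered_span f -> centered_span g -> centered_span (f + g)
| span_opp f : centered_span f -> centered_span (- f).

Lemma centered_rcons_change s i a a' : centered phi (rcons s (i, a)) ->
  phi (ncembed i a') = 0 -> centered phi (rcons s (i, a')).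
Proof.
move=> [so ce] a'0; split.
  case: s so {ce} => //= q s; rewrite !rcons_path => /andP[-> h] //=.
move=> p; rewrite mem_rcons inE => /orP[/eqP -> //|ps].
by apply: ce; rewrite mem_rcons inE ps orbT.
Qed.

Lemma centered_rconsl s p : centered phi (rcons s p) -> centered phi s.
Proof.
move=> [so ce]; split.
  by case: s so {ce} => //= q s; rewrite rcons_path => /andP[].
by move=> q qs; apply: ce; rewrite mem_rcons inE qs orbT.
Qed.

Lemma span_mul_coef f b : centered_span f -> centered_span (f * nccoef 'I_N b).
Proof.
elim=> {f} [c|s [i a] cs|f g _ IHf _ IHg|f _ IHf].
- by rewrite -nccoefM; exact: span_coef.
- rewrite colprod_rcons -mulrA /= -(ncembedC i) -ncembedM.
  rewrite -[ncembed i _]/(ncembed (i, a * nccoef unit b).1 (i, a * nccoef unit b).2).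
  rewrite -colprod_rcons; apply/span_prod/(centered_rcons_change cs).
  rewrite ncembedM ncembedC.
  rewrite (bimod_right' (iota := (idfun : {lrmorphism B -> B})) phi_ce) /=.
  have [_ /(_ (i, a))] := cs; rewrite mem_rcons inE eqxx => /(_ isT) /= ->.
  by rewrite mul0r.
- by rewrite mulrDl; exact: span_add.
- by rewrite mulNr; exact: span_opp.
Qed.

Lemma span_colprod_embed s i a : centered phi s ->
  (forall p, s != [::] -> (last p s).1 != i) ->
  centered_span (colprod s * ncembed i a).
Proof.
move=> cs lt; rewrite (center_partE phi i a) mulrDr; apply: span_add.
  rewrite -[ncembed i _]/(ncembed (i, center_part phi i a).1 (i, center_part phi i a).2).
  rewrite -colprod_rcons; apply: span_prod; apply: centered_rcons => //.
  - exact: center_part0.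
  - exact: lt.
apply: span_mul_coef; case/lastP: s cs {lt} => [|s p] cs; last exact: span_prod.
by rewrite /colprod big_nil -(rmorph1 (@nccoef K 'I_N B)); exact: span_coef.
Qed.

(** The letter joins the last factor if the colours agree and starts a new factor otherwise; in both
    cases the result is centred again. *)
Lemma span_mul_var f i : centered_span f -> centered_span (f * ncvar B i).
Proof.
elim=> {f} [c|s [j a] cs|f g _ IHf _ IHg|f _ IHf].
- rewrite -(ncembedX B i) -(ncembedC i) -ncembedM -[ncembed i _]mul1r.
  rewrite [1](_ : _ = colprod [::]); last by rewrite /colprod big_nil.
  by apply: span_colprod_embed => //; split.
- have [ij|ij] := eqVneq j i.
    rewrite colprod_rcons -mulrA /= -ij -(ncembedX B j) -ncembedM.
    apply: span_colprod_embed; first exact: centered_rconsl cs.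
    move=> p; case: cs => so _; case: s so => //= q s.
    by rewrite rcons_path => /andP[].
  rewrite -(ncembedX B i); apply: span_colprod_embed => // p _.
  by rewrite last_rcons.
- by rewrite mulrDl; exact: span_add.
- by rewrite mulNr; exact: span_opp.
Qed.

Lemma span_mul f h : centered_span f -> centered_span (f * h).
Proof.
elim/ncpoly_ind: h f => [b|i|g h IHg IHh|g IHg|g h IHg IHh] f sf.
- exact: span_mul_coef.
- exact: span_mul_var.
- by rewrite mulrDr; apply: span_add; [exact: IHg | exact: IHh].
- by rewrite mulrN; apply: span_opp; exact: IHg.
- by rewrite mulrA; apply/IHh/IHg.
Qed.

Lemma centered_span_all f : centered_span f.
Proof.
rewrite -[f]mul1r -(rmorph1 (@nccoef K 'I_N B)); apply: span_mul; exact: span_coef.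
Qed.

Lemma cfree_unique (iota : {lrmorphism B -> D}) theta theta' :
  unital_bimodule_map iota theta -> unital_bimodule_map iota theta' ->
  cfree_variables theta phi -> cfree_variables theta' phi ->
  (forall i f, theta (ncembed i f) = theta' (ncembed i f)) -> theta =1 theta'.
Proof.
move=> bt bt' ct ct' tt' f; have tl := bimodule_map_linear bt.
have tl' := bimodule_map_linear bt'.
elim: f / (centered_span_all f) => [b|s p cs|f g _ IHf _ IHg|f _ IHf].
- by rewrite (bimod_coef bt) (bimod_coef bt').
- have s0 : rcons s p != [::] by case: (s).
  have ca := centered_alternatingP p s0 cs.
  have [_ h] := ct _ _ _ ca; have [_ h'] := ct' _ _ _ ca.
  move: h h'; rewrite !prod_colprod // (prod_colprod (fun x => x)) // -/(colprod _).
  by move=> -> ->; apply: eq_bigr => q _; rewrite tt'.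
- by rewrite (lin_add tl) (lin_add tl') IHf IHg.
- by rewrite (lin_opp tl) (lin_opp tl') IHf.
Qed.

End Uniqueness.

(** * The cumulant recursion *)

Section Chains.

Fixpoint increasing_seqs n : seq (seq nat) :=
  if n is m.+1 then
    increasing_seqs m ++ [seq rcons l m | l <- increasing_seqs m]
  else [:: [::]].

Lemma sorted_ltn_rcons l a : sorted ltn (rcons l a) = sorted ltn l && all (gtn a) l.
Proof. by rewrite !(sorted_pairwise ltn_trans) pairwise_rcons andbC. Qed.

Lemma mem_increasing_seqs n l :
  (l \in increasing_seqs n) = sorted ltn l && all (gtn n) l.
Proof.
elim: n l => [|n IH] l.
  by rewrite inE; case: l => [|a l] //=; rewrite andbF.
rewrite /= mem_cat IH; apply/idP/idP.
  case/orP=> [/andP[-> al]|/mapP[k]].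
    by apply: sub_all al => i /= /leqW.
  rewrite IH => /andP[sk ak] ->; rewrite sorted_ltn_rcons sk ak all_rcons /= ltnSn /=.
  by apply: sub_all ak => i /= /leqW.
case/andP; case/lastP: l => [|l a] //; rewrite sorted_ltn_rcons all_rcons.
move=> /andP[sl la] /andP[an al]; apply/orP.
have [ean|nan] := eqVneq a n.
  right; apply/mapP; exists l; last by rewrite ean.
  by rewrite IH sl -ean.
have an' : (a < n)%N by rewrite ltn_neqAle nan -ltnS.
left; rewrite sl la all_rcons /= an' /=.
by apply: sub_all la => i /= ia; exact: ltn_trans an'.
Qed.

Lemma uniq_increasing_seqs n : uniq (increasing_seqs n).
Proof.
elim: n => //= n IH; rewrite cat_uniq IH map_inj_uniq ?IH ?andbT /=.
  apply/hasPn => l /mapP[k _ ->]; rewrite mem_increasing_seqs.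
  by rewrite all_rcons /= ltnn andbF.
exact: rcons_injl.
Qed.

(** The chains of all lengths are the increasing sequences that end in n - 1. Dropping this entry
    leaves an arbitrary increasing sequence below n - 1, a form that suits recursion on n. *)
Lemma chain_sum (V : nmodType) n (F : seq nat -> V) : (0 < n)%N ->
  \sum_(1 <= p < n.+1) \sum_(l : p.-tuple 'I_n | cchain n (map val l)) F (map val l) =
  \sum_(l <- increasing_seqs n.-1) F (rcons l n.-1).
Proof.
case: n => // n _ /=.
pose L := [seq rcons l n | l <- increasing_seqs n].
have memL l : (l \in L) = [&& l != [::], cchain n.+1 l & all (gtn n.+1) l].
  apply/mapP/and3P => [[k]|[l0 /andP[sl /eqP ll] al]].
    rewrite mem_increasing_seqs => /andP[sk ak] ->.
    have : rcons k n \in increasing_seqs n.+1.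
      rewrite /= mem_cat; apply/orP; right; apply/mapP; exists k => //.
      by rewrite mem_increasing_seqs sk.
    rewrite mem_increasing_seqs => /andP[s1 a1].
    by rewrite /cchain s1 last_rcons eqxx; split=> //; case: (k).
  case/lastP: l l0 sl ll al => // k a _; rewrite sorted_ltn_rcons last_rcons /=.
  by move=> kn an _; rewrite an in kn *; exists k; rewrite ?mem_increasing_seqs.
have uL : uniq L by rewrite map_inj_uniq ?uniq_increasing_seqs //; exact: rcons_injl.
have inner p : (0 < p)%N ->
    \sum_(l : p.-tuple 'I_n.+1 | cchain n.+1 (map val l)) F (map val l) =
    \sum_(l <- L | size l == p) F l.
  move=> p0; rewrite -big_enum_cond -big_filter -(big_map (fun l : p.-tuple 'I_n.+1 =>
    map val l) xpredT F) -[RHS]big_filter; apply: perm_big; apply: uniq_perm.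
  - rewrite map_inj_uniq ?filter_uniq -?enumT ?enum_uniq // => l k lk.
    exact/val_inj/(inj_map val_inj).
  - exact: filter_uniq.
  move=> l; rewrite mem_filter memL; apply/mapP/idP => [[k]|].
    rewrite mem_filter mem_enum => /andP[c2 c1] ->.
    have ck : cchain n.+1 (map val k) by apply/andP.
    rewrite size_map size_tuple eqxx ck /=.
    rewrite -size_eq0 size_map size_tuple -lt0n p0 /=.
    by apply/allP => _ /mapP[i _ ->]; exact: (ltn_ord i).
  case/andP => /eqP szl /and3P[l0 cl al].
  have sz : size [seq (inord i : 'I_n.+1) | i <- l] == p by rewrite size_map szl.
  have E : map val (Tuple sz : p.-tuple 'I_n.+1) = l.
    rewrite /= -map_comp -[RHS]map_id; apply/eq_in_map => i /(allP al) /= il.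
    by rewrite inordK.
  have /andP[c1 c2] := cl; exists (Tuple sz); last by rewrite E.
  by rewrite mem_filter mem_enum; rewrite -E in c1 c2; apply/andP; split; [exact: c2 | exact: c1].
rewrite (eq_big_nat _ _ (F2 := fun p => \sum_(l <- L | size l == p) F l)); last first.
  by move=> p /andP[p0 _]; exact: inner.
under eq_bigr => p _ do rewrite big_mkcond.
rewrite exchange_big /= -[RHS](big_map (rcons^~ n) xpredT F).
rewrite big_seq [RHS]big_seq; apply: eq_bigr => l; rewrite memL => /and3P[l0 cl al].
have [s1 s2] : (0 < size l)%N /\ (size l <= n.+1)%N.
  split; first by rewrite lt0n size_eq0.
  have : {subset l <= iota 0 n.+1} by move=> i /(allP al); rewrite mem_iota.
  case/andP: cl => sl _.
  by move/(uniq_leq_size (sorted_uniq ltn_trans ltnn sl)); rewrite size_iota.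
rewrite (bigD1_seq (size l)) ?iota_uniq ?mem_index_iota ?s1 //= eqxx big1 ?addr0 //.
by move=> p; rewrite eq_sym => /negPf ->.
Qed.

End Chains.

(** * Moments and cumulants in one variable *)

Section ChainFormula.
Variables (K : numClosedFieldType) (B D : starAlgType K).
Variables (iota : {lrmorphism B -> D}).
Variables (nu : ncpoly unit B -> B) (rho : ncpoly unit B -> D).
Hypothesis nu_ce : conditional_expectation nu.
Hypothesis rho_lin : linear rho.
Hypothesis rho_right : forall g b, rho (g * nccoef unit b) = rho g * iota b.

Let X : ncpoly unit B := ncvar B tt.
Let nu_lin : linear nu := bimodule_map_linear nu_ce.
Notation M := (cmoment iota nu rho).
Notation run := (run iota nu rho).
Notation init := (init unit B D).

Lemma nu_left b u : nu (nccoef unit b * u) = b * nu u.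
Proof. exact: (bimod_left (iota := (idfun : {lrmorphism B -> B}))). Qed.

Lemma run_letter b (v : state unit B D) : regular iota v ->
  run v (X * nccoef unit b) =
  ((v.1 * rho X + v.2 tt 1 X) * iota b,
   fun i u g => v.2 tt (X * (nccoef unit b * u)) g +
     (v.1 * rho (X * nccoef unit (b * nu u) * g) +
      v.2 tt 1 (X * nccoef unit (b * nu u) * g))).
Proof.
move=> rv; rewrite runM // run_coef //; last exact: run_regular.
by rewrite run_var //; apply: state_ext => //= -[] u g; rewrite nu_left.
Qed.

Lemma slice_rcons (bs : seq B) i k : (i <= k)%N -> (k < size bs)%N ->
  slice bs i k.+1 = rcons (slice bs i k) bs`_k.
Proof.
move=> ik ks; rewrite /slice subSn // (take_nth 0) ?nth_drop ?subnKC //.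
by rewrite size_drop ltn_sub2r // (leq_ltn_trans ik).
Qed.

(** The completed arguments of a block open at the positions [l]. The argument at the last position
    is still growing; it is [last_block] once its gap extends up to k. *)
Definition block_prefix (bs : seq B) (l : seq nat) : ncpoly unit B :=
  xword (mkseq (cblock nu bs l) (size l).-1).

Definition last_block (bs : seq B) l k : B :=
  bs`_(last 0%N l) * nu (xword (slice bs (last 0%N l).+1 k)).

Lemma mkseq_cblock_rcons bs l k : l != [::] ->
  mkseq (cblock nu bs (rcons l k)) (size l) =
  rcons (mkseq (cblock nu bs l) (size l).-1) (last_block bs l k).
Proof.
move=> l0; have sl : (size l).-1.+1 = size l by rewrite prednK // lt0n size_eq0.
rewrite -[in LHS]sl mkseqS; congr rcons.
  rewrite /mkseq; apply/eq_in_map => s; rewrite mem_iota add0n => /= ss.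
  have s1 : (s.+1 < size l)%N by rewrite -sl ltnS.
  by rewrite /cblock !nth_rcons s1 (ltnW s1).
by rewrite /cblock sl !nth_rcons sl leqnn ltnn eqxx nth_last.
Qed.

Lemma block_prefix_rcons bs l k : l != [::] ->
  block_prefix bs (rcons l k) =
  block_prefix bs l * (X * nccoef unit (last_block bs l k)).
Proof.
by move=> l0; rewrite /block_prefix size_rcons mkseq_cblock_rcons // xword_rcons.
Qed.

Lemma nil_increasing_seqs k : [::] \in increasing_seqs k.
Proof. by rewrite mem_increasing_seqs. Qed.

(** Solves the recursion for open blocks. The letter just read lies in the gap or is the newest
    position of the block, which matches the two halves of [increasing_seqs]; the empty sequence in
    the second half stands for a block opened at this letter. *)
Lemma run_word bs k : (k <= size bs)%N -> forall u g,
  (run init (xword (take k bs))).2 tt u g =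
  \sum_(l <- increasing_seqs k | l != [::])
    M (xword (take (head 0%N l) bs)) *
    rho (block_prefix bs l * (X * nccoef unit (bs`_(last 0%N l) *
           nu (xword (slice bs (last 0%N l).+1 k) * u))) * g).
Proof.
have ri := regular_init unit iota.
elim: k => [|k IH] ks u g.
  by rewrite take0 xword_nil -[1]/(nccoef unit 1) run_coef //= big_cons /= big_nil.
set b := bs`_k; set v := run init (xword (take k bs)).
have rv : regular iota v by exact: run_regular.
rewrite (take_nth 0) // xword_rcons runM // run_letter //= -/b !(IH (ltnW ks)).
rewrite big_cat big_map /=; congr (_ + _).
  rewrite big_seq_cond [RHS]big_seq_cond; apply: eq_bigr => l.
  rewrite mem_increasing_seqs => /andP[/andP[_ lk] l0].
  rewrite slice_rcons // -/b; last by case: l l0 lk => // a l _ /allP/(_ _ (mem_last a l)).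
  by rewrite xword_rcons !mulrA.
under [RHS]eq_bigl => l do rewrite -size_eq0 size_rcons.
rewrite [RHS](bigD1_seq [::]) ?nil_increasing_seqs ?uniq_increasing_seqs //=.
congr (_ + _).
  by rewrite /slice subnn take0 /block_prefix /mkseq /= !xword_nil !mul1r.
apply: eq_bigr => l l0; rewrite last_rcons -/b block_prefix_rcons //.
rewrite mulr1 -/(last_block bs l k).
have -> : slice bs k.+1 k.+1 = [::] by rewrite /slice subnn take0.
rewrite xword_nil mul1r; congr (M (xword (take _ _)) * rho _).
  by case: (l) l0.
by rewrite !mulrA.
Qed.

Lemma cmoment_chain bs : bs != [::] ->
  M (xword bs) =
    \sum_(1 <= p < (size bs).+1)
      \sum_(l : p.-tuple 'I_(size bs) | cchain (size bs) (map val l))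
        M (xword (take (head 0%N (map val l)) bs)) *
        rho (xword (cargs nu bs (map val l))).
Proof.
move=> bs0; have n0 : (0 < size bs)%N by rewrite lt0n size_eq0.
rewrite (chain_sum (fun l => M (xword (take (head 0%N l) bs)) *
        rho (xword (cargs nu bs l)))) //.
have ri := regular_init unit iota.
set k := (size bs).-1; have ks : (k < size bs)%N by rewrite prednK.
set b := bs`_k; have lb : last 0 bs = b by rewrite /b nth_last.
set v := run init (xword (take k bs)).
have rv : regular iota v by exact: run_regular.
have bE : bs = rcons (take k bs) b.
  by rewrite -(take_nth 0) // prednK // take_size.
rewrite {1}bE xword_rcons /cmoment runM // run_letter //= (run_word (ltnW ks)).
rewrite [RHS](bigD1_seq [::]) ?nil_increasing_seqs ?uniq_increasing_seqs //=.
rewrite mulrDl; congr (_ + _).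
  by rewrite /cargs /= xword_cons xword_nil mulr1 lb rho_right mulrA.
rewrite mulr_suml; apply: eq_bigr => l l0.
rewrite mulr1 -/(last_block bs l k) /cargs size_rcons /= xword_rcons lb.
rewrite -[LHS]mulrA -rho_right mkseq_cblock_rcons // xword_rcons !mulrA.
by congr (M (xword (take _ _)) * _); case: (l) l0.
Qed.

Lemma top_chain (V : nmodType) n (F : seq nat -> V) : (0 < n)%N ->
  \sum_(l : n.-tuple 'I_n | cchain n (map val l)) F (map val l) = F (seq.iota 0 n).
Proof.
move=> n0; rewrite (big_pred1 (ord_tuple n)) => [|l].
  by rewrite /= val_enum_ord.
rewrite /cchain; apply/andP/eqP => [[sl _]|->].
  apply/val_inj/(inj_map val_inj); rewrite (ord_chain sl).
  by rewrite /= val_enum_ord.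
rewrite /= val_enum_ord iota_ltn_sorted; split => //.
by rewrite -nth_last size_iota nth_iota ?add0n // ltn_predL.
Qed.

(** The terms below the top one in the cumulant recursion and in [cmoment_chain] agree by induction
    on length, so the terms p = n agree as well. *)
Lemma ckappa_cmoment bs : bs != [::] -> ckappa M nu bs = rho (xword bs).
Proof.
have M1 : M 1 = 1 by apply: bimodule_map1; exact: cmoment_bimodule.
have nu1 : nu 1 = 1 by exact: bimodule_map1 nu_ce.
move: {2}(size bs) (leqnn (size bs)) => n; elim: n bs => [|n IH] bs sn bs0.
  by move: sn bs0; rewrite leqn0 -size_eq0 => ->.
have n0 : (0 < size bs)%N by rewrite lt0n size_eq0.
rewrite ckappa_unfold // cmoment_chain // big_nat_recr //=.
rewrite (top_chain (fun l => M (xword (take (head 0%N l) bs)) *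
        rho (xword (cargs nu bs l)))) // cargs_iota //.
have -> : head 0%N (seq.iota 0 (size bs)) = 0%N by case: (size bs).
rewrite take0 xword_nil M1 mul1r addrC -[RHS]addr0 -addrA; congr (_ + _).
apply/eqP; rewrite subr_eq0; apply/eqP/eq_big_nat => p /andP[p0 pn].
apply: eq_bigr => l _; congr (_ * _); apply/esym/IH.
  rewrite size_cargs size_map size_tuple prednK //.
  by rewrite -ltnS (leq_trans pn).
by rewrite -size_eq0 size_cargs.
Qed.

End ChainFormula.

Lemma cmoment_crho (K : numClosedFieldType) (B D : starAlgType K)
    (iota : {lrmorphism B -> D}) mu nu :
  unital_bimodule_map iota mu -> conditional_expectation nu ->
  mu =1 cmoment iota nu (crho iota mu nu).
Proof.
move=> mu_b nu_ce.
have [rho_b rhoE] := crhoP mu_b (bimodule_map_linear nu_ce).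
set rho := crho iota mu nu in rho_b rhoE *.
have rho_lin := bimodule_map_linear rho_b.
have rho_right := bimod_right' rho_b.
have M_b := cmoment_bimodule (bimodule_map_linear nu_ce) rho_lin rho_right.
apply: ncpoly_span.
- exact: (lin_add (bimodule_map_linear mu_b)).
- exact: (lin_add (bimodule_map_linear M_b)).
move=> b bs; rewrite (bimod_left mu_b) (bimod_left M_b); congr (_ * _).
move: {2}(size bs) (leqnn (size bs)) => n; elim: n bs => [|n IH] bs sn.
  move: sn; rewrite leqn0 => /nilP ->.
  by rewrite xword_nil (bimodule_map1 mu_b) (bimodule_map1 M_b).
have [->|bs0] := eqVneq bs [::].
  by rewrite xword_nil (bimodule_map1 mu_b) (bimodule_map1 M_b).
rewrite (ckappaE (bimodule_map1 mu_b) (bimodule_map1 nu_ce) bs0) cmoment_chain //.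
apply: eq_big_nat => p /andP[p0 pn]; apply: eq_bigr => l _.
rewrite rhoE; last by rewrite -size_eq0 size_cargs.
congr (_ * _); apply: IH; rewrite size_take_min.
have : (head 0%N (map val l) < size bs)%N.
  case: l => -[|i l] /=; first by move/eqP => p0'; move: p0; rewrite -p0'.
  by move=> _; exact: ltn_ord.
by move=> h; rewrite geq_min; apply/orP; left; rewrite -ltnS (leq_trans h).
Qed.

(** * Positivity *)

Section ConstantTerm.
Variables (K : numClosedFieldType) (I : Type) (B : starAlgType K).

Lemma const_coef (b : B) : nc_constant_term (nccoef I b) = b.
Proof. exact: ncevalC. Qed.

Lemma const_var (i : I) : nc_constant_term (ncvar B i) = 0.
Proof. exact: ncevalX. Qed.

Lemma constD (f g : ncpoly I B) :
  nc_constant_term (f + g) = nc_constant_term f + nc_constant_term g.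
Proof. exact: rmorphD. Qed.

Lemma constM (f g : ncpoly I B) :
  nc_constant_term (f * g) = nc_constant_term f * nc_constant_term g.
Proof. exact: rmorphM. Qed.

Lemma const0 : nc_constant_term (0 : ncpoly I B) = 0.
Proof. exact: rmorph0. Qed.

End ConstantTerm.

Section GramPositivity.
Variables (R : realType) (B : cstarAlgType R).

Lemma mxpositive_star (A : cstarAlgType R) n (M : 'M[A]_n) : mxpositive M ->
  forall i j, star (M i j) = M j i.
Proof. by move=> [C ->] i j; rewrite -mxstarE mxstarM mxstarK. Qed.

(** Positivity implies complete positivity when the values lie in [B]: by the bimodule property a
    vector over [B] is absorbed into the single polynomial [F]. *)
Lemma cp_of_positive (nu : ncpoly unit B -> B) n (f : 'I_n -> ncpoly unit B) :
  SigmaB nu -> mxpositive (gram nu f).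
Proof.
move=> [nu_ce nu_pos]; apply/mxpositive_ip => x.
have nl := bimod_left (iota := (idfun : {lrmorphism B -> B})) nu_ce.
have nr := bimod_right' (iota := (idfun : {lrmorphism B -> B})) nu_ce.
pose F := \sum_i f i * nccoef unit (x i 0).
suff -> : ip x (gram nu f *m x) = nu (star F * F) by exact: nu_pos.
rewrite star_sum mulr_suml (lin_sum (bimodule_map_linear nu_ce)) /ip.
apply: eq_bigr => j _; rewrite starM nc_star_coef -mulrA nl /= mxE; congr (_ * _).
rewrite mulr_sumr (lin_sum (bimodule_map_linear nu_ce)); apply: eq_bigr => i _.
by rewrite mulrA nr /= mxE.
Qed.

Lemma ce_star (nu : ncpoly unit B -> B) f : SigmaB nu -> nu (star f) = star (nu f).
Proof.
move=> nuS; pose g (i : 'I_2) := if i == 0 then f else 1.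
have := mxpositive_star (cp_of_positive g nuS) 1 0.
by rewrite !mxE /g /= star1 mul1r mulr1 => ->.
Qed.

Lemma gram_fin_sum (A : cstarAlgType R) (rho : ncpoly unit B -> A) (J : finType)
    (f : J -> ncpoly unit B) :
  ((0 < #|J|)%N -> mxpositive (gram rho (fun e : 'I_#|J| => f (enum_val e)))) ->
  exists h : 'I_#|J| -> J -> A, forall s t,
    rho (star (f s) * f t) = \sum_e star (h e s) * h e t.
Proof.
move=> pos; case: (posnP #|J|) => [J0|J0].
  by exists (fun _ _ => 0) => s; have := fintype0 s; rewrite J0.
have [h hE] := mxpositive_sumP (pos J0).
exists (fun e s => h e (enum_rank s)) => s t.
by rewrite -hE mxE !enum_rankK.
Qed.

End GramPositivity.

(** * Positivity of moments from positivity of cumulants *)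

Section MomentPositivity.
Variables (R : realType) (B D : cstarAlgType R).
Variables (iota : {lrmorphism B -> D}).
Variables (nu : ncpoly unit B -> B) (rho : ncpoly unit B -> D).
Hypothesis iota_star : forall b, iota (star b) = star (iota b).
Hypothesis nuS : SigmaB nu.
Hypothesis rho_lin : linear rho.
Hypothesis rho_right : forall g b, rho (g * nccoef unit b) = rho g * iota b.

Let X : ncpoly unit B := ncvar B tt.

(** A separate assumption: [rho_pos] concerns products of two polynomials without constant term, and
    X is not of this kind. *)
Hypothesis rho_X : star (rho X) = rho X.
Hypothesis rho_pos : forall n (f : 'I_n -> ncpoly unit B), (0 < n)%N ->
  (forall i, nc_constant_term (f i) = 0) -> mxpositive (gram rho f).

Let nu_ce : conditional_expectation nu. Proof. by case: nuS. Qed.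
Let nu_lin : linear nu := bimodule_map_linear nu_ce.
Notation M := (cmoment iota nu rho).
Notation run := (run iota nu rho).
Notation init := (init unit B D).
Let M_b : unital_bimodule_map iota M := cmoment_bimodule nu_lin rho_lin rho_right.

Lemma rho_star f g : nc_constant_term f = 0 -> nc_constant_term g = 0 ->
  star (rho (star f * g)) = rho (star g * f).
Proof.
move=> f0 g0; pose h (i : 'I_2) := if i == 0 then f else g.
have hp : mxpositive (gram rho h).
  by apply: rho_pos => // i; rewrite /h; case: ifP.
by have := mxpositive_star hp 0 1; rewrite !mxE.
Qed.

Definition gap_term := (ncpoly unit B * ncpoly unit B * D)%type.

(* A word on the right of a cut sees the state on its left only through the pairing with
   a finite list of such terms; the same list describes the state of the adjoint word. *)
Record right_part (h : ncpoly unit B) (L : seq gap_term) : Prop := {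
  right_const : forall t, t \in L -> nc_constant_term t.1.2 = 0;
  right_run : forall v : state unit B D, regular iota v ->
    (run v h).1 = v.1 * M h + \sum_(t <- L) v.2 tt t.1.1 t.1.2 * t.2;
  right_adjoint : forall u p, (run init (star h)).2 tt u p =
    \sum_(t <- L) star t.2 * rho (star t.1.2 * nccoef unit (nu (star t.1.1 * u)) * p);
  right_star : M (star h) = star (M h)
}.

Lemma right_part1 : right_part 1 [::].
Proof.
have ri := regular_init unit iota.
have r1 v : regular iota v -> run v 1 = v.
  move=> rv; rewrite -[1]/(nccoef unit 1) run_coef //; apply: state_ext => [|i u g] /=.
    by rewrite rmorph1 mulr1.
  by rewrite rmorph1 mul1r.
split=> //.
- by move=> v rv; rewrite r1 // big_nil addr0 (bimodule_map1 M_b) mulr1.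
- by move=> u p; rewrite star1 r1 // big_nil.
- by rewrite star1 (bimodule_map1 M_b) star1.
Qed.

Lemma right_partD f g L L' : right_part f L -> right_part g L' ->
  right_part (f + g) (L ++ L').
Proof.
have ri := regular_init unit iota.
move=> [fc fr fa fs] [gc gr ga gs]; split.
- by move=> t; rewrite mem_cat => /orP[/fc|/gc].
- move=> v rv; rewrite runD // -[LHS]/((run v f).1 + (run v g).1) fr // gr //.
  by rewrite (lin_add (bimodule_map_linear M_b)) mulrDr big_cat /= addrACA.
- by move=> u p; rewrite starD runD // -[LHS]/(_ + _) fa ga big_cat.
- by rewrite starD !(lin_add (bimodule_map_linear M_b)) fs gs starD.
Qed.

Lemma right_partN f L : right_part f L ->
  right_part (- f) [seq (t.1, - t.2) | t <- L].
Proof.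
have ri := regular_init unit iota.
move=> [fc fr fa fs]; split.
- by move=> t /mapP[t' /fc h ->].
- move=> v rv; rewrite runN // -[LHS]/(- (run v f).1) fr //.
  rewrite (lin_opp (bimodule_map_linear M_b)) mulrN big_map opprD -sumrN.
  by congr (_ + _); apply: eq_bigr => t _; rewrite mulrN.
- move=> u p; rewrite starN runN // -[LHS]/(- _) fa big_map -sumrN.
  by apply: eq_bigr => t _; rewrite /= starN mulNr.
- by rewrite starN !(lin_opp (bimodule_map_linear M_b)) fs starN.
Qed.

Lemma right_part_coef b h L : right_part h L ->
  right_part (nccoef unit b * h) [seq (nccoef unit b * t.1.1, t.1.2, t.2) | t <- L].
Proof.
have ri := regular_init unit iota.
move=> [hc hr ha hs]; split.
- by move=> t /mapP[t' /hc h' ->].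
- move=> v rv; rewrite runM // hr; last exact: run_regular.
  by rewrite run_coef //= (bimod_left M_b) mulrA big_map.
- move=> u p; rewrite starM runM // nc_star_coef run_coef //=; last exact: run_regular.
  rewrite ha big_map; apply: eq_bigr => t _ /=.
  by rewrite starM nc_star_coef mulrA.
- by rewrite starM nc_star_coef (bimod_right' M_b) hs (bimod_left M_b) starM iota_star.
Qed.

(** The three groups of terms are the fates of a block open on the left: it ends at this X, keeps X
    in its gap, or takes X as a letter followed by a gap with value [nu t.1.1]. A block that starts
    at X does not cross the cut and is counted in [M (X * h)]. *)
Lemma right_part_var h L : right_part h L ->
  right_part (X * h)
    ((1, X, M h) :: [seq (X * t.1.1, t.1.2, t.2) | t <- L] ++
     [seq (1, X * nccoef unit (nu t.1.1) * t.1.2, t.2) | t <- L]).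
Proof.
have ri := regular_init unit iota.
have nu1 : nu 1 = 1 by exact: bimodule_map1 nu_ce.
move=> [hc hr ha hs].
have runX v : regular iota v -> (run v (X * h)).1 =
    (v.1 * rho X + v.2 tt 1 X) * M h + \sum_(t <- L)
      (v.2 tt (X * t.1.1) t.1.2 + (v.1 * rho (X * nccoef unit (nu t.1.1) * t.1.2) +
        v.2 tt 1 (X * nccoef unit (nu t.1.1) * t.1.2))) * t.2.
  move=> rv; rewrite runM // hr; last exact: run_regular.
  by rewrite run_var.
have MX : M (X * h) = rho X * M h +
    \sum_(t <- L) rho (X * nccoef unit (nu t.1.1) * t.1.2) * t.2.
  rewrite /cmoment runX // mul1r addr0; congr (_ + _).
  by apply: eq_bigr => t _; rewrite mul1r /= add0r addr0.
have star_X : star X = X by exact: nc_star_var.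
split.
- move=> t; rewrite inE mem_cat => /orP[/eqP ->|/orP[/mapP[t' /hc h' ->] //|/mapP[t' /hc h' ->]]].
    exact: const_var.
  by rewrite /= !constM h' mulr0.
- move=> v rv; rewrite runX // MX big_cons big_cat !big_map /=.
  under eq_bigr => t _ do rewrite !mulrDl.
  rewrite !big_split /= mulrDr mulrDl mulr_sumr.
  have -> : \sum_(t <- L) v.1 * rho (X * nccoef unit (nu t.1.1) * t.1.2) * t.2 =
      \sum_(t <- L) v.1 * (rho (X * nccoef unit (nu t.1.1) * t.1.2) * t.2).
    by apply: eq_bigr => t _; rewrite mulrA.
  nc_ring.
- move=> u p; rewrite starM star_X runM // run_var //=; last exact: run_regular.
  rewrite !ha big_cons big_cat !big_map /= star1 mul1r star_X.
  have -> : (run init (star h)).1 = star (M h) by [].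
  rewrite [LHS]addrCA; congr (_ + (_ + _)); apply: eq_bigr => t _ /=.
    by rewrite starM star_X mulrA.
  rewrite starM starM star_X nc_star_coef mulr1 -(ce_star _ nuS).
  by rewrite !mulrA.
- rewrite starM star_X MX /cmoment runM // run_var //=; last exact: run_regular.
  rewrite ha starD starM rho_X -hs; congr (_ + _).
  rewrite star_sum big_seq [RHS]big_seq; apply: eq_bigr => t tL.
  rewrite starM mulr1; congr (_ * _); rewrite (ce_star _ nuS).
  have := @rho_star (nccoef unit (star (nu t.1.1)) * X) t.1.2.
  rewrite constM const_var mulr0 (hc t tL) starM nc_star_coef starK star_X !mulrA.
  by move=> ->.
Qed.

Lemma right_part_exists f : exists L, right_part f L.
Proof.
suff key h L : right_part h L -> exists L', right_part (f * h) L'.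
  by have := key _ _ right_part1; rewrite mulr1.
elim/ncpoly_ind: f h L => [b|[]|f g IHf IHg|f IHf|f g IHf IHg] h L hL.
- by eexists; exact: right_part_coef hL.
- by eexists; exact: right_part_var hL.
- have [Lf hf] := IHf _ _ hL; have [Lg hg] := IHg _ _ hL.
  by rewrite mulrDl; eexists; exact: right_partD hf hg.
- by have [Lf hf] := IHf _ _ hL; rewrite mulNr; eexists; exact: right_partN hf.
- have [Lg hg] := IHg _ _ hL; have [Lf hf] := IHf _ _ hg.
  by rewrite -mulrA; exists Lf.
Qed.

(** A straddling term pairs, through [rho], two outer polynomials around [nu] of a product of two
    gaps. The Gram matrix of [nu] at the gaps factors by complete positivity; its factors are moved
    into the arguments of [rho], whose Gram matrices are then factored in turn. *)
Lemma cmoment_gram n (f : 'I_n -> ncpoly unit B) : mxpositive (gram M f).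
Proof.
have ri := regular_init unit iota.
have /choice[L hL] : forall i, exists L, right_part (f i) L.
  by move=> i; exact: right_part_exists.
pose t0 : gap_term := (0, 0, 0).
pose m := (\max_i size (L i))%N.
have Lm i : (size (L i) <= m)%N by exact: leq_bigmax.
(* Padding with the zero term [t0] brings all lists to the length m, so that one finite type indexes
   the terms of every f_i. *)
pose J : finType := ('I_n * 'I_m)%type.
pose T (s : J) : gap_term := nth t0 (L s.1) s.2.
pose d i (s : J) : D := if s.1 == i then (T s).2 else 0.
have sumL i (F : gap_term -> D -> D) : (forall t, F t 0 = 0) ->
    \sum_(t <- L i) F t t.2 = \sum_s F (T s) (d i s).
  move=> F0; rewrite (big_nth t0) big_mkord.
  rewrite (big_ord_widen m (fun e => F (nth t0 (L i) e) (nth t0 (L i) e).2)) //.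
  transitivity (\sum_(k : 'I_n) \sum_(e : 'I_m) F (T (k, e)) (d i (k, e))).
    rewrite (bigD1 i) //= [X in _ + X]big1 => [|k ki]; last first.
      by apply: big1 => e _; rewrite /d /= (negPf ki).
    rewrite addr0 big_mkcond /=; apply: eq_bigr => e _; rewrite /d /= eqxx /T /=.
    by case: ltnP => // h; rewrite nth_default.
  by rewrite pair_big; apply: eq_bigr => -[].
have T_const s : nc_constant_term (T s).1.2 = 0.
  rewrite /T; have [h|h] := ltnP s.2 (size (L s.1)); last first.
    by rewrite nth_default //; exact: const0.
  exact: (right_const (hL s.1)) (mem_nth _ h).
have [C CE] := gram_fin_sum (rho := nu) (f := fun s : J => (T s).1.1)
  (fun _ => cp_of_positive _ nuS).
pose q c (s : J) := nccoef unit (C c s) * (T s).1.2.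
have q_const c s : nc_constant_term (q c s) = 0 by rewrite constM T_const mulr0.
have /choice[E hE] : forall c, exists h : 'I_#|J| -> J -> D, forall s t,
    rho (star (q c s) * q c t) = \sum_e star (h e s) * h e t.
  by move=> c; apply: gram_fin_sum => J0; exact: rho_pos.
pose h (e : 'I_#|J| * 'I_#|J|) i := \sum_s E e.1 e.2 s * d i s.
have -> : gram M f = \matrix_(j, i) (\sum_(e : 'I_1) star (M (f j)) * M (f i)) +
    \matrix_(j, i) (\sum_e star (h e j) * h e i).
  apply/matrixP => j i; rewrite !mxE big_ord1 /cmoment runM //.
  rewrite (right_run (hL i)); last exact: run_regular.
  have -> : (run init (star (f j))).1 = star (M (f j)) by exact: right_star (hL j).
  congr (_ + _).
  rewrite (sumL i (fun t x => (run init (star (f j))).2 tt t.1.1 t.1.2 * x)); last first.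
    by move=> t; rewrite mulr0.
  transitivity (\sum_t \sum_s star (d j s) *
      (\sum_c \sum_e star (E c e s) * E c e t) * d i t).
    apply: eq_bigr => t _; rewrite (right_adjoint (hL j)).
    rewrite (sumL j (fun s x => star x *
      rho (star s.1.2 * nccoef unit (nu (star s.1.1 * (T t).1.1)) * (T t).1.2))).
      rewrite mulr_suml; apply: eq_bigr => s _; congr (_ * _ * _).
      under eq_bigr => c _ do rewrite -hE.
      rewrite -(lin_sum rho_lin) CE; congr rho.
      rewrite raddf_sum /= mulr_sumr mulr_suml; apply: eq_bigr => c _.
      by rewrite /q starM nc_star_coef nccoefM !mulrA.
    by move=> s; rewrite star0 mul0r.
  transitivity (\sum_t \sum_s \sum_(x : 'I_#|J| * 'I_#|J|)
      star (E x.1 x.2 s * d j s) * (E x.1 x.2 t * d i t)).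
    apply: eq_bigr => t _; apply: eq_bigr => s _.
    rewrite pair_big mulr_sumr mulr_suml; apply: eq_bigr => x _.
    by rewrite starM !mulrA.
  under eq_bigr => t _ do rewrite exchange_big /=.
  rewrite exchange_big /=; apply: eq_bigr => x _.
  rewrite /h star_sum mulr_sumr; apply: eq_bigr => t _.
  by rewrite mulr_suml.
by apply: mxpositiveD; exact: mxpositive_gram_row.
Qed.

End MomentPositivity.

(** * Polynomial dependence on 1/N *)

Section PolynomialFamilies.
Variable K : numClosedFieldType.

Definition inv_succ (n : nat) : K := n.+1%:R^-1.

(* The sequence F is a polynomial in 1/(n+1), with constant coefficient a. *)
Inductive invpoly (V : lmodType K) : (nat -> V) -> V -> Prop :=
| invpoly_cst a : invpoly (fun=> a) a
| invpoly_step a F b : invpoly F b -> invpoly (fun n => a + inv_succ n *: F n) a.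

Lemma eq_invpoly (V : lmodType K) (F G : nat -> V) a b :
  F =1 G -> a = b -> invpoly F a -> invpoly G b.
Proof. by move=> /funext -> ->. Qed.

Lemma invpolyD (V : lmodType K) (F G : nat -> V) a b :
  invpoly F a -> invpoly G b -> invpoly (fun n => F n + G n) (a + b).
Proof.
move=> hF; elim: hF G b => {F a} [a|a F a' hF IH] G b.
  case=> {G b} [b|b G b' hG]; first exact: invpoly_cst.
  apply: (eq_invpoly (F := fun n => a + b + inv_succ n *: G n)) => //.
    by move=> n; rewrite addrA.
  exact: invpoly_step hG.
case=> {G b} [b|b G b' hG].
  apply: (eq_invpoly (F := fun n => a + b + inv_succ n *: F n)) => //.
    by move=> n; rewrite addrAC.
  exact: invpoly_step hF.
apply: (eq_invpoly (F := fun n => a + b + inv_succ n *: (F n + G n))) => //.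
  by move=> n; rewrite scalerDr addrACA.
exact: invpoly_step (IH _ _ hG).
Qed.

Lemma invpoly_shift (V : lmodType K) (F : nat -> V) a :
  invpoly F a -> invpoly (fun n => inv_succ n *: F n) 0.
Proof.
move=> hF; apply: (eq_invpoly (F := fun n => 0 + inv_succ n *: F n)) => //.
  by move=> n; rewrite add0r.
exact: invpoly_step hF.
Qed.

Lemma invpoly_lin (V W : lmodType K) (L : V -> W) (F : nat -> V) a :
  linear L -> invpoly F a -> invpoly (fun n => L (F n)) (L a).
Proof.
move=> Ll; elim=> {F a} [a|a F b hF IH]; first exact: invpoly_cst.
apply: (eq_invpoly (F := fun n => L a + inv_succ n *: L (F n))) => //.
  by move=> n; rewrite (lin_add Ll) (lin_scale Ll).
exact: invpoly_step IH.
Qed.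

Lemma invpoly_sum (V : lmodType K) (J : Type) (r : seq J) (F : J -> nat -> V) a :
  (forall j, invpoly (F j) (a j)) ->
  invpoly (fun n => \sum_(j <- r) F j n) (\sum_(j <- r) a j).
Proof.
move=> h; elim: r => [|j r IH].
  apply: (eq_invpoly (F := fun=> 0) (a := 0)); last exact: invpoly_cst.
    by move=> n; rewrite big_nil.
  by rewrite big_nil.
apply: (eq_invpoly (F := fun n => F j n + \sum_(j <- r) F j n)
  (a := a j + \sum_(j <- r) a j)); last exact: invpolyD.
  by move=> n; rewrite big_cons.
by rewrite big_cons.
Qed.

Lemma invpoly_bilin (U V W : lmodType K) (m : U -> V -> W) (F : nat -> U)
    (G : nat -> V) a b :
  (forall v, linear (fun u => m u v)) -> (forall u, linear (m u)) ->
  invpoly F a -> invpoly G b -> invpoly (fun n => m (F n) (G n)) (m a b).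
Proof.
move=> ml mr hF hG; elim: hF => {F a} [a|a F a' hF IH]; first exact: invpoly_lin.
apply: (eq_invpoly (F := fun n => m a (G n) + inv_succ n *: m (F n) (G n))
  (a := m a b + 0)).
- by move=> n; rewrite (lin_add (ml (G n))) (lin_scale (ml (G n))).
- by rewrite addr0.
- by apply: invpolyD; [exact: invpoly_lin | exact: invpoly_shift IH].
Qed.

Lemma invpolyM (A : algType K) (F G : nat -> A) a b :
  invpoly F a -> invpoly G b -> invpoly (fun n => F n * G n) (a * b).
Proof.
apply: invpoly_bilin => [v|u] k x y; first by rewrite mulrDl scalerAl.
by rewrite mulrDr scalerAr.
Qed.

Lemma inv_succK (V : lmodType K) n (x : V) : n.+1%:R *: (inv_succ n *: x) = x.
Proof. by rewrite scalerA mulfV ?scale1r // pnatr_eq0. Qed.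

End PolynomialFamilies.

(** * Expansion of the moments of the roots *)

Section MomentExpansion.
Variables (K : numClosedFieldType) (B D : starAlgType K).
Variables (iota : {lrmorphism B -> D}).
Variables (nus : nat -> ncpoly unit B -> B) (rhos : nat -> ncpoly unit B -> D).
Variable rho : ncpoly unit B -> D.
Hypothesis nus_ce : forall n, conditional_expectation (nus n).
Hypothesis rhos_lin : forall n, linear (rhos n).
Hypothesis rhos_right : forall n g b, rhos n (g * nccoef unit b) = rhos n g * iota b.
Hypothesis rho_lin : linear rho.
Hypothesis rho_right : forall g b, rho (g * nccoef unit b) = rho g * iota b.

Let X : ncpoly unit B := ncvar B tt.

Hypothesis rhosE : forall n g, rhos n (X * g) = inv_succ K n *: rho (X * g).

Notation M n := (cmoment iota (nus n) (rhos n)).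
Notation run n := (run iota (nus n) (rhos n)).
Notation init := (init unit B D).

(** The strict bound makes induction on m possible: in a word of length m the letter that opens a
    block lies in no gap of it, so the gaps are shorter than m. *)
Definition word_small m := forall v : seq B, (size v < m)%N ->
  invpoly (fun n => nus n (xword v)) ((v == [::])%:R).

(** Each block carries a factor 1/(n+1), so n+1 times a moment keeps at order zero only a single
    block, whose gaps must be empty because [nus] has no constant coefficient on nonempty words. The
    argument [G] is a family since reading a letter puts values of [nus n] into it. *)
Lemma cmoment_expansion m w : word_small m ->
  (forall v, (size w + size v <= m)%N -> forall G g, invpoly G g ->
     invpoly (fun n => n.+1%:R *: (run n init (xword w)).2 tt (xword v) (G n))
       (if (w != [::]) && (v == [::]) then rho (xword w * g) else 0)) /\
  ((size w <= m)%N -> invpoly (fun n => M n (xword w)) ((w == [::])%:R) /\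
     (w != [::] -> invpoly (fun n => n.+1%:R *: M n (xword w)) (rho (xword w)))).
Proof.
move=> small; have ri := regular_init unit iota.
have nl n := bimodule_map_linear (nus_ce n).
have rl := rhos_lin; have rr := rhos_right.
have rhosX n : rhos n X = inv_succ K n *: rho X by have := rhosE n 1; rewrite mulr1.
elim/last_ind: w => [|w b [IHp IHm]].
  split=> [v _ G g _|_] /=.
    apply: (eq_invpoly (F := fun=> 0) (a := 0)) => //; last exact: invpoly_cst.
    by move=> n; rewrite xword_nil -(rmorph1 (@nccoef K unit B)) run_coef //= scaler0.
  split=> //; apply: (eq_invpoly (F := fun=> 1) (a := 1)) => //; last exact: invpoly_cst.
  move=> n; rewrite xword_nil (bimodule_map1 (cmoment_bimodule _ _ _)) //.
have w0 : rcons w b != [::] by case: (w).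
have rw n : regular iota (run n init (xword w)) by exact: run_regular.
rewrite (negPf w0) size_rcons; split=> [v sv G g hG|sw] /=.
  have sv' : (size v < m)%N by apply: leq_trans sv; rewrite addSn ltnS leq_addl.
  have [hM _] := IHm (leq_trans (leqnSn _) (leq_trans (leq_addr _ _) sv)).
  have h1 := IHp (b :: v) (leq_trans (eq_leq (addnS _ _)) sv) G g hG.
  (* The constant coefficient of [b * nus n (xword v)]: zero unless the gap is empty. *)
  pose e : B := b * (v == [::])%:R.
  have hG' : invpoly (fun n => X * nccoef unit (b * nus n (xword v)) * G n)
      (X * nccoef unit e * g).
    apply: invpolyM => //; apply: (invpoly_lin (L := fun c => X * nccoef unit (b * c))).
      by move=> k x y; rewrite mulrDr -scalerAr nccoefD nccoefZ mulrDr scalerAr.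
    exact: small.
  have s0 : (size w + 0 <= m)%N.
    by rewrite addn0 (leq_trans (leqnSn _)) // (leq_trans (leq_addr _ _) sv).
  have h3 := IHp [::] s0 _ _ hG'.
  have h2 : invpoly (fun n => M n (xword w) *
      rho (X * nccoef unit (b * nus n (xword v)) * G n))
      ((w == [::])%:R * rho (X * nccoef unit e * g)).
    by apply: invpolyM => //; exact: invpoly_lin hG'.
  apply: (eq_invpoly _ _ (invpolyD h1 (invpolyD h2 h3))).
    move=> n; rewrite xword_nil xword_rcons runM // (run_letter (nus_ce n)) //=.
    rewrite xword_cons -!mulrA rhosE !scalerDr; congr (_ + (_ + _)).
    by rewrite scalerAr inv_succK.
  rewrite andbF add0r andbT /e; case: (v == [::]); last first.
    by rewrite mulr0 rmorph0 mulr0 mul0r mulr0 (lin_0 rho_lin) mulr0 add0r if_same.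
  rewrite mulr1 xword_rcons; have [->|wn] /= := eqVneq w [::].
    by rewrite mul1r addr0 xword_nil mul1r.
  by rewrite mul0r add0r !mulrA.
have [hM _] := IHm (ltnW sw).
have s0 : (size w + 0 <= m)%N by rewrite addn0 ltnW.
have h3 := IHp [::] s0 _ _ (invpoly_cst X).
have h2 : invpoly (fun n => M n (xword w) * rho X) ((w == [::])%:R * rho X).
  by apply: invpolyM => //; exact: invpoly_cst.
have h : invpoly (fun n => n.+1%:R *: M n (xword (rcons w b))) (rho (xword (rcons w b))).
  apply: (eq_invpoly _ _ (invpolyM (invpolyD h2 h3) (invpoly_cst (iota b)))).
    move=> n; rewrite xword_nil xword_rcons /cmoment runM // (run_letter (nus_ce n)) //=.
    rewrite scalerAl scalerDr; congr ((_ + _) * _).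
    by rewrite rhosX -scalerAr inv_succK.
  rewrite andbT xword_rcons mulrA rho_right; congr (_ * _).
  have [->|wn] /= := eqVneq w [::]; first by rewrite mul1r addr0 xword_nil mul1r.
  by rewrite mul0r add0r.
split=> //; apply: (eq_invpoly _ _ (invpoly_shift h)) => // n.
by rewrite scalerA mulVf ?scale1r // pnatr_eq0.
Qed.

End MomentExpansion.

Section WordInduction.
Variables (K : numClosedFieldType) (B : starAlgType K).

Lemma ncpoly_word_ind (Q : ncpoly unit B -> Prop) :
  (forall b w, Q (nccoef unit b * xword w)) ->
  (forall f g, Q f -> Q g -> Q (f + g)) -> (forall f, Q f -> Q (- f)) -> forall f, Q f.
Proof.
move=> Qw Qa Qn f.
(* Quantifying over all predicates lets a left factor be shifted from the polynomial into the
   predicate. *)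
pose S (g : ncpoly unit B) := forall Q : ncpoly unit B -> Prop,
  (forall b w, Q (nccoef unit b * xword w)) ->
  (forall f g, Q f -> Q g -> Q (f + g)) -> (forall f, Q f -> Q (- f)) -> Q g.
suff key g : S g -> S (f * g).
  have := key 1; rewrite mulr1; apply=> // Q' Q'w _ _.
  by have := Q'w 1 [::]; rewrite xword_nil rmorph1 mulr1.
elim/ncpoly_ind: f g => {Q Qw Qa Qn} [b|[]|f h IHf IHh|f IHf|f h IHf IHh] g Sg Q Qw Qa Qn.
- apply: (Sg (fun x => Q (nccoef unit b * x))) => [c w|x y Qx Qy|x Qx].
  + by rewrite mulrA -nccoefM.
  + by rewrite mulrDr; exact: Qa.
  + by rewrite mulrN; exact: Qn.
- apply: (Sg (fun x => Q (ncvar B tt * x))) => [c w|x y Qx Qy|x Qx].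
  + by have := Qw 1 (c :: w); rewrite rmorph1 mul1r xword_cons -mulrA.
  + by rewrite mulrDr; exact: Qa.
  + by rewrite mulrN; exact: Qn.
- by rewrite mulrDl; apply: (Qa); [apply: (IHf g Sg Q) | apply: (IHh g Sg Q)].
- by rewrite mulNr; apply: (Qn); apply: (IHf g Sg Q).
- by rewrite -mulrA; apply: (IHf _ (IHh _ Sg) Q).
Qed.

End WordInduction.

(** * Positivity of the constant coefficient *)

Section Limits.
Variables (R : realType) (A : cstarAlgType R).

Lemma invpoly_bounded (F : nat -> A) a : invpoly F a ->
  exists c, forall n, cnorm (F n) <= c.
Proof.
elim=> {F a} [a|a F b _ [c hc]]; first by exists (cnorm a).
exists (cnorm a + c) => n; rewrite (le_trans (cnormD _ _)) // lerD2l.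
rewrite /inv_succ -(@rmorph_nat _ _ (real_complex R)) -fmorphV /= cnormZr.
rewrite ger0_norm ?invr_ge0 ?ler0n //.
rewrite (le_trans _ (hc n)) // -{2}[cnorm (F n)]mul1r ler_wpM2r ?cnorm_ge0 //.
by rewrite invf_le1 ?ltr0n // ler1n.
Qed.

Lemma invpoly_converges (F : nat -> A) a : invpoly F a -> converges F a.
Proof.
case=> {F a} [a|a F b hF]; first exact: converges_cst.
have [c hc] := invpoly_bounded hF.
have c0 : 0 <= c by rewrite (le_trans (cnorm_ge0 (F 0%N))).
move=> e e0; have [s s0 sc] := small_scalar e0 c0.
exists (Num.truncn s^-1) => n Nn; rewrite addrC addKr.
rewrite /inv_succ -(@rmorph_nat _ _ (real_complex R)) -fmorphV /= cnormZr.
rewrite ger0_norm ?invr_ge0 ?ler0n // (le_lt_trans _ sc) //.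
apply: ler_pM => //; rewrite ?invr_ge0 ?cnorm_ge0 //.
rewrite invf_ple ?posrE ?ltr0n //; apply/ltW.
have := truncnS_gt s^-1; move/lt_le_trans; apply.
by rewrite ler_nat ltnS.
Qed.

Lemma invpoly_positive (F : nat -> A) a : invpoly F a ->
  (forall n, positive (F n)) -> positive a.
Proof.
move=> hF pF; apply/positiveP/(psd_limit _ (invpoly_converges hF)) => n.
exact/positiveP.
Qed.

End Limits.

(** * Infinite divisibility *)

Section CumulantScaling.
Variables (K : numClosedFieldType) (B D : starAlgType K).
Variables (iota : {lrmorphism B -> D}).

Let X : ncpoly unit B := ncvar B tt.

Lemma eq_on_varM (V : zmodType) (rho rho' : ncpoly unit B -> V) :
  {morph rho : f g / f + g} -> {morph rho' : f g / f + g} ->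
  (forall bs, bs != [::] -> rho (xword bs) = rho' (xword bs)) ->
  forall g, rho (X * g) = rho' (X * g).
Proof.
move=> rD r'D e g.
have r0 (r : ncpoly unit B -> V) : {morph r : f g / f + g} -> forall f, r (- f) = - r f.
  move=> rd f; have r0 : r 0 = 0 by apply: (addrI (r 0)); rewrite -rd !addr0.
  by apply: (addrI (r f)); rewrite -rd !subrr.
elim/ncpoly_word_ind: g => [b w|f g IHf IHg|f IHf].
- by rewrite mulrA -xword_cons e.
- by rewrite mulrDr rD r'D IHf IHg.
- by rewrite mulrN !r0 // IHf.
Qed.

Lemma ckappa_convolution N mu nu muN nuN :
  unital_bimodule_map iota mu -> conditional_expectation nu ->
  unital_bimodule_map iota muN -> conditional_expectation nuN ->
  is_cfree_convolution iota (fun _ : 'I_N => muN) (fun _ : 'I_N => nuN) mu nu ->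
  forall bs, bs != [::] -> ckappa mu nu bs = N%:R *: ckappa muN nuN bs.
Proof.
move=> mu_b nu_ce muN_b nuN_ce [phi [theta [[phi_ce theta_b] phiE thetaE cf muE]]] bs bs0.
have [rho_b rhoE] := crhoP muN_b (bimodule_map_linear nuN_ce).
have muNE := cmoment_crho muN_b nuN_ce.
set rho := crho iota muN nuN in rho_b rhoE muNE *.
have rho_lin := bimodule_map_linear rho_b.
have rho_right := bimod_right' rho_b.
have phi_lin := bimodule_map_linear phi_ce.
have phi_free : free_variables phi.
  by move=> m eps a ca; have [] := cf m eps a ca.
have thetaM : theta =1 cmoment iota phi rho.
  apply: (cfree_unique phi_ce theta_b _ cf) => [||i f].
  - exact: cmoment_bimodule.
  - exact: cmoment_cfree.
  - rewrite thetaE muNE cmoment_embed //.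
    by congr (cmoment iota _ rho f); apply/funext => g /=; rewrite phiE.
pose rho' f := N%:R *: rho f.
have rho'_lin : linear rho'.
  by move=> k x y; rewrite /rho' rho_lin scalerDr !scalerA mulrC.
have rho'_right g b : rho' (g * nccoef unit b) = rho' g * iota b.
  by rewrite /rho' rho_right scalerAl.
have nuE : nu = phi \o @ncsumvars K B N by apply/funext => f; have [] := muE f.
have muM : mu = cmoment iota nu rho'.
  apply/funext => f; have [-> _] := muE f.
  by rewrite thetaM (cmoment_sum (rho' := rho')) // nuE.
by rewrite [in LHS]muM ckappa_cmoment // /rho' rhoE.
Qed.

(** On centred factors both sides of the product rule are zero. This opens the c-free expansion to
    [nu] alone. *)
Lemma free_is_cfree N (nus : 'I_N -> ncpoly unit B -> B) nu :
  is_free_convolution nus nu ->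
  is_cfree_convolution (idfun : {lrmorphism B -> B}) nus nus nu nu.
Proof.
move=> [phi [phi_ce phiE fr nuE]]; exists phi, phi; split=> //.
move=> m eps a ca; have [_ ce] := ca; split; first exact: fr.
by rewrite (fr _ _ _ ca) big_ord_recl ce // mul0r.
Qed.

Lemma crho_scaled N mu nu muN nuN : (0 < N)%N ->
  unital_bimodule_map iota mu -> conditional_expectation nu ->
  unital_bimodule_map iota muN -> conditional_expectation nuN ->
  is_cfree_convolution iota (fun _ : 'I_N => muN) (fun _ : 'I_N => nuN) mu nu ->
  forall g, crho iota muN nuN (X * g) = N%:R^-1 *: crho iota mu nu (X * g).
Proof.
move=> N0 mu_b nu_ce muN_b nuN_ce conv.
have [rho_b rhoE] := crhoP mu_b (bimodule_map_linear nu_ce).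
have [rhoN_b rhoNE] := crhoP muN_b (bimodule_map_linear nuN_ce).
apply: (@eq_on_varM _ _ (fun g => N%:R^-1 *: crho iota mu nu g)).
- exact: (lin_add (bimodule_map_linear rhoN_b)).
- by move=> f g; rewrite (lin_add (bimodule_map_linear rho_b)) scalerDr.
move=> bs bs0; rewrite rhoNE // rhoE // (ckappa_convolution mu_b nu_ce muN_b nuN_ce conv) //.
by rewrite scalerA mulVf ?scale1r // pnatr_eq0 -lt0n.
Qed.

Lemma const_word (b : B) w :
  nc_constant_term (nccoef unit b * xword w) = if w == [::] then b else 0.
Proof.
rewrite constM const_coef; case: w => [|c w] /=.
  by rewrite xword_nil -(rmorph1 (@nccoef K unit B)) const_coef mulr1.
by rewrite xword_cons !constM const_var !mul0r mulr0.
Qed.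

End CumulantScaling.

Section Expansion.
Variables (K : numClosedFieldType) (B D : starAlgType K).
Variables (iota : {lrmorphism B -> D}).
Variables (mu : ncpoly unit B -> D) (nu : ncpoly unit B -> B).
Variables (mus : nat -> ncpoly unit B -> D) (nus : nat -> ncpoly unit B -> B).
Hypothesis mu_b : unital_bimodule_map iota mu.
Hypothesis nu_ce : conditional_expectation nu.
Hypothesis mus_b : forall n, unital_bimodule_map iota (mus n).
Hypothesis nus_ce : forall n, conditional_expectation (nus n).
Hypothesis conv : forall n, is_cfree_convolution iota
  (fun _ : 'I_n.+1 => mus n) (fun _ : 'I_n.+1 => nus n) mu nu.

(** Control of [nus] on words shorter than m gives control of [mus] up to length m; for the pair
    [(nu, nu)] this is one step of an induction on m. *)
Lemma root_expansion m : word_small nus m ->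
  forall w, (size w <= m)%N ->
  invpoly (fun n => mus n (xword w)) ((w == [::])%:R) /\
  (w != [::] -> invpoly (fun n => n.+1%:R *: mus n (xword w)) (crho iota mu nu (xword w))).
Proof.
move=> small w wm.
have [rho_b rhoE] := crhoP mu_b (bimodule_map_linear nu_ce).
pose rhos n := crho iota (mus n) (nus n).
have rhos_b n : unital_bimodule_map iota (rhos n).
  by have [] := crhoP (mus_b n) (bimodule_map_linear (nus_ce n)).
have musE n : mus n = cmoment iota (nus n) (rhos n).
  by apply/funext; exact: cmoment_crho.
have rhosE n g : rhos n (ncvar B tt * g) = inv_succ K n *: crho iota mu nu (ncvar B tt * g).
  exact: crho_scaled (conv n) g.
have [_ /(_ wm)] := cmoment_expansion nus_ce (fun n => bimodule_map_linear (rhos_b n))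
  (fun n => bimod_right' (rhos_b n)) (bimodule_map_linear rho_b) (bimod_right' rho_b)
  rhosE w small.
move=> [h1 h2]; split=> [|w0].
  by apply: eq_invpoly h1 => // n; rewrite musE.
by apply: eq_invpoly (h2 w0) => // n; rewrite musE.
Qed.

End Expansion.

(** * Necessity: the cumulants of an infinitely divisible pair *)

Section Necessity.
Local Open Scope complex_scope.
Variables (R : realType) (B D : cstarAlgType R).
Variables (iota : {lrmorphism B -> D}).
Variables (mu : ncpoly unit B -> D) (nu : ncpoly unit B -> B).
Hypothesis muS : SigmaBD iota mu.
Hypothesis nuS : SigmaB nu.
Hypothesis div : cfree_infinitely_divisible iota mu nu.

Lemma cfree_divisible_free : free_infinitely_divisible nu.
Proof.
move=> N N0; have [muN [nuN [_ nuNS conv]]] := div N0; exists nuN => //.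
have [phi [theta [[phi_ce _] phiE _ cf muE]]] := conv.
exists phi; split=> //; last by move=> f; have [] := muE f.
by move=> m eps a ca; have [] := cf m eps a ca.
Qed.

Lemma cfree_divisible_crho n (f : 'I_n -> ncpoly unit B) :
  (forall i, nc_constant_term (f i) = 0) ->
  mxpositive (gram (crho iota mu nu) f).
Proof.
move=> f0; have [mu_b _ _] := muS; have [nu_ce _] := nuS.
have /choice[mn mnE] : forall k, exists mn : (ncpoly unit B -> D) * (ncpoly unit B -> B),
    [/\ SigmaBD iota mn.1, SigmaB mn.2 & is_cfree_convolution iota
        (fun _ : 'I_k.+1 => mn.1) (fun _ : 'I_k.+1 => mn.2) mu nu].
  by move=> k; have [m [v h]] := div (ltn0Sn k); exists (m, v).
pose mus k := (mn k).1; pose nus k := (mn k).2.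
have mus_b k : unital_bimodule_map iota (mus k) by have [[]] := mnE k.
have nus_ce k : conditional_expectation (nus k) by have [_ []] := mnE k.
have conv k : is_cfree_convolution iota (fun _ : 'I_k.+1 => mus k)
    (fun _ : 'I_k.+1 => nus k) mu nu by have [] := mnE k.
have conv_nu k : is_cfree_convolution (idfun : {lrmorphism B -> B})
    (fun _ : 'I_k.+1 => nus k) (fun _ : 'I_k.+1 => nus k) nu nu.
  apply: free_is_cfree; have [phi [theta [[phi_ce _] phiE _ cf muE]]] := conv k.
  exists phi; split=> //; last by move=> g; have [] := muE g.
  by move=> m eps a ca; have [] := cf m eps a ca.
have small m : word_small nus m.
  elim: m => [|m IH] v //; rewrite ltnS => vm.
  have [h _] := root_expansion (iota := (idfun : {lrmorphism B -> B}))
    nu_ce nu_ce nus_ce nus_ce conv_nu IH vm.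
  exact: h.
have [rho_b _] := crhoP mu_b (bimodule_map_linear nu_ce).
set rho := crho iota mu nu in rho_b *.
have rho_lin := bimodule_map_linear rho_b.
have mus_lin k := bimodule_map_linear (mus_b k).
(* Subtracting the constant terms makes the expansion additive in [g], so that it can be checked on
   words; the corrections vanish on the products [star (f j) * f i]. *)
have expand g : invpoly
    (fun k => k.+1%:R *: (mus k g - iota (nc_constant_term g)))
    (rho g - iota (nc_constant_term g)).
  elim/ncpoly_word_ind: g => [b w|g h IHg IHh|g IHg].
  - have [_ hw] := root_expansion mu_b nu_ce mus_b nus_ce conv (small _) (leqnn (size w)).
    rewrite const_word; have [w0|w0] := eqVneq w [::].
      apply: (eq_invpoly _ _ (@invpoly_cst _ D 0)) => [k|].
        by rewrite w0 xword_nil mulr1 (bimod_coef (mus_b k)) subrr scaler0.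
      by rewrite w0 xword_nil mulr1 (bimod_coef rho_b) subrr.
    apply: (eq_invpoly _ _ (invpolyM (invpoly_cst (iota b)) (hw w0))) => [k|].
      by rewrite rmorph0 subr0 (bimod_left (mus_b k)) scalerAr.
    by rewrite rmorph0 subr0 (bimod_left rho_b).
  - apply: eq_invpoly (invpolyD IHg IHh) => [k|].
      rewrite constD rmorphD (lin_add (mus_lin k)) -scalerDr; congr (_ *: _); nc_ring.
    rewrite constD rmorphD (lin_add rho_lin); nc_ring.
  - apply: eq_invpoly (invpoly_lin (L := fun x => - x) _ IHg) => [k||k x y].
    + rewrite /nc_constant_term !rmorphN (lin_opp (mus_lin k)) -scalerN.
      by congr (_ *: _); nc_ring.
    + rewrite /nc_constant_term !rmorphN (lin_opp rho_lin); nc_ring.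
    + by rewrite opprD scalerN.
apply/mxpositive_ip => x.
apply: (@invpoly_positive R D (fun k => k.+1%:R *: ip x (gram (mus k) f *m x))).
  apply: (@eq_invpoly _ _ (fun k => \sum_j \sum_i star (x j 0) *
     (k.+1%:R *: mus k (star (f j) * f i)) * x i 0)
     _ (\sum_j \sum_i star (x j 0) * rho (star (f j) * f i) * x i 0)).
  - move=> k; rewrite /ip scaler_sumr; apply: eq_bigr => j _.
    rewrite mxE mulr_sumr scaler_sumr; apply: eq_bigr => i _.
    by rewrite mxE -scalerAr -scalerAl mulrA.
  - rewrite /ip; apply: eq_bigr => j _; rewrite mxE mulr_sumr.
    by apply: eq_bigr => i _; rewrite mxE mulrA.
  apply: invpoly_sum => j; apply: invpoly_sum => i.
  apply: invpolyM; last exact: invpoly_cst.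
  apply: invpolyM; first exact: invpoly_cst.
  have c0 : nc_constant_term (star (f j) * f i) = 0 by rewrite constM f0 mulr0.
  apply: eq_invpoly (expand (star (f j) * f i)) => [k|]; by rewrite c0 rmorph0 subr0.
move=> k; apply/positiveP; rewrite -(@rmorph_nat _ _ (real_complex R)).
apply: psdZ; first exact: ler0n.
have [[_ _ pos] _ _] := mnE k; apply/positiveP.
by move: x; apply/mxpositive_ip; exact: pos.
Qed.

End Necessity.

(** * Sufficiency: construction of the roots *)

Section Sufficiency.
Local Open Scope complex_scope.
Variables (R : realType) (B D : cstarAlgType R).
Variables (iota : {lrmorphism B -> D}).
Hypothesis iota_star : forall b, iota (star b) = star (iota b).
Variables (mu : ncpoly unit B -> D) (nu : ncpoly unit B -> B).
Hypothesis muS : SigmaBD iota mu.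
Hypothesis nuS : SigmaB nu.
Hypothesis div : free_infinitely_divisible nu.
Hypothesis pos : forall n (f : 'I_n -> ncpoly unit B), (0 < n)%N ->
  (forall i, nc_constant_term (f i) = 0) -> mxpositive (gram (crho iota mu nu) f).

(** The joint functional reuses the [phi] that witnesses the divisibility of [nu]: its gaps are
    evaluated by [nuN] on one variable and by [nu] on the sum. *)
Lemma crho_divisible_cfree : cfree_infinitely_divisible iota mu nu.
Proof.
move=> N N0; have [nuN nuNS [phi [phi_ce phiE phi_free nuE]]] := div N0.
have [mu_b _ mu_pos] := muS; have [nu_ce _] := nuS; have [nuN_ce _] := nuNS.
have [rho_b rhoE] := crhoP mu_b (bimodule_map_linear nu_ce).
have muE := cmoment_crho mu_b nu_ce.
have rho_pos := pos; set rho := crho iota mu nu in rho_b rhoE muE rho_pos.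
have rho_lin := bimodule_map_linear rho_b.
pose t : R := N%:R^-1; have t0 : 0 <= t by rewrite invr_ge0 ler0n.
have Nt : (N%:R : R[i]) * t%:C = 1.
  by rewrite /t fmorphV rmorph_nat mulfV // pnatr_eq0 -lt0n.
(* The value at 1 is divided by N as well, so [rhoN] need not be unital; the moments involve its
   values on left multiples of X only. *)
pose rhoN f := t%:C *: rho f.
have rhoN_lin : linear rhoN.
  by move=> k x y; rewrite /rhoN rho_lin scalerDr !scalerA mulrC.
have rhoN_right g b : rhoN (g * nccoef unit b) = rhoN g * iota b.
  by rewrite /rhoN (bimod_right' rho_b) scalerAl.
have phi_lin := bimodule_map_linear phi_ce.
pose muN := cmoment iota nuN rhoN.
have muN_b : unital_bimodule_map iota muN.
  exact: (cmoment_bimodule (bimodule_map_linear nuN_ce)).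
(* The first cumulant is the mean of X under [mu], selfadjoint by positivity of the Gram matrix of X
   and 1. *)
have rhoN_X : star (rhoN (ncvar B tt)) = rhoN (ncvar B tt).
  rewrite /rhoN starZ conj_real; congr (_ *: _).
  have -> : rho (ncvar B tt) = mu (ncvar B tt).
    have := rhoE [:: 1] isT; rewrite ckappa_unfold // big_geq // subr0.
    by rewrite xword_cons xword_nil mulr1 rmorph1 mulr1.
  pose g (i : 'I_2) : ncpoly unit B := if i == 0 then ncvar B tt else 1.
  have := mxpositive_star (mu_pos 2%N g) 0 1.
  by rewrite !mxE /g /= star1 mul1r mulr1 nc_star_var => ->.
have rhoN_pos n (f : 'I_n -> ncpoly unit B) : (0 < n)%N ->
    (forall i, nc_constant_term (f i) = 0) -> mxpositive (gram rhoN f).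
  move=> n0 f0; apply/mxpositive_ip => x.
  have -> : ip x (gram rhoN f *m x) = t%:C *: ip x (gram rho f *m x).
    rewrite -ipZr -mul_kscale_l; congr (ip x (_ *m x)).
    by apply/matrixP => i j; rewrite !mxE.
  apply/positiveP/psdZ => //; apply/positiveP; move: x; apply/mxpositive_ip.
  exact: rho_pos.
have muN_gram n (f : 'I_n -> ncpoly unit B) : mxpositive (gram muN f).
  exact: cmoment_gram.
exists muN, nuN; split=> //.
  split=> // f; have [h hE] := mxpositive_sumP (muN_gram 1%N (fun=> f)).
  by exists (h 0 0); have := hE 0 0; rewrite mxE big_ord1.
exists phi, (cmoment iota phi rhoN); split=> //.
- by split=> //; exact: cmoment_bimodule.
- move=> i f; rewrite cmoment_embed //.
  by congr (cmoment iota _ rhoN f); apply/funext => g /=; rewrite phiE.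
- exact: cmoment_cfree.
move=> f; split=> //.
rewrite (cmoment_sum (rho' := rho)) //; first 1 last.
- by move=> g; rewrite /rhoN scalerA Nt scale1r.
- exact: bimod_right'.
rewrite muE; congr (cmoment iota _ rho f); exact/funext.
Qed.

End Sufficiency.

Theorem theorem4p8 (R : realType) (B D : cstarAlgType R)
    (iota : {lrmorphism B -> D}) (iota_incl : unital_inclusion iota)
    (mu : ncpoly unit B -> D) (nu : ncpoly unit B -> B)
    (mu_Sigma : SigmaBD iota mu) (nu_Sigma : SigmaB nu) :
  cfree_infinitely_divisible iota mu nu <->
  free_infinitely_divisible nu /\
  (forall (n : nat) (f : 'I_n -> ncpoly unit B), (0 < n)%N ->
     (forall i, nc_constant_term (f i) = 0%R) ->
     mxpositive (gram (crho iota mu nu) f)).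
Proof.
split=> [div|[div pos]].
  split=> [|n f _]; first exact: cfree_divisible_free div.
  exact: cfree_divisible_crho.
by apply: crho_divisible_cfree => //; exact: inclusion_star.
Qed.
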